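(* Let $n\ge1$, let $p_1,\dots,p_n\in\mathbb{C}^2$ be distinct points, let $k_1,\dots,k_n>0$ and $c,\alpha'\ge0$ be constants such that $$h(z)=c+\alpha'\sum_{i=1}^n\frac{k_i}{|z-p_i|^2}$$ is positive on $U=\mathbb{C}^2\setminus\{p_1,\dots,p_n\}$. On $M=\mathbb{C}\times U$ consider the triple $\omega=\omega_{\mathbb{C}}+h\,\omega_{\mathbb{C}^2}$, $\Omega=h\,\Omega_{\mathbb{C}^3}$, $e^\phi=\sqrt h$. Then the holonomy of the Bismut connection $\nabla^B$ of $(\omega,\Omega,e^\phi)$ is $$\mathrm{Hol}(\nabla^B)=\begin{cases}\{1\}&\text{if }\alpha'=0,\text{ or if }c=0\text{ and }n=1,\\ SU(2)&\text{otherwise,}\end{cases}$$ where $SU(2)\subset SU(3)$ acts trivially on the flat $\mathbb{C}$ factor. In particular, every such solution other than the flat metric ($\alpha'=0$) and the Boothby metric ($c=0$, $n=1$) is not Bismut-flat and has full holonomy $SU(2)$.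
   Context: $\omega_{\mathbb{C}^m}$ and $\Omega_{\mathbb{C}^m}$ denote the standard Kähler form and holomorphic volume form on $\mathbb{C}^m$. For a Hermitian structure $(g,J,\omega)$ with $g=\omega(\cdot,J\cdot)$, put $d^c\omega=-d\omega(J\cdot,J\cdot,J\cdot)$; the Bismut connection is $\nabla^B=\nabla^g-\frac12g^{-1}d^c\omega$ with $\nabla^g$ the Levi-Civita connection. The metric here is the product of the flat metric on $\mathbb{C}$ and $h\,\delta$ on $U$, $\delta$ the Euclidean metric of $\mathbb{C}^2\cong\mathbb{R}^4$. *)

(* Defs.v *)
From HB Require Import structures.
From mathcomp Require Import all_boot all_order all_algebra.
From mathcomp Require Import sesquilinear spectral complex.
From mathcomp Require Import all_classical all_reals all_analysis.

Set Implicit Arguments.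
Unset Strict Implicit.
Unset Printing Implicit Defensive.

Import Order.TTheory GRing.Theory Num.Theory.
Import numFieldNormedType.Exports.

Local Open Scope classical_set_scope.
Local Open Scope complex_scope.
Local Open Scope ring_scope.

(* Tangent vectors at any point are identified with [V := 'cV[R]_d.+1] through
  the coordinate frame.  A connection is given by its matrix-valued one-form
  [A] : nabla_X Y = D_X Y + A x X *m Y. *)

Section Connections.
Variables (R : realType) (d : nat).
Local Notation V := 'cV[R]_d.+1.

Definition coord_vec (i : 'I_d.+1) : V := delta_mx i 0.

(* Normalized so that d(f dx /\ dy) = df /\ dx /\ dy with (a /\ b)(X, Y) =
   a(X) b(Y) - a(Y) b(X). *)
Definition ext_deriv2 (w : V -> V -> V -> R) (x X Y Z : V) : R :=
  'D_X (fun y => w y Y Z) x - 'D_Y (fun y => w y X Z) x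
  + 'D_Z (fun y => w y X Y) x.

Definition hermitian_metric (w : V -> V -> V -> R) (J : V -> 'M[R]_d.+1)
    (x X Y : V) : R :=
  w x X (J x *m Y).

Definition dc_form (w : V -> V -> V -> R) (J : V -> 'M[R]_d.+1)
    (x X Y Z : V) : R :=
  - ext_deriv2 w x (J x *m X) (J x *m Y) (J x *m Z).

Definition gram (g : V -> V -> V -> R) (x : V) : 'M[R]_d.+1 :=
  \matrix_(i, j) g x (coord_vec i) (coord_vec j).

(* [connection_of_symbols G] has (nabla_(d_i) d_j)^k = G x k i j. *)
Definition connection_of_symbols
    (G : V -> 'I_d.+1 -> 'I_d.+1 -> 'I_d.+1 -> R) (x X : V) : 'M[R]_d.+1 :=
  \matrix_(k, j) \sum_i X i 0 * G x k i j.

Definition christoffel (g : V -> V -> V -> R) (x : V) (k i j : 'I_d.+1) : R :=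
  2^-1 * \sum_l invmx (gram g x) k l *
    ('D_(coord_vec i) (fun y => gram g y j l) x
     + 'D_(coord_vec j) (fun y => gram g y i l) x
     - 'D_(coord_vec l) (fun y => gram g y i j) x).

(* The vector (g^-1 H)(X, Y) is the g-dual of the covector H(X, Y, .). *)
Definition raise_last (g : V -> V -> V -> R) (H : V -> V -> V -> V -> R)
    (x : V) (k i j : 'I_d.+1) : R :=
  \sum_l invmx (gram g x) k l *
    H x (coord_vec i) (coord_vec j) (coord_vec l).

Definition bismut (w : V -> V -> V -> R) (J : V -> 'M[R]_d.+1) :
    V -> V -> 'M[R]_d.+1 :=
  let g := hermitian_metric w J in
  connection_of_symbols (fun x k i j =>
    christoffel g x k i j - 2^-1 * raise_last g (dc_form w J) x k i j).

Definition curvature (A : V -> V -> 'M[R]_d.+1) (x X Y : V) : 'M[R]_d.+1 :=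
  'D_X (fun y => A y Y) x - 'D_Y (fun y => A y X) x
  + (A x X *m A x Y - A x Y *m A x X).

Definition flat (M : set V) (A : V -> V -> 'M[R]_d.+1) : Prop :=
  forall x, M x -> forall X Y, curvature A x X Y = 0.

(* Parallel transport along a C^1 curve [0, 1] -> M.  Requiring [c] and [P] to
   be defined beyond [0, 1] is harmless: a C^1 function on a closed interval
   extends to a C^1 function on the line. *)
Definition C1_transport (M : set V) (A : V -> V -> 'M[R]_d.+1)
    (x y : V) (T : 'M[R]_d.+1) : Prop :=
  exists (c : R -> V) (P : R -> 'M[R]_d.+1),
    [/\ forall t, derivable c t 1,
        continuous (derive1 c),
        forall t, 0 <= t <= 1 -> M (c t),
        c 0 = x /\ c 1 = y &
        [/\ P 0 = 1%:M,
            P 1 = T &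
            forall t : R, 0 <= t <= 1 ->
              is_derive t 1 P (- (A (c t) (derive1 c t) *m P t))]].

(* Piecewise C^1 paths are the finite concatenations of C^1 ones. *)
Inductive transport (M : set V) (A : V -> V -> 'M[R]_d.+1) (x : V) :
    V -> 'M[R]_d.+1 -> Prop :=
| transport_refl : transport M A x x 1%:M
| transport_step y z T S :
    transport M A x y T -> C1_transport M A y z S ->
    transport M A x z (S *m T).

Definition holonomy (M : set V) (A : V -> V -> 'M[R]_d.+1) (x : V) :
    set 'M[R]_d.+1 :=
  [set T | transport M A x x T].

End Connections.

(* C^m is R^(2m) with real coordinates ordered (x_1, y_1, ..., x_m, y_m). *)

Section ComplexCoordinates.
Variable R : realType.

Lemma ord_re_subproof m (j : 'I_m) : (j.*2 < m.*2)%N.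
Proof. by rewrite ltn_double. Qed.

Lemma ord_im_subproof m (j : 'I_m) : (j.*2.+1 < m.*2)%N.
Proof. by rewrite ltn_Sdouble. Qed.

Definition ord_re m (j : 'I_m) : 'I_(m.*2) := Ordinal (ord_re_subproof j).
Definition ord_im m (j : 'I_m) : 'I_(m.*2) := Ordinal (ord_im_subproof j).

Definition to_complex m (X : 'cV[R]_(m.*2)) : 'cV[R[i]]_m :=
  \col_j (X (ord_re j) 0 +i* X (ord_im j) 0).

Definition kahler m (X Y : 'cV[R]_(m.*2)) : R :=
  \sum_(j < m) (X (ord_re j) 0 * Y (ord_im j) 0
                - X (ord_im j) 0 * Y (ord_re j) 0).

(* dz_1 /\ ... /\ dz_m *)
Definition hol_volume m (X : m.-tuple 'cV[R]_(m.*2)) : R[i] :=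
  \det (\matrix_(i, j) to_complex (tnth X j) i 0).

Definition SU m : set 'M[R[i]]_m :=
  [set B | B \is unitarymx /\ \det B = 1].

(* SU(2) inside SU(3), acting on the last two coordinates of C^3, seen as a
   set of real endomorphisms of C^3 = R^6. *)
Definition SU2_in_SU3 : set 'M[R]_6 :=
  [set T | exists2 B : 'M[R[i]]_2, SU B &
     forall X : 'cV[R]_6,
       @to_complex 3 (T *m X)
       = (block_mx 1%:M 0 0 B : 'M[R[i]]_(1 + 2)) *m @to_complex 3 X].

End ComplexCoordinates.

Section Solutions.
Variable R : realType.

Record SU3_triple := SU3Triple {
  kform : 'cV[R]_6 -> 'cV[R]_6 -> 'cV[R]_6 -> R;
  volform : 'cV[R]_6 -> 'cV[R]_6 -> 'cV[R]_6 -> 'cV[R]_6 -> R[i];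
  exp_dilaton : 'cV[R]_6 -> R }.

(* The almost complex structure for which [W] has type (3,0); a nowhere
   vanishing decomposable [W] determines it. *)
Definition is_complex_structure
    (W : 'cV[R]_6 -> 'cV[R]_6 -> 'cV[R]_6 -> 'cV[R]_6 -> R[i])
    (M : set 'cV[R]_6) (J : 'cV[R]_6 -> 'M[R]_6) : Prop :=
  forall x, M x ->
    J x *m J x = - 1%:M /\
    forall X Y Z, W x (J x *m X) Y Z = 'i * W x X Y Z.

Definition prC (X : 'cV[R]_6) : 'cV[R]_2 := @usubmx R 2 4 1 X.
Definition prC2 (X : 'cV[R]_6) : 'cV[R]_4 := @dsubmx R 2 4 1 X.

Definition sqnorm (v : 'cV[R]_4) : R := \sum_i v i 0 ^+ 2.

Variables (n : nat) (p : 'I_n -> 'cV[R]_4) (k : 'I_n -> R) (c a : R).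

Definition hfun (z : 'cV[R]_4) : R := c + a * \sum_i k i / sqnorm (z - p i).

Definition Uset : set 'cV[R]_4 := [set z | forall i, z <> p i].
Definition Mset : set 'cV[R]_6 := [set x | Uset (prC2 x)].

Definition solution : SU3_triple := SU3Triple
  (fun x X Y => @kahler R 1 (prC X) (prC Y)
                + hfun (prC2 x) * @kahler R 2 (prC2 X) (prC2 Y))
  (fun x X Y Z => (hfun (prC2 x))%:C * @hol_volume R 3 [tuple X; Y; Z])
  (fun x => Num.sqrt (hfun (prC2 x))).

End Solutions.

Section StandardComplexStructure.
Variable R : realType.

Definition std_J : 'M[R]_6 :=
  \matrix_(i, j) (if ((i : nat) == j.+1) && ~~ odd j then 1
                  else if ((j : nat) == i.+1) && ~~ odd i then - 1
                  else 0).

Lemma to_complex_std_J (X : 'cV[R]_6) :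
  @to_complex R 3 (std_J *m X) = 'i *: @to_complex R 3 X.
Proof.
apply/colP => -[[|[|[|//]]] hj]; rewrite !mxE !big_ord_recl !big_ord0 !mxE /=;
  rewrite ?(mul0r, mul1r, add0r, addr0, sub0r, mulN1r, subr0);
  apply/eqP; rewrite eq_complex /= ?(mul0r, mul1r, add0r, sub0r);
  by apply/andP; split; apply/eqP; try congr (- _); congr (X _ _);
     apply/val_inj.
Qed.

Lemma std_JP (n : nat) (p : 'I_n -> 'cV[R]_4) (k : 'I_n -> R) (c a : R) :
  is_complex_structure (volform (solution p k c a)) (Mset p) (fun=> std_J).
Proof.
move=> x _; split.
  apply/matrixP => -[[|[|[|[|[|[|//]]]]]] hi] -[[|[|[|[|[|[|//]]]]]] hj];
  rewrite !mxE !big_ord_recl big_ord0 !mxE /=;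
  by rewrite ?(mul0r, mulr0, mul1r, mulr1, add0r, addr0, mulrN1, oppr0).
move=> X Y Z; rewrite /= mulrCA; congr (_ * _); rewrite /hol_volume.
pose D : 'rV[R[i]]_3 := \row_j (if j == 0 then 'i else 1).
have -> : 'i = \det (diag_mx D) :> R[i].
  by rewrite det_diag !big_ord_recl big_ord0 !mxE /= !mulr1.
rewrite mulrC -det_mulmx; congr (\det _); apply/matrixP => r s.
rewrite mul_mx_diag !mxE; case: s => -[|[|[|//]]] hs /=.
- have := congr1 (fun v : 'cV[R[i]]_3 => v r 0) (to_complex_std_J X).
  by rewrite !mxE mulrC.
- by rewrite mulr1.
- by rewrite mulr1.
Qed.

End StandardComplexStructure.

(* Main.v *)
(* Identify C^2 with the quaternions.  The Bismut connection is trivial on the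
   flat factor, and on C^2 it is d + (2 h)^-1 dz * conj (grad h), acting by left
   multiplication.  Transport from x to y is therefore left multiplication by a
   quaternion of squared norm h(x) / h(y), and holonomies are unit quaternions,
   that is, elements of SU(2).

   If a = 0 the connection vanishes; if c = 0 and n = 1, left multiplication by
   z - p_1 is a parallel frame.  In the other cases write h = a k_i / |z - p_i|^2
   + g, so that g(p_i) > 0.  In the frame z - p_i the connection is regular at
   p_i, and along z = p_i + r q it equals r^2 (g(p_i) / (a k_i)) conj q dq up to
   O(r^3).  Around the triangle q = 1, 1 + s, 2 with s imaginary, the transport
   is 1 + r^2 (g(p_i) / (a k_i)) s + O(r^3) with a remainder Lipschitz in s, so
   by Banach's fixed point theorem the triangles of a fixed small size r realize
   a neighbourhood of 1 among the unit quaternions.  Taking square roots of unit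
   quaternions repeatedly shows that this neighbourhood generates the group.
   Any x is joined by a segment to such triangles at its nearest centre.

   The connection is not flat because one component of its curvature vanishes at
   p_i + r only if 4 a k_i g(p_i) = O(r). *)
From HB Require Import structures.
Require Import Defs.
From mathcomp Require Import all_boot all_order all_algebra.
From mathcomp Require Import sesquilinear spectral complex.
From mathcomp Require Import ring lra.
From mathcomp Require Import all_classical all_reals all_analysis.
Import Order.TTheory GRing.Theory Num.Theory.
Import numFieldNormedType.Exports.
Local Open Scope classical_set_scope.
Local Open Scope ring_scope.

Set Implicit Arguments.
Unset Strict Implicit.
Unset Printing Implicit Defensive.

(** * Calculus of matrix-valued functions *)

(** [holonomy] consists of exact transports along loops at a given point, so approximating a
    quaternion is not enough: it has to be hit exactly. An expansion in [r] leaves a remainder of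
    which only bounds are known, and for this reason every estimate below comes as a pair, a bound
    and a Lipschitz constant in [s], both uniform in [r] and in time.

    The unknown [s] has three coordinates and a quaternion four. The missing equation is supplied by
    the conservation of [h |Z|^2] under transport: it fixes the norm beforehand, so that matching
    the imaginary part suffices as long as the real part is nonnegative.

    The vertices 1 and 2 are real, so the edge joining them contributes no imaginary part and the
    area swept by the triangle is linear in [s]. The vertex 0, which would be more natural, is the
    centre itself and does not belong to the space. The direction of the real axis is a free unit
    quaternion [eta], because the triangle has to sit on the ray from the centre to the given
    point. *)

Section MatrixCalculus.
Variable R : realType.

Lemma mx_norm_entry m n (M : 'M[R]_(m, n)) i j : `|M i j| <= `|M|.
Proof.
rewrite [leRHS]/Num.Def.normr /= mx_normrE.
exact: (le_bigmax _ (fun ij : 'I_m * 'I_n => `|M ij.1 ij.2|) (i, j)).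
Qed.

Lemma mx_norm_le m n (M : 'M[R]_(m, n)) (e : R) :
  0 <= e -> (forall i j, `|M i j| <= e) -> `|M| <= e.
Proof.
move=> e0 H; rewrite [leLHS]/Num.Def.normr /= mx_normrE.
by apply: bigmax_le => // -[i j] _; exact: H.
Qed.

Lemma mx_norm_mulmx m n p (A : 'M[R]_(m, n)) (B : 'M[R]_(n, p)) :
  `|A *m B| <= n%:R * (`|A| * `|B|).
Proof.
apply: mx_norm_le => [|i j]; first by rewrite !mulr_ge0.
rewrite mxE (le_trans (ler_norm_sum _ _ _)) //.
rewrite -[X in X%:R]card_ord -sum1_card natr_sum mulr_suml ler_sum // => l _.
by rewrite mul1r normrM ler_pM // mx_norm_entry.
Qed.

Lemma is_derive_mxP (V : normedModType R) m n (M : V -> 'M[R]_(m, n)) t v D :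
  is_derive t v M D <-> forall i j, is_derive t v (fun x => M x i j) (D i j).
Proof.
split=> [H i j|H].
  have dM : derivable M t v by [].
  split; first by have /derivable_mxP := dM.
  by have [_ <-] := H; rewrite derive_mx // mxE.
have dM : derivable M t v by apply/derivable_mxP => i j; have [] := H i j.
split=> //; rewrite derive_mx //; apply/matrixP => i j; rewrite mxE.
by have [] := H i j.
Qed.

Lemma is_derive_big (V W : normedModType R) (I : finType) (f : I -> V -> W) x v
    (df : I -> W) : (forall i, is_derive x v (f i) (df i)) ->
  is_derive x v (fun y => \sum_i f i y) (\sum_i df i).
Proof.
move=> H; have -> : (fun y => \sum_i f i y) = \sum_i f i.
  by apply/funext => y; rewrite fct_sumE.
by elim/big_ind2 : _ => // [|a b c d ? ?]; [exact: is_derive_cst|exact: is_deriveD].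
Qed.

Lemma is_derive_mul (V : normedModType R) (f g : V -> R) x v df dg :
  is_derive x v f df -> is_derive x v g dg ->
  is_derive x v (fun y => f y * g y) (df * g x + f x * dg).
Proof.
move=> Hf Hg; have H := is_deriveM Hf Hg.
by apply: is_derive_eq H _; rewrite addrC /GRing.scale /= [g x * df]mulrC.
Qed.

Lemma is_derive_mulmx (V : normedModType R) m n p (A : V -> 'M[R]_(m, n))
    (B : V -> 'M[R]_(n, p)) x v dA dB :
  is_derive x v A dA -> is_derive x v B dB ->
  is_derive x v (fun y => A y *m B y) (dA *m B x + A x *m dB).
Proof.
move=> /is_derive_mxP HA /is_derive_mxP HB; apply/is_derive_mxP => i j.
rewrite !mxE -big_split /=; under eq_fun do rewrite mxE.
by apply: is_derive_big => l; exact: is_derive_mul.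
Qed.

Lemma is_derive_scale (V : normedModType R) m n (f : V -> R)
    (B : V -> 'M[R]_(m, n)) x v df dB :
  is_derive x v f df -> is_derive x v B dB ->
  is_derive x v (fun y => f y *: B y) (df *: B x + f x *: dB).
Proof.
move=> Hf /is_derive_mxP HB; apply/is_derive_mxP => i j.
by rewrite !mxE; under eq_fun do rewrite mxE; exact: is_derive_mul.
Qed.

Lemma is_derive_trmx (V : normedModType R) m n (A : V -> 'M[R]_(m, n)) x v dA :
  is_derive x v A dA -> is_derive x v (fun y => (A y)^T) dA^T.
Proof.
move=> /is_derive_mxP HA; apply/is_derive_mxP => i j.
by rewrite mxE; under eq_fun do rewrite mxE.
Qed.

Lemma is_derive_inv (V : normedModType R) (f : V -> R) x v df :
  f x != 0 -> is_derive x v f df ->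
  is_derive x v (fun y => (f y)^-1) (- df / f x ^+ 2).
Proof.
move=> fx [Hf <-]; split; first exact: derivableV.
by rewrite deriveV // /GRing.scale /= mulNr mulNr mulrC.
Qed.

Lemma is_derive_linear (V : normedModType R) m n p q
    (f : {linear 'M[R]_(m, n) -> 'M[R]_(p, q)}) (A : V -> 'M[R]_(m, n)) x v dA :
  is_derive x v A dA -> is_derive x v (fun y => f (A y)) (f dA).
Proof.
move=> /is_derive_mxP HA.
have E (B : 'M[R]_(m, n)) : f B = \sum_i \sum_j B i j *: f (delta_mx i j).
  rewrite {1}(matrix_sum_delta B) linear_sum; apply: eq_bigr => i _.
  by rewrite linear_sum; apply: eq_bigr => j _; rewrite linearZ.
rewrite [f dA]E; have -> : (fun y => f (A y)) = (fun y => \sum_i \sum_j A y i j *: f (delta_mx i j)).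
  by apply/funext => y; exact: E.
apply: is_derive_big => i; apply: is_derive_big => j.
have H := is_derive_scale (HA i j) (is_derive_cst (f (delta_mx i j)) x v).
by apply: is_derive_eq H _; rewrite scaler0 addr0.
Qed.

Lemma is_derive_continuous (V : normedModType R) (f : R -> V) (t : R) df :
  is_derive t 1 f df -> {for t, continuous f}.
Proof.
by move=> [H _]; apply: differentiable_continuous; apply/derivable1_diffP.
Qed.

Lemma is_derive_within (V : normedModType R) (f f' : R -> V) (a b : R) :
  (forall t, a <= t <= b -> is_derive t 1 f (f' t)) ->
  {within `[a, b], continuous f}.
Proof.
move=> H; apply: continuous_in_subspaceT => t.
by rewrite inE /= in_itv /= => /H/is_derive_continuous.
Qed.

(* Comparison with a scalar majorant replaces the mean value theorem, which
   fails for vector-valued functions. *)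
Lemma derive_majorant m n (D D' : R -> 'M[R]_(m, n)) (e e' : R -> R) :
  (forall t : R, 0 <= t <= 1 -> is_derive t 1 D (D' t)) ->
  (forall t : R, 0 <= t <= 1 -> is_derive t 1 e (e' t)) ->
  (forall t : R, 0 <= t <= 1 -> `|D' t| <= e' t) ->
  forall t : R, 0 <= t <= 1 -> `|D t - D 0| <= e t - e 0.
Proof.
move=> HD He Hle t /andP[t0 t1].
have mono (f f' : R -> R) : (forall s : R, 0 <= s <= 1 -> is_derive s 1 f (f' s)) ->
    (forall s : R, 0 <= s <= 1 -> 0 <= f' s) -> f 0 <= f t.
  move=> Hf Hf'; have sub s : 0 <= s <= t -> 0 <= s <= 1.
    by move=> /andP[-> st]; rewrite (le_trans st).
  have [s sI|s|c + E] := MVT_segment t0 (f := f) (df := f').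
  - by apply: Hf; apply: sub; move: sI; rewrite in_itv /= => /andP[/ltW-> /ltW->].
  - by apply: (is_derive_within (f' := f')) => r /sub /Hf.
  - rewrite in_itv /= => /sub /Hf' fc; rewrite -subr_ge0 E mulr_ge0 //.
    by rewrite subr_ge0.
apply: mx_norm_le => [|i j].
  rewrite subr_ge0; apply: (mono e e' He) => s sI.
  exact: le_trans (Hle _ sI).
(* For each entry, both [e + D i j] and [e - D i j] are nondecreasing, by the scalar mean value
   theorem. *)
rewrite !mxE ler_norml; apply/andP; split.
  have := mono (fun s => D s i j + e s) (fun s => D' s i j + e' s).
  move=> /(_ _ _)/wrap[s sI|s sI|]; last by lra.
    apply: is_deriveD; last exact: He.
    by move/is_derive_mxP : (HD _ sI).
  have := le_trans (mx_norm_entry (D' s) i j) (Hle _ sI).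
  by rewrite ler_norml; lra.
have := mono (fun s => e s - D s i j) (fun s => e' s - D' s i j).
move=> /(_ _ _)/wrap[s sI|s sI|]; last by lra.
  apply: is_deriveB; first exact: He.
  by move/is_derive_mxP : (HD _ sI).
have := le_trans (mx_norm_entry (D' s) i j) (Hle _ sI).
by rewrite ler_norml; lra.
Qed.

(** The majorant is [t * K]. With [K = 0] this says that a function with zero derivative is
    constant, the form in which conservation laws are proved. *)
Lemma derive_bound m n (D D' : R -> 'M[R]_(m, n)) (K : R) :
  (forall t : R, 0 <= t <= 1 -> is_derive t 1 D (D' t)) ->
  (forall t : R, 0 <= t <= 1 -> `|D' t| <= K) ->
  forall t : R, 0 <= t <= 1 -> `|D t - D 0| <= K.
Proof.
move=> HD HK t tI.
have := derive_majorant (e := fun t => t * K) (e' := fun=> K) HD _ HK tI.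
move=> /(_ _)/wrap[s _|].
  have H := @is_derive_mul R id (cst K) s 1 1 0 (is_derive_id _ _) (is_derive_cst _ _ _).
  by apply: is_derive_eq H _; rewrite mulr0 addr0 mul1r.
move=> H; apply: le_trans H _; rewrite mul0r subr0 ler_piMl //; last by lra.
exact: le_trans (HK _ tI).
Qed.

Lemma gronwall_small m n (D D' : R -> 'M[R]_(m, n)) (e : R) :
  (forall t : R, 0 <= t <= 1 -> is_derive t 1 D (D' t)) -> D 0 = 0 ->
  (forall t : R, 0 <= t <= 1 -> `|D' t| <= `|D t| / 2 + e) ->
  forall t : R, 0 <= t <= 1 -> `|D t| <= 2 * e.
Proof.
move=> HD D0 Hle.
have [|c cI cmax] := @EVT_max R (fun t => `|D t|) 0 1 ler01.
  apply: continuous_in_subspaceT => t; rewrite inE /= in_itv /= => tI.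
  apply: (@continuous_comp _ _ _ D (fun x => `|x|)); last exact: norm_continuous.
  exact: is_derive_continuous (HD _ tI).
have bnd t : 0 <= t <= 1 -> `|D t| <= `|D c| / 2 + e.
  move=> tI; rewrite -[D t]subr0 -[0]D0.
  apply: (derive_bound HD) => // s sI; apply: le_trans (Hle _ sI) _.
  have := cmax s; rewrite in_itv /= => /(_ sI); lra.
have := bnd c; rewrite in_itv /= in cI => /(_ cI) cle t tI.
have := bnd _ tI; lra.
Qed.

End MatrixCalculus.

(** * Linear differential equations *)

(** Completeness of matrix spaces underlies both the convergence of Picard iteration and the fixed
    point argument. *)
HB.instance Definition _ (R : realType) (m n : nat) :=
  Uniform_isComplete.Build 'M[R]_(m, n) cauchy_cvg.

Section LinearODE.
Variable R : realType.

(** Precomposition with this retraction extends functions that are controlled only on [0, 1] to the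
    whole line. *)
Definition clamp (t : R) : R := if t < 0 then 0 else if 1 < t then 1 else t.

Lemma clamp_itv t : 0 <= clamp t <= 1.
Proof.
by rewrite /clamp; case: (ltP t 0) => ?; [|case: (ltP 1 t) => ?];
  apply/andP; split; lra.
Qed.

Lemma clamp_id t : 0 <= t <= 1 -> clamp t = t.
Proof. by rewrite /clamp => /andP[? ?]; case: (ltP t 0) => ?; [|case: (ltP 1 t) => ?]; lra. Qed.

Lemma clamp_lip s t : `|clamp s - clamp t| <= `|s - t|.
Proof.
rewrite ler_norml; have := ler_norm (s - t); have := ler_norm (t - s).
rewrite distrC /clamp => ? ?.
by case: (ltP t 0) => ?; [|case: (ltP 1 t) => ?];
  (case: (ltP s 0) => ?; [|case: (ltP 1 s) => ?]); apply/andP; split; lra.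
Qed.

Lemma continuous_clamp (V : normedModType R) (f : R -> V) :
  (forall t : R, 0 <= t <= 1 -> {for t, continuous f}) -> continuous (f \o clamp).
Proof.
move=> cf t; apply: (@continuous_comp _ _ _ clamp f).
  apply/cvgrPdist_lt => e e0; near=> s.
  apply: le_lt_trans (clamp_lip t s) _.
  by near: s; apply: cvgr_dist_lt.
exact: cf (clamp_itv t).
Unshelve. all: by end_near. Qed.

Lemma primitive_exists (f : R -> R) :
  (forall t : R, 0 <= t <= 1 -> {for t, continuous f}) ->
  exists F : R -> R, F 0 = 0 /\ forall t : R, 0 <= t <= 1 -> is_derive t 1 F (f t).
Proof.
move=> cf; set g := f \o clamp; have cg := continuous_clamp cf.
(* Integration starts at -1, and is considered up to 2, so that 0 and 1 are interior points and the
   derivative there is two-sided. *)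
pose G x : R := (\int[lebesgue_measure]_(t in `[-1, x]) (g t))%R.
exists (fun t => G t - G 0); split=> [|t tI]; first by rewrite subrr.
have [||||dG GE] := @continuous_FTC1_closed R g (-1) t 2.
- by lra.
- apply: continuous_compact_integrable; first exact: segment_compact.
  exact: continuous_subspaceT.
- by lra.
- exact: cg.
have dG' : is_derive t 1 G (f t).
  by split=> //; rewrite -derive1E GE /g /= clamp_id.
rewrite -[f t]subr0; exact: is_deriveB.
Qed.

Lemma mx_primitive_exists m n (f : R -> 'M[R]_(m, n)) :
  (forall t : R, 0 <= t <= 1 -> {for t, continuous f}) ->
  exists F : R -> 'M[R]_(m, n),
    F 0 = 0 /\ forall t : R, 0 <= t <= 1 -> is_derive t 1 F (f t).
Proof.
move=> cf.
have H (ij : 'I_m * 'I_n) : exists F : R -> R,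
    F 0 = 0 /\ forall t : R, 0 <= t <= 1 -> is_derive t 1 F (f t ij.1 ij.2).
  apply: primitive_exists => t tI.
  apply: (@continuous_comp _ _ _ f (fun M : 'M[R]_(m, n) => M ij.1 ij.2)).
    exact: cf.
  exact: coord_continuous.
have [F HF] := choice H.
exists (fun t => \matrix_(i, j) F (i, j) t); split.
  by apply/matrixP => i j; rewrite !mxE; have [] := HF (i, j).
move=> t tI; apply/is_derive_mxP => i j; under eq_fun do rewrite mxE.
by have [_ /(_ _ tI)] := HF (i, j).
Qed.

Lemma mulmx_continuous_at m n p (A : R -> 'M[R]_(m, n)) (B : R -> 'M[R]_(n, p)) (t : R) :
  {for t, continuous A} -> {for t, continuous B} ->
  {for t, continuous (fun s => A s *m B s)}.
Proof.
move=> cA cB.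
have cC k l (C : R -> 'M[R]_(k, l)) i j : {for t, continuous C} ->
    {for t, continuous (fun s => C s i j)}.
  move=> cC; apply: (@continuous_comp _ _ _ C (fun M : 'M[R]_(k, l) => M i j)) => //.
  exact: coord_continuous.
apply/cvgrPdist_le => e e0.
have H (ij : 'I_m * 'I_p) : \forall s \near t,
    `|(A t *m B t) ij.1 ij.2 - (A s *m B s) ij.1 ij.2| <= e.
  have : (fun s => (A s *m B s) ij.1 ij.2) @ t --> (A t *m B t) ij.1 ij.2.
    rewrite mxE; have -> : (fun s => (A s *m B s) ij.1 ij.2) =
        \sum_l (fun s => A s ij.1 l * B s l ij.2).
      by apply/funext => s; rewrite mxE fct_sumE.
    elim/big_ind2 : _ => [|f a g b Hf Hg|l _]; first exact: cvg_cst.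
      exact: cvgD Hf Hg.
    by apply: cvgM; [exact: cC|exact: cC].
  by move/cvgrPdist_le; apply.
near=> s; have Hs : forall ij : 'I_m * 'I_p,
    `|(A t *m B t) ij.1 ij.2 - (A s *m B s) ij.1 ij.2| <= e.
  by near: s; apply: filter_forall => ij; exact: H.
apply: mx_norm_le; first exact: ltW.
by move=> i j; have := Hs (i, j); rewrite [(A t *m B t - _) i j]mxE [(- (A s *m B s)) i j]mxE.
Unshelve. all: by end_near. Qed.

Lemma continuous_bounded m n (B : R -> 'M[R]_(m, n)) :
  (forall t : R, 0 <= t <= 1 -> {for t, continuous B}) ->
  exists2 K : R, 0 <= K & forall t : R, 0 <= t <= 1 -> `|B t| <= K.
Proof.
move=> cB; have [|c _ cmax] := @EVT_max R (fun t => `|B t|) 0 1 ler01.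
  apply: continuous_in_subspaceT => t; rewrite inE /= in_itv /= => tI.
  apply: (@continuous_comp _ _ _ B (fun x => `|x|)); last exact: norm_continuous.
  exact: cB.
by exists `|B c| => // t tI; apply: cmax; rewrite in_itv.
Qed.

(** Picard iteration, measured in the weighted norm [sup |X t| / expR (2 * K * t)]. In it the
    integral operator contracts by 1/2 on the whole of [0, 1], so the interval need not be
    subdivided. *)
Lemma lin_ode_exists n (B : R -> 'M[R]_n) :
  (forall t : R, 0 <= t <= 1 -> {for t, continuous B}) ->
  exists P : R -> 'M[R]_n, P 0 = 1%:M /\
    forall t : R, 0 <= t <= 1 -> is_derive t 1 P (B t *m P t).
Proof.
move=> cB; have [K0 K00 BK0] := continuous_bounded cB.
pose K := n%:R * K0 + 1.
have K_gt0 : 0 < K by rewrite ltr_pwDr // mulr_ge0.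
have BK m (t : R) (X : 'M[R]_(n, m)) : 0 <= t <= 1 -> `|B t *m X| <= K * `|X|.
  move=> tI; apply: le_trans (mx_norm_mulmx _ _) _; rewrite mulrA ler_wpM2r //.
  by rewrite (le_trans (ler_wpM2l _ (BK0 _ tI))) // lerDl.
pose is_int (X Y : R -> 'M[R]_n) := Y 0 = 1%:M /\
  forall t : R, 0 <= t <= 1 -> is_derive t 1 Y (B t *m X t).
pose cont (X : R -> 'M[R]_n) := forall t : R, 0 <= t <= 1 -> {for t, continuous X}.
have int_ex X : cont X -> exists Y, is_int X Y.
  move=> cX; have [t tI|F [F0 dF]] := @mx_primitive_exists n n (fun t => B t *m X t).
    by apply: mulmx_continuous_at; [exact: cB|exact: cX].
  exists (fun t => 1%:M + F t); split=> [|t tI]; first by rewrite F0 addr0.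
  rewrite -[B t *m X t]add0r; apply: is_deriveD; last exact: dF.
have int_cont X Y : is_int X Y -> cont Y.
  by move=> [_ dY] t tI; exact: is_derive_continuous (dY _ tI).
(* Choice requires a total operator; at discontinuous [X] its value is arbitrary. *)
have /choice[T HT] : forall X, exists Y, cont X -> is_int X Y.
  move=> X; have [cX|ncX] := pselect (cont X); last by exists X.
  by have [Y HY] := int_ex _ cX; exists Y.
pose P := fix P k := if k is k'.+1 then T (P k') else fun=> 1%:M.
have cP k : cont (P k).
  elim: k => [|k IHk] /=; last exact: int_cont (HT _ IHk).
  by move=> t _; exact: cst_continuous.
have iP k : is_int (P k) (P k.+1) by exact: HT.
pose E (t : R) := expR (2 * K * t).
have dE (c : R) (t : R) : is_derive t 1 (fun t => c * E t) (c * (2 * K * E t)).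
  have H1 : is_derive t 1 (fun t => 2 * K * t) (2 * K).
    have H := @is_derive_mul R R (cst (2 * K)) id t 1 0 1 (is_derive_cst _ _ _) (is_derive_id _ _).
    by apply: is_derive_eq H _; rewrite mul0r add0r mulr1.
  have H2 := is_derive1_comp (is_derive_expR (2 * K * t)) H1.
  have H := @is_derive_mul R R (cst c) E t 1 0 _ (is_derive_cst _ _ _) H2.
  by apply: is_derive_eq H _; rewrite mul0r add0r /= -/(E t) [E t * _]mulrC.
have Egt0 t : 0 < E t by exact: expR_gt0.
have E1 t : 0 <= t <= 1 -> 1 <= E t.
  by move=> /andP[t0 _]; rewrite -expR0 ler_expR !mulr_ge0 // ltW.
(* The contraction: [c / 2 * E] has derivative [c * K * E], which majorizes [B *m (X - X')]. *)
have int_diff X X' Y Y' (c : R) : is_int X Y -> is_int X' Y' ->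
    (forall t, 0 <= t <= 1 -> `|X t - X' t| <= c * E t) ->
    forall t, 0 <= t <= 1 -> `|Y t - Y' t| <= c / 2 * E t.
  move=> [Y0 dY] [Y'0 dY'] XX' t tI.
  have c0 : 0 <= c.
    by rewrite -(pmulr_lge0 _ (Egt0 t)) (le_trans _ (XX' t tI)).
  have := @derive_majorant R n n (fun t => Y t - Y' t)
    (fun t => B t *m X t - B t *m X' t) (fun t => c / 2 * E t)
    (fun t => c / 2 * (2 * K * E t)).
  move=> /(_ _ _ _)/wrap[s sI|s sI|/(_ t tI)].
  - exact: (is_deriveB (dY _ sI) (dY' _ sI)).
  - rewrite -mulmxBr (le_trans (BK _ _ _ sI)) // (le_trans (ler_wpM2l (ltW K_gt0) (XX' _ sI))) //.
    by rewrite le_eqVlt; apply/orP; left; apply/eqP; field.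
  - rewrite Y0 Y'0 subrr subr0 => H; apply: le_trans H _.
    by rewrite gerBl mulr_ge0 ?divr_ge0 // ltW.
have dP k : forall t, 0 <= t <= 1 -> `|P k.+1 t - P k t| <= K / 2 ^+ k * E t.
  elim: k => [|k IHk] t tI.
    have [P10 dP1] := iP 0%N; rewrite expr0 divr1.
    have := derive_bound (K := K) dP1 _ tI; rewrite P10 /=.
    move=> /(_ _)/wrap[s sI|H].
      rewrite (le_trans (BK _ _ _ sI)) // ler_piMr ?(ltW K_gt0) //.
      apply: mx_norm_le => // i j; rewrite mxE; case: (i == j) => /=.
        by rewrite normr1.
      by rewrite normr0.
    by rewrite (le_trans H) // ler_peMr ?E1 // ltW.
  have := int_diff _ _ _ _ _ (iP k.+1) (iP k) IHk t tI.
  by rewrite exprS invfM [_^-1 * _]mulrC mulrA.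
pose C := K * expR (2 * K).
have dPC k t : 0 <= t <= 1 -> `|P k.+1 t - P k t| <= C / 2 ^+ k.
  move=> tI; apply: le_trans (dP k t tI) _.
  rewrite -mulrAC ler_wpM2r ?invr_ge0 ?exprn_ge0 // ler_wpM2l ?(ltW K_gt0) //.
  rewrite ler_expR ler_piMr ?mulr_ge0 ?(ltW K_gt0) //; lra.
have C0 : 0 <= C by rewrite mulr_ge0 ?expR_ge0 // ltW.
have tail k m t : 0 <= t <= 1 -> `|P (m + k)%N t - P k t| <= 2 * C / 2 ^+ k * (1 - 1 / 2 ^+ m).
  move=> tI; elim: m => [|m IHm].
    by rewrite add0n subrr normr0 expr0 divr1 subrr mulr0.
  rewrite addSn -(subrKA (P (m + k)%N t)) (le_trans (ler_normD _ _)) //.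
  apply: le_trans (lerD (dPC _ _ tI) IHm) _.
  rewrite exprD exprS le_eqVlt; apply/orP; left; apply/eqP; field.
  by rewrite !expf_neq0.
(* The iterates are controlled only on [0, 1]; clamping makes the limit continuous from both sides
   at the endpoints too. *)
pose Q t := limn (fun k => P k (clamp t)).
have cvgP t : 0 <= t <= 1 -> cvgn (fun k => P k t).
  move=> tI; pose u k := P k t.
  have Eu : u = (fun k => u 0%N + series (telescope u) k).
    by apply/funext => k; rewrite -eq_sum_telescope.
  rewrite -/u Eu; apply: is_cvgD; first exact: is_cvg_cst.
  apply: normed_cvg; apply: (@series_le_cvg _ _ (geometric C 2^-1)).
  - by move=> k; exact: normr_ge0.
  - by move=> k; rewrite /geometric /= mulr_ge0 // exprn_ge0.
  - by move=> k; rewrite /geometric /= exprVn dPC.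
  - by apply: is_cvg_geometric_series; rewrite ger0_norm //; lra.
have PQ k t : 0 <= t <= 1 -> `|Q t - P k t| <= 2 * C / 2 ^+ k.
  move=> tI; rewrite /Q clamp_id //; apply/ler_addgt0Pl => e e0.
  have /cvgrPdist_le /(_ _ e0) [N _ HN] := cvgP t tI.
  rewrite -(subrKA (P (N + k)%N t)) (le_trans (ler_normD _ _)) // lerD //.
    by apply: HN => /=; exact: leq_addr.
  apply: le_trans (tail _ _ _ tI) _.
  have D0 : 0 <= 1 / 2 ^+ N :> R by rewrite divr_ge0 // exprn_ge0.
  apply: ler_piMr.
    by rewrite divr_ge0 // ?exprn_ge0 // mulr_ge0.
  by rewrite gerBl.
have small e : 0 < e -> exists k, 2 * C / 2 ^+ k < e.
  move=> e0; have := @cvg_geometric R (2 * C) 2^-1.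
  rewrite ger0_norm // => /(_ _)/wrap[|/cvgrPdist_lt /(_ _ e0) [N _ /(_ N (leqnn N))]].
    lra.
  rewrite /= sub0r normrN /geometric /= exprVn => H; exists N.
  exact: le_lt_trans (ler_norm _) H.
have cQ : cont Q.
  move=> t tI; apply/cvgrPdist_lt => e e0.
  have [k Hk] := small (e / 3) (divr_gt0 e0 (ltr0n _ 3)).
  have QE s : `|Q s - P k (clamp s)| < e / 3.
    have -> : Q s = Q (clamp s) by rewrite /Q (clamp_id (clamp_itv s)).
    exact: le_lt_trans (PQ _ _ (clamp_itv s)) Hk.
  near=> s.
  have H : `|P k (clamp t) - P k (clamp s)| < e / 3.
    near: s; have := continuous_clamp (cP k) (x := t).
    by move/cvgrPdist_lt; apply; rewrite divr_gt0.
  have -> : Q t - Q s = (Q t - P k (clamp t)) + (P k (clamp t) - P k (clamp s))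
      - (Q s - P k (clamp s)).
    by rewrite opprB subrKA subrKA.
  apply: le_lt_trans (ler_normB _ _) _.
  have := ler_normD (Q t - P k (clamp t)) (P k (clamp t) - P k (clamp s)).
  have := QE t; have := QE s; lra.
(* [Q] is so far merely continuous. Its integral [Y] is differentiable, and it equals [Q] because
   both are limits of [P k.+1]. *)
have [Y iY] := int_ex _ cQ; have [Y0 dY] := iY.
exists Y; split=> // t tI; suff <- : Q t = Y t by exact: dY.
apply/eqP; rewrite -subr_eq0 -normr_le0; apply/ler_addgt0Pl => e e0; rewrite addr0.
pose W := 1 + expR (2 * K); have W0 : 0 < W by rewrite addr_gt0 ?expR_gt0.
have [k Hk] := small (e / W) (divr_gt0 e0 W0).
have EW s : 0 <= s <= 1 -> E s <= expR (2 * K).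
  by move=> sI; rewrite ler_expR ler_piMr ?mulr_ge0 ?(ltW K_gt0) //; lra.
have := int_diff _ _ _ _ (2 * C / 2 ^+ k) iY (iP k) _ t tI => /(_ _)/wrap[s sI|H2].
  by rewrite (le_trans (PQ k s sI)) // ler_peMr ?E1 // divr_ge0 // mulr_ge0.
have H1 := PQ k.+1 t tI.
rewrite -(subrKA (P k.+1 t)) (le_trans (ler_normD _ _)) // distrC [`|_ - Y t|]distrC.
rewrite distrC (le_trans (lerD H1 H2)) //.
have D0 : 0 <= 2 * C / 2 ^+ k by rewrite divr_ge0 // mulr_ge0.
apply: (@le_trans _ _ (2 * C / 2 ^+ k * W)); last by rewrite -ler_pdivlMr // ltW.
have -> : 2 * C / 2 ^+ k.+1 = 2 * C / 2 ^+ k / 2.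
  by rewrite exprS invfM mulrA mulrAC.
rewrite mulrDr mulr1 lerD //; first by lra.
apply: ler_pM => //; [by rewrite divr_ge0|by rewrite ltW|by lra|exact: EW].
Unshelve. all: by end_near. Qed.

End LinearODE.

(** * Quaternions and SU(2) *)

Section Quaternions.
Variable R : realType.
Local Notation quat := 'cV[R]_4.

Definition o0 : 'I_4 := @Ordinal 4 0 isT.
Definition o1 : 'I_4 := @Ordinal 4 1 isT.
Definition o2 : 'I_4 := @Ordinal 4 2 isT.
Definition o3 : 'I_4 := @Ordinal 4 3 isT.

Lemma forall_ord4 (P : 'I_4 -> Prop) : P o0 -> P o1 -> P o2 -> P o3 -> forall i, P i.
Proof.
move=> P0 P1 P2 P3 [[|[|[|[|//]]]] hi].
- by have -> : Ordinal hi = o0 by apply/val_inj.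
- by have -> : Ordinal hi = o1 by apply/val_inj.
- by have -> : Ordinal hi = o2 by apply/val_inj.
- by have -> : Ordinal hi = o3 by apply/val_inj.
Qed.

Lemma sum_ord4 (V : nmodType) (F : 'I_4 -> V) : \sum_i F i = F o0 + F o1 + F o2 + F o3.
Proof.
by rewrite !big_ord_recl big_ord0 addr0 !addrA; do !congr (_ + _); congr (F _); apply/val_inj.
Qed.

(* Left multiplication by the quaternion z1 + j z2, where [q] lists the real
   coordinates (x1, y1, x2, y2) of (z1, z2). *)
Definition lmul_mx (q : quat) : 'M[R]_4 := \matrix_(i, j)
  match val i, val j with
  | 0%N, 0%N => q o0 0 | 0%N, 1%N => - q o1 0 | 0%N, 2%N => - q o2 0 | 0%N, _ => - q o3 0
  | 1%N, 0%N => q o1 0 | 1%N, 1%N => q o0 0 | 1%N, 2%N => q o3 0 | 1%N, _ => - q o2 0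
  | 2%N, 0%N => q o2 0 | 2%N, 1%N => - q o3 0 | 2%N, 2%N => q o0 0 | 2%N, _ => q o1 0
  | _, 0%N => q o3 0 | _, 1%N => q o2 0 | _, 2%N => - q o1 0 | _, _ => q o0 0
  end.

(** Right multiplication in the basis 1, i, j, ji. As ji = -k, signs involving the last vector
    differ from the usual table. *)
Definition rmul_mx (q : quat) : 'M[R]_4 := \matrix_(i, j)
  match val i, val j with
  | 0%N, 0%N => q o0 0 | 0%N, 1%N => - q o1 0 | 0%N, 2%N => - q o2 0 | 0%N, _ => - q o3 0
  | 1%N, 0%N => q o1 0 | 1%N, 1%N => q o0 0 | 1%N, 2%N => - q o3 0 | 1%N, _ => q o2 0
  | 2%N, 0%N => q o2 0 | 2%N, 1%N => q o3 0 | 2%N, 2%N => q o0 0 | 2%N, _ => - q o1 0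
  | _, 0%N => q o3 0 | _, 1%N => - q o2 0 | _, 2%N => q o1 0 | _, _ => q o0 0
  end.

Definition qconj (q : quat) : quat := \col_i (if i == o0 then q i 0 else - q i 0).

Definition qone : quat := delta_mx o0 0.

Definition dotp (p q : quat) : R := \sum_i p i 0 * q i 0.

Lemma dotpE (p q : quat) : dotp p q = p o0 0 * q o0 0 + p o1 0 * q o1 0 + p o2 0 * q o2 0 + p o3 0 * q o3 0.
Proof. exact: sum_ord4. Qed.

Lemma sqnormE (q : quat) : sqnorm q = q o0 0 ^+ 2 + q o1 0 ^+ 2 + q o2 0 ^+ 2 + q o3 0 ^+ 2.
Proof. exact: sum_ord4. Qed.

Lemma sqnorm_dotp (q : quat) : sqnorm q = dotp q q.
Proof. by apply: eq_bigr => i _; rewrite expr2. Qed.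

Lemma dotpC (p q : quat) : dotp p q = dotp q p.
Proof. by apply: eq_bigr => i _; rewrite mulrC. Qed.

Lemma dotpDr (p q r : quat) : dotp p (q + r) = dotp p q + dotp p r.
Proof. by rewrite -big_split /=; apply: eq_bigr => i _; rewrite !mxE mulrDr. Qed.

Lemma dotpZr (c : R) (p q : quat) : dotp p (c *: q) = c * dotp p q.
Proof. by rewrite mulr_sumr; apply: eq_bigr => i _; rewrite !mxE mulrCA. Qed.

Lemma dotp_sumr (I : finType) (p : quat) (q : I -> quat) :
  dotp p (\sum_i q i) = \sum_i dotp p (q i).
Proof.
rewrite exchange_big /=; apply: eq_bigr => j _.
by rewrite summxE mulr_sumr.
Qed.

Lemma sqnorm_ge0 (q : quat) : 0 <= sqnorm q.
Proof. by apply: sumr_ge0 => i _; exact: sqr_ge0. Qed.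

Lemma sqnorm_eq0 (q : quat) : (sqnorm q == 0) = (q == 0).
Proof.
apply/idP/eqP => [|->]; last by rewrite /sqnorm big1 // => i _; rewrite mxE expr0n.
rewrite psumr_eq0 => [/allP H|i _]; last exact: sqr_ge0.
apply/matrixP => i j; rewrite ord1 mxE; apply/eqP; rewrite -sqrf_eq0.
by apply: H; rewrite mem_index_enum.
Qed.

Lemma sqnorm_gt0 (q : quat) : q != 0 -> 0 < sqnorm q.
Proof. by move=> q0; rewrite lt_def sqnorm_ge0 sqnorm_eq0 q0. Qed.

Lemma sqnormZ (c : R) (q : quat) : sqnorm (c *: q) = c ^+ 2 * sqnorm q.
Proof. by rewrite mulr_sumr; apply: eq_bigr => i _; rewrite mxE exprMn. Qed.

Local Ltac mx4 := apply/matrixP; apply: forall_ord4; apply: forall_ord4;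
  rewrite ?(mxE, sum_ord4, sqnormE) /= ?mxE /=; try by ring.

Lemma lmul_mx_is_linear : linear lmul_mx.
Proof. by move=> a p q; mx4. Qed.

HB.instance Definition _ := GRing.isLinear.Build R quat 'M[R]_4 _ lmul_mx lmul_mx_is_linear.

Lemma lmul_entry (p q : quat) :
  [/\ (lmul_mx p *m q) o0 0 =
        p o0 0 * q o0 0 - p o1 0 * q o1 0 - p o2 0 * q o2 0 - p o3 0 * q o3 0,
      (lmul_mx p *m q) o1 0 =
        p o1 0 * q o0 0 + p o0 0 * q o1 0 + p o3 0 * q o2 0 - p o2 0 * q o3 0,
      (lmul_mx p *m q) o2 0 =
        p o2 0 * q o0 0 - p o3 0 * q o1 0 + p o0 0 * q o2 0 + p o1 0 * q o3 0 &
      (lmul_mx p *m q) o3 0 =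
        p o3 0 * q o0 0 + p o2 0 * q o1 0 - p o1 0 * q o2 0 + p o0 0 * q o3 0].
Proof. by split; rewrite mxE sum_ord4 !mxE /=; ring. Qed.

Lemma lmul_mxM (p q : quat) : lmul_mx (lmul_mx p *m q) = lmul_mx p *m lmul_mx q.
Proof.
have [E0 E1 E2 E3] := lmul_entry p q.
apply/matrixP; apply: forall_ord4; apply: forall_ord4;
  by rewrite [LHS]mxE /= ?(E0, E1, E2, E3) [RHS]mxE sum_ord4 !mxE /=; ring.
Qed.

Lemma lmul_mx_tr (q : quat) : (lmul_mx q)^T = lmul_mx (qconj q).
Proof. by mx4. Qed.

Lemma lmul_mxK (q : quat) : (lmul_mx q)^T *m lmul_mx q = (sqnorm q)%:M.
Proof. by mx4. Qed.

Lemma lmul_mxKr (q : quat) : lmul_mx q *m (lmul_mx q)^T = (sqnorm q)%:M.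
Proof. by mx4. Qed.

(** Polarization of p conj(p) = |p|^2; it is what makes the connection metric. *)
Lemma lmul_mx_polar (p q : quat) :
  lmul_mx p *m (lmul_mx q)^T + lmul_mx q *m (lmul_mx p)^T = (2 * dotp p q)%:M.
Proof. by rewrite dotpE; mx4. Qed.

Lemma lmul_rmulC (p q : quat) : lmul_mx p *m rmul_mx q = rmul_mx q *m lmul_mx p.
Proof. by mx4. Qed.

Local Ltac vec4 := apply/colP; apply: forall_ord4;
  rewrite ?(mxE, sum_ord4, sqnormE) /= ?mxE /=; try by ring.

Lemma lmul_mx1 (q : quat) : lmul_mx q *m qone = q.
Proof. by vec4. Qed.

Lemma rmul_mx1 (q : quat) : rmul_mx q *m qone = q.
Proof. by vec4. Qed.

Lemma lmul_rmul (p q : quat) : lmul_mx p *m q = rmul_mx q *m p.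
Proof. by vec4. Qed.

Lemma lmul_mx_qone : lmul_mx qone = 1%:M.
Proof. by mx4. Qed.

Lemma sqnorm_qone : sqnorm qone = 1.
Proof. by rewrite sqnormE !mxE /=; ring. Qed.

Lemma sqnorm_lmul (p q : quat) : sqnorm (lmul_mx p *m q) = sqnorm p * sqnorm q.
Proof. by have [E0 E1 E2 E3] := lmul_entry p q; rewrite !sqnormE E0 E1 E2 E3; ring. Qed.

Lemma sqnorm_conj (q : quat) : sqnorm (qconj q) = sqnorm q.
Proof. by rewrite !sqnormE !mxE /=; ring. Qed.

Lemma lmul_mx_inj : injective lmul_mx.
Proof. by move=> p q pq; rewrite -(lmul_mx1 p) pq lmul_mx1. Qed.

(** A map that commutes with right multiplications is determined by its value at 1: M q = M (1 q) =
    (M 1) q. Transports are recognized as left multiplications in this way, without solving for the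
    quaternion. *)
Lemma commutant_rmul (M : 'M[R]_4) :
  (forall q, M *m rmul_mx q = rmul_mx q *m M) -> M = lmul_mx (M *m qone).
Proof.
move=> H.
suff E : forall q : quat, M *m q = lmul_mx (M *m qone) *m q.
  apply/matrixP => i j.
  have := congr1 (fun v : quat => v i 0) (E (delta_mx j 0)).
  by rewrite -!colE !mxE.
by move=> q; rewrite lmul_rmul mulmxA -H -mulmxA rmul_mx1.
Qed.

End Quaternions.

(** * Square roots of unit quaternions *)

Section SquareRoot.
Variable R : realType.
Local Notation quat := 'cV[R]_4.

Local Ltac vec4 := apply/colP; apply: forall_ord4;
  rewrite ?(mxE, sum_ord4, sqnormE) /= ?mxE /=; try by ring.

(** Half-angle formula: if the real part of [q] is cos t and [c] = cos (t / 2) >= 0, then 1 - cos t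
    = 2 (1 - c) (1 + c) >= 2 (1 - c). The defect [1 - q o0 0], which measures the distance to 1, is
    thus at least halved. *)
Lemma sqrt_unit_quat (q : quat) : sqnorm q = 1 ->
  exists2 r : quat, sqnorm r = 1 & lmul_mx r *m r = q /\ 2 * (1 - r o0 0) <= 1 - q o0 0.
Proof.
(* At [q = -1] the formula would divide by [c = 0]; there any imaginary unit is a root. *)
move=> q1; have [qm1|qm1] := eqVneq (q o0 0) (-1).
  have := q1; rewrite sqnormE qm1 sqrrN expr1n => /eqP.
  rewrite -!addrA -subr_eq0 addrAC subrr add0r => /eqP z.
  have [z1 [z2 z3]] : q o1 0 = 0 /\ q o2 0 = 0 /\ q o3 0 = 0.
    have := sqr_ge0 (q o1 0); have := sqr_ge0 (q o2 0); have := sqr_ge0 (q o3 0).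
    move=> a3 a2 a1; split; [|split]; apply/eqP; rewrite -sqrf_eq0; apply/eqP; lra.
  exists (delta_mx o1 0); first by rewrite sqnormE !mxE /=; ring.
  split; last by rewrite mxE /=; lra.
  by vec4; rewrite ?qm1 ?z1 ?z2 ?z3; ring.
have qlt : -1 < q o0 0.
  rewrite lt_def qm1 /=; have : q o0 0 ^+ 2 <= 1.
    have := q1; rewrite sqnormE.
    have := sqr_ge0 (q o1 0); have := sqr_ge0 (q o2 0); have := sqr_ge0 (q o3 0); lra.
  nra.
pose c := Num.sqrt ((1 + q o0 0) / 2).
have c2 : c ^+ 2 = (1 + q o0 0) / 2 by rewrite sqr_sqrtr //; lra.
have c0 : 0 < c by rewrite sqrtr_gt0; lra.
have cn0 : c != 0 by rewrite gt_eqF.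
have qle : q o0 0 = 2 * c ^+ 2 - 1 by rewrite c2; lra.
pose r : quat := \col_i (if i == o0 then c else q i 0 / (2 * c)).
exists r.
  have E : q o1 0 ^+ 2 + q o2 0 ^+ 2 + q o3 0 ^+ 2 = 1 - (2 * c ^+ 2 - 1) ^+ 2.
    by rewrite -qle -q1 sqnormE; ring.
  rewrite sqnormE !mxE /= !expr_div_n.
  have -> : c ^+ 2 + q o1 0 ^+ 2 / (2 * c) ^+ 2 + q o2 0 ^+ 2 / (2 * c) ^+ 2
      + q o3 0 ^+ 2 / (2 * c) ^+ 2 = c ^+ 2 + (q o1 0 ^+ 2 + q o2 0 ^+ 2 + q o3 0 ^+ 2) / (2 * c) ^+ 2.
    by rewrite !mulrDl !addrA.
  by rewrite E; field.
split.
  have E : q o1 0 ^+ 2 + q o2 0 ^+ 2 + q o3 0 ^+ 2 = 1 - (2 * c ^+ 2 - 1) ^+ 2.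
    by rewrite -qle -q1 sqnormE; ring.
  vec4; rewrite ?mxE /=; last 3 first.
  - by field.
  - by field.
  - by field.
  have -> : c * c + - (q o1 0 / (2 * c)) * (q o1 0 / (2 * c)) + - (q o2 0 / (2 * c)) * (q o2 0 / (2 * c))
     + - (q o3 0 / (2 * c)) * (q o3 0 / (2 * c)) =
     c ^+ 2 - (q o1 0 ^+ 2 + q o2 0 ^+ 2 + q o3 0 ^+ 2) / (2 * c) ^+ 2 by field.
  by rewrite E qle; field.
rewrite mxE /= qle; have c1 : c <= 1; last by nra.
have : c ^+ 2 <= 1; last nra.
have := q1; rewrite sqnormE.
have := sqr_ge0 (q o1 0); have := sqr_ge0 (q o2 0); have := sqr_ge0 (q o3 0); nra.
Qed.

End SquareRoot.

(** * Unit quaternions as SU(2) *)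

Section SU2.
Variable R : realType.
Local Notation quat := 'cV[R]_4.

Definition act (q : quat) : 'M[R]_6 := block_mx (1%:M : 'M[R]_2) 0 0 (lmul_mx q).

(** Left multiplication by z1 + j z2 is complex linear when C acts from the right; its matrix has
    rows (z1, - conj z2) and (z2, conj z1). *)
Definition su2_mx (q : quat) : 'M[R[i]]_2 := \matrix_(i, j)
  match val i, val j with
  | 0%N, 0%N => Complex (q o0 0) (q o1 0)
  | 0%N, _ => Complex (- q o2 0) (q o3 0)
  | _, 0%N => Complex (q o2 0) (q o3 0)
  | _, _ => Complex (q o0 0) (- q o1 0)
  end.

Lemma to_complex_inj : injective (@to_complex R 3).
Proof.
move=> X Y E; apply/matrixP => i j; rewrite (ord1 j) {j}.
have H k : X (ord_re k) 0 = Y (ord_re k) 0 /\ X (ord_im k) 0 = Y (ord_im k) 0.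
  by have := congr1 (fun v : 'cV[R[i]]_3 => v k 0) E; rewrite !mxE; case.
have hk : (i./2 < 3)%N by case: i => -[|[|[|[|[|[|//]]]]]].
have [Hre Him] := H (Ordinal hk).
have [oi|ei] := boolP (odd i).
  suff <- : ord_im (Ordinal hk) = i by [].
  by apply/val_inj => /=; rewrite -[RHS]odd_double_half oi.
suff <- : ord_re (Ordinal hk) = i by [].
by apply/val_inj => /=; rewrite -[RHS]odd_double_half (negbTE ei).
Qed.

Lemma to_complex_act (q : quat) (X : 'cV[R]_6) :
  @to_complex R 3 (act q *m X) =
  (block_mx 1%:M 0 0 (su2_mx q) : 'M[R[i]]_(1 + 2)) *m @to_complex R 3 X.
Proof.
(* The real splitting 6 = 2 + 4 corresponds to the complex splitting 3 = 1 + 2. *)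
have shape (u : 'cV[R]_2) (v : quat) :
    @to_complex R 3 (col_mx u v) = col_mx (\col_(j < 1) Complex (u ord0 0) (u ord_max 0))
      (\col_(j < 2) (if val j == 0%N then Complex (v o0 0) (v o1 0) else Complex (v o2 0) (v o3 0))
        : 'cV[R[i]]_2) :> 'cV[R[i]]_(1 + 2).
  apply/colP => i; case: (splitP i) => j Ej.
    have -> : i = lshift 2 j by apply/val_inj.
    rewrite (col_mxEu _ _ j) !mxE.
    have -> : ord_re (lshift 2 j) = @lshift 2 4 ord0 :> 'I_6 by apply/val_inj; rewrite /= (ord1 j).
    have -> : ord_im (lshift 2 j) = @lshift 2 4 ord_max :> 'I_6 by apply/val_inj; rewrite /= (ord1 j).
    by congr Complex; rewrite (unsplitK (inl _)).
  have -> : i = rshift 1 j by apply/val_inj.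
  rewrite (col_mxEd _ _ j) !mxE; case: j Ej => -[|[|//]] hj _ /=.
    have -> : ord_re (rshift 1 (Ordinal hj)) = @rshift 2 4 o0 :> 'I_6 by apply/val_inj.
    have -> : ord_im (rshift 1 (Ordinal hj)) = @rshift 2 4 o1 :> 'I_6 by apply/val_inj.
    by congr Complex; rewrite (unsplitK (inr _)).
  have -> : ord_re (rshift 1 (Ordinal hj)) = @rshift 2 4 o2 :> 'I_6 by apply/val_inj.
  have -> : ord_im (rshift 1 (Ordinal hj)) = @rshift 2 4 o3 :> 'I_6 by apply/val_inj.
  by congr Complex; rewrite (unsplitK (inr _)).
have -> : X = col_mx (prC X) (prC2 X) :> 'cV[R]_6 by rewrite vsubmxK.
move: (prC X) (prC2 X) => u v.
have -> : act q *m col_mx u v = col_mx u (lmul_mx q *m v).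
  have := mul_block_col (1%:M : 'M[R]_2) 0 0 (lmul_mx q) u v.
  by rewrite mul1mx !mul0mx addr0 add0r.
pose w (x : quat) : 'cV[R[i]]_2 :=
  \col_j (if val j == 0%N then Complex (x o0 0) (x o1 0) else Complex (x o2 0) (x o3 0)).
have Ew : su2_mx q *m w v = w (lmul_mx q *m v).

  apply/colP => -[[|[|//]] hj]; rewrite mxE [RHS]mxE /= !big_ord_recl big_ord0 !mxE /=;
  apply/eqP; rewrite eq_complex /= !sum_ord4 !mxE /=;
  apply/andP; split; apply/eqP; ring.
by rewrite !shape -/(w _) -/(w _) (mul_block_col _ _ _ _ _ (w v)) mul1mx !mul0mx addr0 add0r Ew.
Qed.

Lemma su2_mx_SU (q : quat) : sqnorm q = 1 -> SU (su2_mx q).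
Proof.
rewrite sqnormE => q1; split.
  apply/unitarymxP; apply/matrixP => -[[|[|//]] hi] -[[|[|//]] hj];
  rewrite !mxE !big_ord_recl big_ord0 !mxE /=; apply/eqP; rewrite eq_complex /=;
  apply/andP; split; apply/eqP; lra.
rewrite (expand_det_row _ ord0) !big_ord_recl big_ord0 /cofactor !det_mx11 !mxE /=.
rewrite ?expr0 ?expr1 /=; apply/eqP; rewrite eq_complex /=.
by apply/andP; split; apply/eqP; lra.
Qed.

(** The inverse of [B] is at once its adjoint and its adjugate, whence d = conj a and c = - conj b.
    Both equalities are written as explicit combinations of three relations: the determinant, the
    norm of the first row, the orthogonality of the rows. *)
Lemma SU_su2_mx (B : 'M[R[i]]_2) : SU B -> exists2 q : quat, sqnorm q = 1 & B = su2_mx q.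
Proof.
move=> [/unitarymxP U D].
pose i0 : 'I_2 := ord0; pose i1 : 'I_2 := lift ord0 ord0.
have E00 := congr1 (fun M : 'M[R[i]]_2 => M i0 i0) U.
have E10 := congr1 (fun M : 'M[R[i]]_2 => M i1 i0) U.
move: D E00 E10.
rewrite (expand_det_row _ ord0) !big_ord_recl big_ord0 /cofactor !det_mx11 !mxE /=.
rewrite !big_ord_recl !big_ord0 !mxE /= -/i0 -/i1.
have -> : lift i1 0 = i0 by apply/val_inj.
rewrite !expr0 !expr1 !addr0 !mul1r mulN1r.
move Ea : (B i0 i0) => a; move Eb : (B i0 i1) => b.
move Ec : (B i1 i0) => c; move Ed : (B i1 i1) => d.
pose cj (z : R[i]) : R[i] := z^*%C; rewrite -/(cj a) -/(cj b) => D E00 E10.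
have H1 : d - cj a = 0.
  have -> : d - cj a = d * (1 - (a * cj a + b * cj b)) + cj a * ((a * d - b * c) - 1)
      + b * (c * cj a + d * cj b) by ring.
  have -> : a * d - b * c = 1 by rewrite -D; ring.
  by rewrite E00 E10 !subrr !mulr0 !addr0.
have H2 : c + cj b = 0.
  have -> : c + cj b = c * (1 - (a * cj a + b * cj b)) - cj b * ((a * d - b * c) - 1)
      + a * (c * cj a + d * cj b) by ring.
  have -> : a * d - b * c = 1 by rewrite -D; ring.
  by rewrite E00 E10 !subrr !mulr0 oppr0 !addr0.
pose q : quat := \col_i match val i with
  0%N => complex.Re a | 1%N => complex.Im a | 2%N => complex.Re c | _ => complex.Im c end.
move/eqP: H1; rewrite subr_eq0 => /eqP H1; move/eqP: H2; rewrite addr_eq0 => /eqP H2.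
exists q.
  rewrite sqnormE !mxE /= H2.
  by move: E00 => /eqP; rewrite eq_complex /cj; case: (a) => ? ?; case: (b) => ? ? /= /andP[/eqP ? _]; lra.
apply/matrixP => i j; rewrite mxE.
have -> : B i j = match val i, val j with
   | 0%N, 0%N => a | 0%N, _ => b | _, 0%N => c | _, _ => d end.
  by case: i => -[|[|//]] hi; case: j => -[|[|//]] hj; rewrite -?(Ea, Eb, Ec, Ed) /=;
    congr (B _ _); apply/val_inj.
by case: i => -[|[|//]] hi; case: j => -[|[|//]] hj; rewrite !mxE /=;
  rewrite ?H1 ?H2 /cj; case: (a) => ? ?; case: (b) => ? ? /=; apply/eqP; rewrite eq_complex /= ?opprK !eqxx.
Qed.

Lemma SU2_in_SU3_act : SU2_in_SU3 (R := R) = [set act q | q in [set q : quat | sqnorm q = 1]].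
Proof.
apply/seteqP; split=> [T [B HB E]|T [q q1 <-]]; last first.
  by exists (su2_mx q); [exact: su2_mx_SU|exact: to_complex_act].
have [q q1 Bq] := SU_su2_mx HB; exists q => //.
suff H : forall X : 'cV[R]_6, act q *m X = T *m X.
  apply/matrixP => i j; have := congr1 (fun v : 'cV[R]_6 => v i 0) (H (delta_mx j 0)).
  by rewrite -!colE !mxE.
by move=> X; apply: to_complex_inj; rewrite E to_complex_act Bq.
Qed.

End SU2.

(** * The Bismut connection *)

Section Gradient.
Variable R : realType.
Local Notation quat := 'cV[R]_4.

Lemma is_derive_dotp (V : normedModType R) (f g : V -> quat) x v df dg :
  is_derive x v f df -> is_derive x v g dg ->
  is_derive x v (fun y => dotp (f y) (g y)) (dotp df (g x) + dotp (f x) dg).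
Proof.
move=> /is_derive_mxP Hf /is_derive_mxP Hg; rewrite -big_split /=.
by apply: is_derive_big => i; exact: is_derive_mul.
Qed.

Lemma is_derive_sqnorm (V : normedModType R) (f : V -> quat) x v df :
  is_derive x v f df ->
  is_derive x v (fun y => sqnorm (f y)) (2 * dotp (f x) df).
Proof.
move=> Hf; have H := is_derive_dotp Hf Hf.
rewrite (_ : (fun y => _) = (fun y => dotp (f y) (f y))).
  by apply: is_derive_eq H _; rewrite dotpC; ring.
by apply/funext => y; exact: sqnorm_dotp.
Qed.

Variables (n : nat) (p : 'I_n -> quat) (k : 'I_n -> R) (c a : R).

Definition hgrad (z : quat) : quat :=
  \sum_i (- (2 * a * k i) / sqnorm (z - p i) ^+ 2) *: (z - p i).

Lemma Uset_sqnorm z i : Uset p z -> sqnorm (z - p i) != 0.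
Proof. by move=> Uz; rewrite sqnorm_eq0 subr_eq0; apply/eqP/Uz. Qed.

Lemma is_derive_inv_sqnorm (V : normedModType R) (Z : V -> quat) x v dZ q :
  sqnorm (Z x - q) != 0 -> is_derive x v Z dZ ->
  is_derive x v (fun y => (sqnorm (Z y - q))^-1)
    (- (2 * dotp (Z x - q) dZ) / sqnorm (Z x - q) ^+ 2).
Proof.
move=> n0 HZ; apply: is_derive_inv => //.
have H : is_derive x v (fun y => Z y - q) dZ.
  rewrite -[dZ]subr0; exact: is_deriveB.
exact: is_derive_sqnorm H.
Qed.

Lemma is_derive_hfun (V : normedModType R) (Z : V -> quat) x v dZ :
  Uset p (Z x) -> is_derive x v Z dZ ->
  is_derive x v (fun y => hfun p k c a (Z y)) (dotp (hgrad (Z x)) dZ).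
Proof.
move=> Ux HZ; rewrite /hfun.
have H1 : is_derive x v (fun y => \sum_i k i / sqnorm (Z y - p i))
    (\sum_i k i * (- (2 * dotp (Z x - p i) dZ) / sqnorm (Z x - p i) ^+ 2)).
  apply: is_derive_big => i.
  have H := is_derive_mul (is_derive_cst (k i) x v)
    (is_derive_inv_sqnorm (Uset_sqnorm i Ux) HZ).
  by apply: is_derive_eq H _; rewrite mul0r add0r.
have H2 := is_deriveD (is_derive_cst c x v) (is_derive_mul (is_derive_cst a x v) H1).
apply: is_derive_eq H2 _; rewrite mul0r !add0r [RHS]dotpC /hgrad dotp_sumr mulr_sumr.
apply: eq_bigr => i _; by rewrite dotpZr [dotp dZ _]dotpC /=; ring.
Qed.

Lemma Uset_open z : Uset p z -> \forall y \near z, Uset p y.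
Proof.
move=> Uz; suff : \forall y \near z, forall i, y <> p i by [].
apply: (@filter_forall quat 'I_n (fun i => [set y : quat | y <> p i]) (nbhs z) _) => i.
have o : open [set y : quat | y <> p i].
  have -> : [set y : quat | y <> p i] = ~` [set p i].
    by apply/seteqP; split.
  by apply: closed_openC; exact: accessible_closed_set1 (hausdorff_accessible (@norm_hausdorff _ _)) _.
exact: open_nbhs_nbhs (conj o (Uz i)).
Qed.

Lemma prC2_continuous : continuous (@prC2 R).
Proof.
move=> x; apply/(@cvgrPdist_lt R quat 'cV[R]_6 (nbhs x) (nbhs_filter x)) => e e0.
apply/(@nbhs_ballP R 'cV[R]_6); exists e => // y.
rewrite -ball_normE /= => xy; apply: le_lt_trans xy.
apply: mx_norm_le => // i j.
by rewrite (le_trans _ (mx_norm_entry (x - y) (@rshift 2 4 i) j)) // !mxE.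
Qed.

(** The formulas for metric and connection are valid on [Mset p] only; openness permits
    differentiating them. *)
Lemma Mset_open x : Mset p x -> \forall y \near x, Mset p y.
Proof. by move=> Mx; have := prC2_continuous (Uset_open Mx). Qed.

Lemma prC2_linear : linear (@prC2 R).
Proof. by move=> s x y; apply/matrixP => i j; rewrite !mxE. Qed.

HB.instance Definition _ := GRing.isLinear.Build R 'cV[R]_6 quat _ (@prC2 R) prC2_linear.

Lemma is_derive_prC2 (V : normedModType R) (f : V -> 'cV[R]_6) x v df :
  is_derive x v f df -> is_derive x v (fun y => prC2 (f y)) (prC2 df).
Proof. exact: is_derive_linear. Qed.

Definition o6 k (hk : (k < 6)%N) : 'I_6 := Ordinal hk.

Lemma forall_ord6 (P : 'I_6 -> Prop) :
  P (@o6 0 isT) -> P (@o6 1 isT) -> P (@o6 2 isT) -> P (@o6 3 isT) ->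
  P (@o6 4 isT) -> P (@o6 5 isT) -> forall i, P i.
Proof.
move=> P0 P1 P2 P3 P4 P5 [[|[|[|[|[|[|//]]]]]] hi].
- by rewrite (_ : Ordinal hi = @o6 0 isT) //; apply/val_inj.
- by rewrite (_ : Ordinal hi = @o6 1 isT) //; apply/val_inj.
- by rewrite (_ : Ordinal hi = @o6 2 isT) //; apply/val_inj.
- by rewrite (_ : Ordinal hi = @o6 3 isT) //; apply/val_inj.
- by rewrite (_ : Ordinal hi = @o6 4 isT) //; apply/val_inj.
- by rewrite (_ : Ordinal hi = @o6 5 isT) //; apply/val_inj.
Qed.

Lemma sum_ord6 (V : nmodType) (F : 'I_6 -> V) :
  \sum_i F i = F (@o6 0 isT) + F (@o6 1 isT) + F (@o6 2 isT) + F (@o6 3 isT)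
    + F (@o6 4 isT) + F (@o6 5 isT).
Proof.
by rewrite !big_ord_recl big_ord0 addr0 !addrA; do !congr (_ + _); congr (F _); apply/val_inj.
Qed.

Definition J6 (X : 'cV[R]_6) : 'cV[R]_6 := std_J R *m X.

Lemma prC2E (X : 'cV[R]_6) :
  [/\ prC2 X o0 0 = X (@o6 2 isT) 0, prC2 X o1 0 = X (@o6 3 isT) 0,
      prC2 X o2 0 = X (@o6 4 isT) 0 & prC2 X o3 0 = X (@o6 5 isT) 0].
Proof. by split; rewrite mxE; congr (X _ _); apply/val_inj. Qed.

Lemma J6E (X : 'cV[R]_6) :
  [/\ J6 X (@o6 0 isT) 0 = - X (@o6 1 isT) 0, J6 X (@o6 1 isT) 0 = X (@o6 0 isT) 0,
      J6 X (@o6 2 isT) 0 = - X (@o6 3 isT) 0 & J6 X (@o6 3 isT) 0 = X (@o6 2 isT) 0] /\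
  (J6 X (@o6 4 isT) 0 = - X (@o6 5 isT) 0 /\ J6 X (@o6 5 isT) 0 = X (@o6 4 isT) 0).
Proof. by split; split; rewrite mxE sum_ord6 !mxE /=; ring. Qed.

Lemma kahler2E (X Y : 'cV[R]_6) : @kahler R 2 (prC2 X) (prC2 Y) =
  X (@o6 2 isT) 0 * Y (@o6 3 isT) 0 - X (@o6 3 isT) 0 * Y (@o6 2 isT) 0 +
  (X (@o6 4 isT) 0 * Y (@o6 5 isT) 0 - X (@o6 5 isT) 0 * Y (@o6 4 isT) 0).
Proof.
have [X0 X1 X2 X3] := prC2E X; have [Y0 Y1 Y2 Y3] := prC2E Y.
rewrite /kahler !big_ord_recl big_ord0 addr0 -X0 -X1 -X2 -X3 -Y0 -Y1 -Y2 -Y3.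
by congr (_ * _ - _ * _ + (_ * _ - _ * _)); congr (prC2 _ _ _); apply/val_inj.
Qed.

Lemma kahler1E (X Y : 'cV[R]_6) : @kahler R 1 (prC X) (prC Y) =
  X (@o6 0 isT) 0 * Y (@o6 1 isT) 0 - X (@o6 1 isT) 0 * Y (@o6 0 isT) 0.
Proof.
rewrite /kahler !big_ord_recl big_ord0 addr0 !mxE.
by congr (_ * _ - _ * _); congr (_ _ _); apply/val_inj.
Qed.

Lemma kahler2_J6 (X Y : 'cV[R]_6) :
  @kahler R 2 (prC2 (J6 X)) (prC2 (J6 Y)) = @kahler R 2 (prC2 X) (prC2 Y).
Proof.
rewrite !kahler2E.
by have [[_ _ -> ->] [-> ->]] := J6E X; have [[_ _ -> ->] [-> ->]] := J6E Y; ring.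
Qed.

Lemma dotp_J6 (g : quat) (X : 'cV[R]_6) : dotp g (prC2 (J6 X)) =
  - g o0 0 * X (@o6 3 isT) 0 + g o1 0 * X (@o6 2 isT) 0
  - g o2 0 * X (@o6 5 isT) 0 + g o3 0 * X (@o6 4 isT) 0.
Proof.
rewrite dotpE; have [-> -> -> ->] := prC2E (J6 X).
by have [[_ _ -> ->] [-> ->]] := J6E X; ring.
Qed.

Lemma dotp_prC2 (g : quat) (X : 'cV[R]_6) : dotp g (prC2 X) =
  g o0 0 * X (@o6 2 isT) 0 + g o1 0 * X (@o6 3 isT) 0
  + g o2 0 * X (@o6 4 isT) 0 + g o3 0 * X (@o6 5 isT) 0.
Proof. by rewrite dotpE; have [-> -> -> ->] := prC2E X. Qed.

End Gradient.

Lemma det_mx33 (C : comNzRingType) (N : 'M[C]_3) :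
  let i0 := @Ordinal 3 0 isT in let i1 := @Ordinal 3 1 isT in
  let i2 := @Ordinal 3 2 isT in
  \det N = N i0 i0 * (N i1 i1 * N i2 i2 - N i1 i2 * N i2 i1)
          - N i1 i0 * (N i0 i1 * N i2 i2 - N i0 i2 * N i2 i1)
          + N i2 i0 * (N i0 i1 * N i1 i2 - N i0 i2 * N i1 i1).
Proof.
move=> i0 i1 i2.
rewrite (expand_det_col _ ord0) !big_ord_recl big_ord0 /cofactor !(expand_det_row _ ord0).
rewrite !big_ord_recl !big_ord0 /cofactor !det_mx11 !mxE /=.
pose f r s := N (inord r) (inord s).
have E r s : N r s = f (val r) (val s) by rewrite /f !inord_val.
by rewrite !E /= /bump /=; ring.
Qed.

(** * Complex structure, metric and torsion form in coordinates *)

Section Bismut.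
Variable R : realType.
Local Notation quat := 'cV[R]_4.
Variables (n : nat) (p : 'I_n -> quat) (k : 'I_n -> R) (c a : R).
Variable J : 'cV[R]_6 -> 'M[R]_6.
Local Notation M := (Mset p).
Local Notation sol := (solution p k c a).
Local Notation h := (hfun p k c a).
Local Notation grad := (hgrad p k a).
Hypothesis h_gt0 : forall z, Uset p z -> 0 < h z.
Hypothesis HJ : is_complex_structure (volform sol) M J.

(** Inserting the other two coordinate vectors, in cyclic order, into dz_1 /\ dz_2 /\ dz_3 leaves
    the covector dz_j. *)
Lemma hol_volume_delta (j : 'I_3) (X : 'cV[R]_6) : exists Y Z : 'cV[R]_6,
  forall X, @hol_volume R 3 [tuple X; Y; Z] = @to_complex R 3 X j 0.
Proof.
have E (i : 'I_3) : exists Y : 'cV[R]_6, forall l, @to_complex R 3 Y l 0 = (l == i)%:R.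
  exists (delta_mx (ord_re i) 0) => l; rewrite !mxE /= andbT.
  have -> : (ord_im l == ord_re i :> 'I_6) = false.
    by apply/negP => /eqP/(congr1 val)/= E; have := congr1 odd E; rewrite /= !odd_double.
  have -> : (ord_re l == ord_re i :> 'I_6) = (l == i).
    apply/eqP/eqP => [|->//] /(congr1 val) /= E; apply/val_inj => /=.
    by apply: double_inj.
  by rewrite andbT; case: (l == i).
have [Y0 E0] := E (@Ordinal 3 0 isT); have [Y1 E1] := E (@Ordinal 3 1 isT).
have [Y2 E2] := E (@Ordinal 3 2 isT).
case: j => -[|[|[|//]]] hj; 
  [exists Y1, Y2; pose N' (X : 'cV[R]_6) := [:: X; Y1; Y2]
  |exists Y2, Y0; pose N' (X : 'cV[R]_6) := [:: X; Y2; Y0]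
  |exists Y0, Y1; pose N' (X : 'cV[R]_6) := [:: X; Y0; Y1]] => {}X;
rewrite /hol_volume det_mx33; set N := \matrix_(_, _) _;
(have NE r s : N r s = @to_complex R 3 (nth 0 (N' X) s) r 0 by rewrite mxE (tnth_nth 0));
rewrite !NE /= ?E0 ?E1 ?E2 /=;
rewrite ?(mulr0, mulr1, mulrN, oppr0, mul0r, subr0, addr0, add0r, sub0r, opprK);
congr (@to_complex R 3 X _ _); exact: val_inj.
Qed.

(** Since [h] does not vanish, the (3,0) condition tested on [hol_volume_delta] reads dz_j(J X) = i
    dz_j(X) for each j, which determines [J]. *)
Lemma complex_structure_std x : M x -> J x = std_J R.
Proof.
move=> Mx; have [_ HW] := HJ Mx.
suff H : forall X : 'cV[R]_6, J x *m X = std_J R *m X.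
  apply/matrixP => i j; have := congr1 (fun v : 'cV[R]_6 => v i 0) (H (delta_mx j 0)).
  by rewrite -!colE !mxE.
move=> X; apply: to_complex_inj; rewrite to_complex_std_J; apply/colP => j.
have [Y [Z HYZ]] := hol_volume_delta j X.
rewrite [RHS]mxE; have := HW X Y Z; rewrite /= !HYZ mulrCA.
have h0 : (h (prC2 x))%:C%C != 0.
  by apply/eqP => -[h0]; have := h_gt0 Mx; rewrite h0 ltxx.
by move=> /(mulfI h0).
Qed.

Local Notation w := (kform sol).
Local Notation g := (hermitian_metric w J).
Local Notation H := (fun x : 'cV[R]_6 => h (prC2 x)).

Lemma derive_H x X : M x -> is_derive x X H (dotp (grad (prC2 x)) (prC2 X)).
Proof.
move=> Mx; apply: is_derive_hfun => //; exact: is_derive_prC2.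
Qed.

Lemma derive_w x X Y Z : M x ->
  'D_X (fun y => w y Y Z) x =
    dotp (grad (prC2 x)) (prC2 X) * @kahler R 2 (prC2 Y) (prC2 Z).
Proof.
move=> Mx; have H1 := is_derive_mul (derive_H X Mx)
   (is_derive_cst (@kahler R 2 (prC2 Y) (prC2 Z)) x X).
have H2 := is_deriveD (is_derive_cst (@kahler R 1 (prC Y) (prC Z)) x X) H1.
have [_ <-] : is_derive x X (fun y => w y Y Z)
    (dotp (grad (prC2 x)) (prC2 X) * @kahler R 2 (prC2 Y) (prC2 Z)).
  by apply: is_derive_eq H2 _; rewrite mulr0 addr0 add0r.
by [].
Qed.

(** The metric is diagonal with entries [fibre_scale h]; the inverse metric uses the same pattern
    with [h^-1]. *)
Definition fibre_scale (t : R) (i : 'I_6) : R := if (i < 2)%N then 1 else t.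

Lemma gramE x i j : M x -> gram g x i j = (i == j)%:R * fibre_scale (H x) i.
Proof.
move=> Mx; rewrite mxE /g /hermitian_metric complex_structure_std //.
rewrite -/(J6 _) /w /= kahler1E kahler2E.
have [[-> -> -> ->] [-> ->]] := J6E (coord_vec R j).
move: i j; apply: forall_ord6; apply: forall_ord6; rewrite /coord_vec !mxE /fibre_scale /H /=; ring.
Qed.

(** The last factor cancels the value 1 of [fibre_scale] in the flat directions, where the metric is
    constant. *)
Lemma derive_gram x X i j : M x ->
  'D_X (fun y => gram g y i j) x =
  (i == j)%:R * fibre_scale (dotp (grad (prC2 x)) (prC2 X)) i * (2 <= i)%:R.
Proof.
move=> Mx; rewrite (near_eq_derive (g := fun y => (i == j)%:R * fibre_scale (H y) i)); last first.
  by have := Mset_open Mx; apply: filterS => y My; exact: gramE.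
rewrite /fibre_scale; case: ltnP => i2 /=.
  by rewrite mulr0 mulr1; exact: derive_cst.
have [_ ->] := is_derive_mul (is_derive_cst ((i == j)%:R : R) x X) (derive_H X Mx).
by rewrite mul0r add0r mulr1.
Qed.

Lemma invmx_gram x i j : M x ->
  invmx (gram g x) i j = (i == j)%:R * fibre_scale (H x)^-1 i.
Proof.
move=> Mx; pose D : 'M[R]_6 := \matrix_(i, j) ((i == j)%:R * fibre_scale (H x)^-1 i).
have Hx : H x != 0 by rewrite gt_eqF // h_gt0.
have E : D *m gram g x = 1%:M.
  apply/matrixP => r s; rewrite mxE (bigD1 r) //= big1 => [|l lr].
    rewrite !mxE -/(gram g x) eqxx addr0 mul1r.
    have := gramE r s Mx; rewrite mxE => ->.
    rewrite mulrCA /fibre_scale; case: ltnP => _; first by rewrite !mulr1.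
    by rewrite mulVf // mulr1.
  by rewrite !mxE eq_sym (negbTE lr) !mul0r.
have [_ u] := mulmx1_unit E.
by rewrite -[invmx _]mul1mx -E -mulmxA mulmxV // mulmx1 mxE.
Qed.

Lemma sum_invmx_gram x i (F : 'I_6 -> R) : M x ->
  \sum_l invmx (gram g x) i l * F l = fibre_scale (H x)^-1 i * F i.
Proof.
move=> Mx; rewrite (bigD1 i) //= big1 => [|l li].
  by rewrite invmx_gram // eqxx mul1r addr0.
by rewrite invmx_gram // eq_sym (negbTE li) !mul0r.
Qed.

(** Here d omega = dh /\ omega_{C^2} because the two Kähler forms are constant, and omega_{C^2} is
    invariant under [J]; so only dh gets composed with [J]. *)
Lemma dc_formE x X Y Z : M x -> dc_form w J x X Y Z =
  - (dotp (grad (prC2 x)) (prC2 (J6 X)) * @kahler R 2 (prC2 Y) (prC2 Z)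
     - dotp (grad (prC2 x)) (prC2 (J6 Y)) * @kahler R 2 (prC2 X) (prC2 Z)
     + dotp (grad (prC2 x)) (prC2 (J6 Z)) * @kahler R 2 (prC2 X) (prC2 Y)).
Proof.
move=> Mx; rewrite /dc_form /ext_deriv2 complex_structure_std //.
by rewrite !derive_w // -!/(J6 _) !kahler2_J6.
Qed.

End Bismut.

(** * The connection one-form *)

Section Bismut.
Variable R : realType.
Local Notation quat := 'cV[R]_4.
Variables (n : nat) (p : 'I_n -> quat) (k : 'I_n -> R) (c a : R).
Variable J : 'cV[R]_6 -> 'M[R]_6.
Local Notation M := (Mset p).
Local Notation sol := (solution p k c a).
Local Notation h := (hfun p k c a).
Local Notation grad := (hgrad p k a).
Hypothesis h_gt0 : forall z, Uset p z -> 0 < h z.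
Hypothesis HJ : is_complex_structure (volform sol) M J.

Local Notation w := (kform sol).
Local Notation g := (hermitian_metric w J).
Local Notation H := (fun x : 'cV[R]_6 => h (prC2 x)).

Definition ord4_of (m : nat) : 'I_4 := match m with 0%N => o0 | 1%N => o1 | 2%N => o2 | _ => o3 end.

Lemma block0E (N : 'M[R]_4) (r j : 'I_6) :
  (block_mx (0 : 'M[R]_2) 0 0 N : 'M[R]_6) r j =
  match val r, val j with
  | r'.+2, j'.+2 => N (ord4_of r') (ord4_of j')
  | _, _ => 0
  end.
Proof.
have S2 (i : 'I_4) : ord4_of i = i by move: i; exact: forall_ord4.
case: (@splitP 2 4 r) => r' Er.
  have -> : r = @lshift 2 4 r' by apply/val_inj.
  apply: (etrans (@col_mxEu R 2 4 (2 + 4) (row_mx 0 0) (row_mx 0 N) r' j)).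
  by rewrite row_mx0 mxE; case: r' {Er} => -[|[|//]].
have -> : r = @rshift 2 4 r' by apply/val_inj.
case: (@splitP 2 4 j) => j' Ej.
  have -> : j = @lshift 2 4 j' by apply/val_inj.
  apply: (etrans (@block_mxEdl R 2 4 2 4 0 0 0 N r' j')).
  by rewrite mxE; case: j' {Ej} => -[|[|//]].
have -> : j = @rshift 2 4 j' by apply/val_inj.
apply: (etrans (@block_mxEdr R 2 4 2 4 0 0 0 N r' j')).
by rewrite /= !S2.
Qed.

(** Tables on coordinate vectors of the covector of [G], of its composition with [J] ([covJ]) and of
    omega_{C^2} ([kt]). Indices are plain naturals so that a case analysis evaluates them. *)
Definition cov (G : quat) (m : nat) : R :=
  match m with 2 => G o0 0 | 3 => G o1 0 | 4 => G o2 0 | 5 => G o3 0 | _ => 0 end.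

Definition covJ (G : quat) (m : nat) : R :=
  match m with 2 => G o1 0 | 3 => - G o0 0 | 4 => G o3 0 | 5 => - G o2 0 | _ => 0 end.

Definition kt (i j : nat) : R :=
  match i, j with 2, 3 | 4, 5 => 1 | 3, 2 | 5, 4 => - 1 | _, _ => 0 end.

Lemma covE G i : dotp G (prC2 (coord_vec R i)) = cov G i.
Proof. by move: i; apply: forall_ord6; rewrite dotp_prC2 /coord_vec !mxE /=; ring. Qed.

Lemma covJE G i : dotp G (prC2 (J6 (coord_vec R i))) = covJ G i.
Proof. by move: i; apply: forall_ord6; rewrite dotp_J6 /coord_vec !mxE /=; ring. Qed.

Lemma ktE i j : @kahler R 2 (prC2 (coord_vec R i)) (prC2 (coord_vec R j)) = kt i j.
Proof.
rewrite kahler2E /coord_vec !mxE.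
by move: i j; apply: forall_ord6; apply: forall_ord6; rewrite /=; ring.
Qed.

(** The Levi-Civita part of the conformally flat factor is (2 h)^-1 (dh(X) Y + dh(Y) X - <X, Y> grad
    h); the torsion completes it to the quaternion product X conj(grad h) Y. The check is entrywise,
    by 36 polynomial identities. *)
Lemma bismutE x X : M x -> bismut w J x X =
  block_mx (0 : 'M[R]_2) 0 0
    ((2 * H x)^-1 *: (lmul_mx (prC2 X) *m (lmul_mx (grad (prC2 x)))^T)).
Proof.
move=> Mx; have Hx : H x != 0 by rewrite gt_eqF // h_gt0.
pose T (r i j : 'I_6) : R :=
  'D_(coord_vec R i) (fun y => gram g y j r) x + 'D_(coord_vec R j) (fun y => gram g y i r) x
  - 'D_(coord_vec R r) (fun y => gram g y i j) x
  - dc_form w J x (coord_vec R i) (coord_vec R j) (coord_vec R r).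
have E r j : bismut w J x X r j = \sum_i X i 0 * (2^-1 * fibre_scale (H x)^-1 r * T r i j).
  rewrite mxE; apply: eq_bigr => i _; congr (_ * _).
  by rewrite /christoffel /raise_last !sum_invmx_gram // /T; ring.
have [X0 X1 X2 X3] := prC2E X; pose G := grad (prC2 x).
rewrite -/G.
pose S (b : bool) : R := b%:R.
pose t (r i j : 'I_6) : R := S (j == r) * (cov G i * S (2 <= j)%N)
  + S (i == r) * (cov G j * S (2 <= i)%N) - S (i == j) * (cov G r * S (2 <= i)%N)
  + (covJ G i * kt j r - covJ G j * kt i r + covJ G r * kt i j).
have Et r i j : T r i j = t r i j.
  rewrite /T !derive_gram // !dc_formE // -/G !covE !covJE !ktE /t /S /fibre_scale opprK.
  by congr (_ + _ - _ + _); rewrite -mulrA; congr (_ * _); case: ltnP => _; rewrite ?mulr0.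
apply/matrixP => r j; rewrite E block0E; under eq_bigr do rewrite Et.
rewrite sum_ord6 {E Et T}.
have NE (i l : 'I_4) : ((2 * H x)^-1 *: (lmul_mx (prC2 X) *m (lmul_mx G)^T)) i l =
    2^-1 * (H x)^-1 * (lmul_mx (prC2 X) i o0 * lmul_mx G l o0
      + lmul_mx (prC2 X) i o1 * lmul_mx G l o1 + lmul_mx (prC2 X) i o2 * lmul_mx G l o2
      + lmul_mx (prC2 X) i o3 * lmul_mx G l o3).
  by rewrite mxE mxE sum_ord4 !mxE invfM.
move: (prC2 X) NE X0 X1 X2 X3 => u NE X0 X1 X2 X3.
move: r j; apply: forall_ord6; apply: forall_ord6; rewrite /t /S /fibre_scale /= ?NE
  ?[lmul_mx _ _ _]mxE /= ?X0 ?X1 ?X2 ?X3;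
  move: (X _ 0) (X _ 0) (X _ 0) (X _ 0) (X _ 0) (X _ 0) (G o0 0) (G o1 0) (G o2 0) (G o3 0)
    (H x)^-1 (2^-1);
  by clear; move=> *; ring.
Qed.

End Bismut.

(** * Parallel transport and the exceptional cases *)

Section FibreBlock.
Variable R : realType.
Local Notation quat := 'cV[R]_4.

(** Inclusion of the C^2 factor. Block diagonal matrices are handled as [base + fib *m N *m fib^T],
    so that products reduce to the relations of two complementary projections. *)
Definition fib : 'M[R]_(2 + 4, 4) := col_mx (0 : 'M[R]_(2, 4)) 1%:M.

Lemma fib_trK : fib^T *m fib = 1%:M.
Proof. by rewrite /fib tr_col_mx mul_row_col trmx0 trmx1 mul0mx mul1mx add0r. Qed.

Lemma fib_prC2 (X : 'cV[R]_6) : fib^T *m X = prC2 X.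
Proof.
rewrite -[X in LHS](vsubmxK (X : 'cV[R]_(2 + 4))) /fib tr_col_mx mul_row_col.
by rewrite trmx0 trmx1 mul0mx mul1mx add0r.
Qed.

Lemma fib_block (N : 'M[R]_4) : fib *m N *m fib^T = block_mx (0 : 'M[R]_2) 0 0 N.
Proof.
rewrite /fib tr_col_mx mul_col_mx mul_col_row trmx0 trmx1 mul1mx mul0mx.
by rewrite !mulmx0 !mul0mx mulmx1.
Qed.

Definition base : 'M[R]_(2 + 4) := 1%:M - fib *m fib^T.

Lemma base_block (N : 'M[R]_4) :
  base + fib *m N *m fib^T = block_mx (1%:M : 'M[R]_2) 0 0 N.
Proof.
have E : (1%:M : 'M[R]_(2 + 4)) = block_mx (1%:M : 'M[R]_2) 0 0 (1%:M : 'M[R]_4).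
  exact: (@scalar_mx_block R 2 4 1).
rewrite /base -{1}[fib]mulmx1 !fib_block E opp_block_mx !add_block_mx.
by rewrite !oppr0 !addr0 subrr add0r.
Qed.

Lemma act_fib q : act q = base + fib *m lmul_mx q *m fib^T.
Proof. by rewrite base_block. Qed.

Lemma tr_fib_base : fib^T *m base = 0.
Proof. by rewrite mulmxBr mulmx1 mulmxA fib_trK mul1mx subrr. Qed.

Lemma base_fib : base *m fib = 0.
Proof. by rewrite mulmxBl mul1mx -mulmxA fib_trK mulmx1 subrr. Qed.

Lemma fib_split m (N : 'M[R]_(2 + 4, m)) : N = base *m N + fib *m (fib^T *m N).
Proof. by rewrite mulmxBl mul1mx mulmxA subrK. Qed.

Lemma baseK : base *m base = base.
Proof. by rewrite {1}/base mulmxBl mul1mx -mulmxA tr_fib_base mulmx0 subr0. Qed.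

Lemma base_mul (N N' : 'M[R]_4) :
  (base + fib *m N *m fib^T) *m (base + fib *m N' *m fib^T) =
  base + fib *m (N *m N') *m fib^T.
Proof.
move: baseK base_fib tr_fib_base; move: base => b baseK base_fib tr_fib_base.
rewrite mulmxDl !mulmxDr baseK !mulmxA base_fib !mul0mx addr0.
rewrite -[_ *m b]mulmxA tr_fib_base mulmx0 add0r; congr (_ + _).
by rewrite -[fib *m N *m fib^T *m fib]mulmxA fib_trK mulmx1.
Qed.

Lemma act_mul (p q : quat) : act p *m act q = act (lmul_mx p *m q).
Proof. by rewrite !act_fib lmul_mxM; exact: base_mul. Qed.

Lemma act_qone : act (qone R) = 1%:M.
Proof. by rewrite act_fib lmul_mx_qone mulmx1 subrK. Qed.

End FibreBlock.

(** * Parallel transport as left multiplication *)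

Section Transport.
Variable R : realType.
Local Notation quat := 'cV[R]_4.
Variables (n : nat) (p : 'I_n -> quat) (k : 'I_n -> R) (c a : R).
Variable J : 'cV[R]_6 -> 'M[R]_6.
Local Notation M := (Mset p).
Local Notation sol := (solution p k c a).
Local Notation h := (hfun p k c a).
Local Notation grad := (hgrad p k a).
Hypothesis h_gt0 : forall z, Uset p z -> 0 < h z.
Hypothesis HJ : is_complex_structure (volform sol) M J.
Local Notation A := (bismut (kform sol) J).

Definition conn4 (z v : quat) : 'M[R]_4 :=
  (2 * h z)^-1 *: (lmul_mx v *m (lmul_mx (grad z))^T).

Lemma bismut_fib x X : M x -> A x X = fib R *m conn4 (prC2 x) (prC2 X) *m (fib R)^T.
Proof. by move=> Mx; rewrite fib_block; exact: (bismutE h_gt0 HJ). Qed.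

Section Curve.
Variables q q' : R -> quat.
Hypothesis Uq : forall t : R, 0 <= t <= 1 -> Uset p (q t).
Hypothesis dq : forall t : R, 0 <= t <= 1 -> is_derive t 1 q (q' t).

(** Any number of columns is allowed: frames have 4, the fibre rows of a transport matrix of R^6
    have 6. *)
Definition parallel m (Z : R -> 'M[R]_(4, m)) :=
  forall t : R, 0 <= t <= 1 -> is_derive t 1 Z (- (conn4 (q t) (q' t) *m Z t)).

(** Compatibility with the metric [h] times the Euclidean one, from [lmul_mx_polar]. *)
Lemma conn4_sym z v : Uset p z ->
  (conn4 z v)^T + conn4 z v = (dotp (grad z) v / h z)%:M.
Proof.
move=> Uz; have hz : h z != 0 by rewrite gt_eqF // h_gt0.
rewrite /conn4 linearZ /= trmx_mul trmxK -scalerDr lmul_mx_polar.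
by rewrite scale_scalar_mx; congr (_%:M); field.
Qed.

(** By [conn4_sym] the derivatives of [h] and of the Gram matrix cancel, so the product has zero
    derivative. *)
Lemma parallel_energy m (Z : R -> 'M[R]_(4, m)) : parallel Z ->
  forall t : R, 0 <= t <= 1 ->
  h (q t) *: ((Z t)^T *m Z t) = h (q 0) *: ((Z 0)^T *m Z 0).
Proof.
move=> dZ t tI; apply/eqP; rewrite -subr_eq0 -normr_le0.
pose F s := h (q s) *: ((Z s)^T *m Z s); rewrite -/(F t) -/(F 0).
apply: (derive_bound (D' := fun=> 0)) tI => [s sI|s _]; last by rewrite normr0.
have Uqs := Uq sI; have hs : h (q s) != 0 by rewrite gt_eqF // h_gt0.
have H := is_derive_scale (is_derive_hfun k c a Uqs (dq sI))
  (is_derive_mulmx (is_derive_trmx (dZ _ sI)) (dZ _ sI)).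
apply: is_derive_eq H _; rewrite linearN /= mulNmx mulmxN trmx_mul -opprD.
rewrite -[_ *m _ *m Z s]mulmxA -mulmxDr -mulmxDl conn4_sym //.
rewrite mul_scalar_mx -scalemxAr scalerN scalerA -scalerBl.
by rewrite mulrCA mulfV // mulr1 subrr scale0r.
Qed.

Lemma gram_eq0 m (Z : 'M[R]_(4, m)) : Z^T *m Z = 0 -> Z = 0.
Proof.
move=> E; apply/matrixP => i j; rewrite mxE; apply/eqP.
have /eqP := congr1 (fun N : 'M[R]_m => N j j) E; rewrite !mxE.
rewrite psumr_eq0 => [/allP /(_ i (mem_index_enum _))|l _]; rewrite !mxE -?expr2.
  by rewrite sqrf_eq0.
exact: sqr_ge0.
Qed.

(** Uniqueness of parallel fields comes from conservation of energy and [h > 0], without a Lipschitz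
    estimate on the connection. *)
Lemma parallel_eq0 m (Z : R -> 'M[R]_(4, m)) : parallel Z -> Z 0 = 0 ->
  forall t : R, 0 <= t <= 1 -> Z t = 0.
Proof.
move=> dZ Z0 t tI; apply: gram_eq0; have := parallel_energy dZ tI.
have ht : (h (q t) == 0) = false by apply/gt_eqF/h_gt0/Uq.
by rewrite Z0 mulmx0 scaler0 => /eqP; rewrite scaler_eq0 ht /= => /eqP.
Qed.

Lemma parallelB m (Z W : R -> 'M[R]_(4, m)) :
  parallel Z -> parallel W -> parallel (fun t => Z t - W t).
Proof.
move=> dZ dW t tI; rewrite mulmxBr opprD.
exact: (is_deriveB (dZ _ tI) (dW _ tI)).
Qed.

Lemma parallelMr m l (Z : R -> 'M[R]_(4, m)) (N : 'M[R]_(m, l)) :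
  parallel Z -> parallel (fun t => Z t *m N).
Proof.
move=> dZ t tI; have H := is_derive_mulmx (dZ _ tI) (is_derive_cst N t 1).
by apply: is_derive_eq H _; rewrite mulmx0 addr0 mulNmx mulmxA.
Qed.

Lemma parallel_uniq m (Z W : R -> 'M[R]_(4, m)) : parallel Z -> parallel W ->
  Z 0 = W 0 -> forall t : R, 0 <= t <= 1 -> Z t = W t.
Proof.
move=> dZ dW ZW t tI; apply/eqP; rewrite -subr_eq0; apply/eqP.
by apply: (parallel_eq0 (parallelB dZ dW)) => //; rewrite ZW subrr.
Qed.

Lemma conn4_rmul z v r : conn4 z v *m rmul_mx r = rmul_mx r *m conn4 z v.
Proof.
rewrite /conn4 -scalemxAl -scalemxAr; congr (_ *: _).
by rewrite -mulmxA lmul_mx_tr lmul_rmulC mulmxA lmul_rmulC mulmxA.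
Qed.

(** The connection commutes with right multiplications, so [P *m rmul_mx r] and [rmul_mx r *m P] are
    parallel with equal initial values. They agree by uniqueness, and [commutant_rmul] applies; the
    norm is given by the energy. *)
Lemma parallel_quat (P : R -> 'M[R]_4) : parallel P -> P 0 = 1%:M ->
  forall t : R, 0 <= t <= 1 ->
  exists2 r, P t = lmul_mx r & sqnorm r = h (q 0) / h (q t).
Proof.
move=> dP P0 t tI.
have PE : P t = lmul_mx (P t *m qone R).
  apply: commutant_rmul => r.
  apply: (parallel_uniq (parallelMr (rmul_mx r) dP) (W := fun s => rmul_mx r *m P s)) => //.
    move=> s sI; have H := is_derive_mulmx (is_derive_cst (rmul_mx r) s 1) (dP _ sI).
    by apply: is_derive_eq H _; rewrite mul0mx add0r mulmxN [rmul_mx r *m (_ *m _)]mulmxA -conn4_rmul mulmxA.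
  by rewrite P0 mulmx1 mul1mx.
exists (P t *m qone R) => //.
have ht : h (q t) != 0 by rewrite gt_eqF //; apply/h_gt0/Uq.
have := parallel_energy dP tI; rewrite P0 trmx1 mulmx1 PE lmul_mxK lmul_mx1.
rewrite !scale_scalar_mx mulr1 => /(congr1 (fun N : 'M[R]_4 => N o0 o0)).
by rewrite !mxE /= !mulr1n => <-; rewrite mulrAC mulfV ?mul1r.
Qed.

End Curve.

(** Reduction from R^6 to the fibre. The base rows of the transport have zero derivative; its
    fibre-by-base block is parallel and starts at 0, hence vanishes; the block that remains is
    [P]. *)
Lemma C1_transport_parallel x y T : C1_transport M A x y T ->
  exists q q' (P : R -> 'M[R]_4),
    [/\ forall t : R, 0 <= t <= 1 -> Uset p (q t),
        forall t : R, 0 <= t <= 1 -> is_derive t 1 q (q' t),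
        parallel q q' P,
        q 0 = prC2 x /\ q 1 = prC2 y &
        P 0 = 1%:M /\ T = base R + fib R *m P 1 *m (fib R)^T].
Proof.
move=> [cv [P [dc cc' Mc [c0 c1] [P0 P1 dP]]]].
have dcv (t : R) : is_derive t 1 cv (cv^`() t)%classic.
  by rewrite derive1E; exact: derivableP.
have I0 : 0 <= (0 : R) <= 1 by rewrite lexx ler01.
have I1 : 0 <= (1 : R) <= 1 by rewrite lexx ler01.
pose q (t : R) := prC2 (cv t); pose q' (t : R) := prC2 (cv^`() t)%classic.
have Uq (t : R) : 0 <= t <= 1 -> Uset p (q t) by move=> tI; exact: Mc.
have dq (t : R) : 0 <= t <= 1 -> is_derive t 1 q (q' t).
  by move=> tI; exact: is_derive_prC2.
have AE (t : R) : 0 <= t <= 1 -> A (cv t) (cv^`() t)%classic =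
    fib R *m conn4 (q t) (q' t) *m (fib R)^T.
  by move=> tI; apply: bismut_fib; exact: Mc.
have dfP : parallel q q' (fun t => (fib R)^T *m P t).
  move=> t tI; have H := is_derive_mulmx (is_derive_cst (fib R)^T t 1) (dP _ tI).
  apply: is_derive_eq H _; rewrite mul0mx add0r mulmxN AE // !mulmxA fib_trK.
  by rewrite mul1mx.
have dbP (t : R) : 0 <= t <= 1 -> is_derive t 1 (fun t => base R *m P t) 0.
  move=> tI; have H := is_derive_mulmx (is_derive_cst (base R) t 1) (dP _ tI).
  by apply: is_derive_eq H _; rewrite mul0mx add0r mulmxN AE // !mulmxA base_fib !mul0mx oppr0.
have bP : base R *m T = base R.
  apply/eqP; rewrite -subr_eq0 -normr_le0 -{2}[base R]mulmx1 -P0 -P1.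
  by apply: (derive_bound dbP) => // t _; rewrite normr0.
have fbP : (fib R)^T *m T *m base R = 0.
  rewrite -P1; apply: (parallel_eq0 Uq dq (parallelMr (base R) dfP)) => //.
  by rewrite P0 mulmx1 tr_fib_base.
exists q, q', (fun t => (fib R)^T *m P t *m fib R); split=> //.
- exact: parallelMr.
- by rewrite /q c0 c1.
split; first by rewrite P0 mulmx1 fib_trK.
rewrite P1 [LHS]fib_split bP; congr (_ + _).
rewrite -!mulmxA; congr (_ *m _).
rewrite !mulmxA -[LHS]mulmx1 -(subrK (fib R *m (fib R)^T) 1%:M) -/(base R) mulmxDr fbP add0r.
by rewrite mulmxA.
Qed.

End Transport.

(** * Trivial holonomy, and transport along segments *)

Section Holonomy.
Variable R : realType.
Local Notation quat := 'cV[R]_4.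
Variables (n : nat) (p : 'I_n -> quat) (k : 'I_n -> R) (c a : R).
Variable J : 'cV[R]_6 -> 'M[R]_6.
Local Notation M := (Mset p).
Local Notation sol := (solution p k c a).
Local Notation h := (hfun p k c a).
Local Notation grad := (hgrad p k a).
Hypothesis h_gt0 : forall z, Uset p z -> 0 < h z.
Hypothesis HJ : is_complex_structure (volform sol) M J.
Local Notation A := (bismut (kform sol) J).
Local Notation conn4 := (conn4 p k c a).
Local Notation parallel := (parallel p k c a).

(** The Euclidean Hessian of [h] applied to [v]. It serves the continuity of the connection along
    segments and the curvature. *)
Definition hhess (z v : quat) : quat :=
  \sum_i (a * k i) *: ((- 2 / sqnorm (z - p i) ^+ 2) *: v
    + (8 * dotp (z - p i) v / sqnorm (z - p i) ^+ 3) *: (z - p i)).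

Lemma is_derive_hgrad (V : normedModType R) (Z : V -> quat) x v dZ :
  Uset p (Z x) -> is_derive x v Z dZ ->
  is_derive x v (fun y => grad (Z y)) (hhess (Z x) dZ).
Proof.
move=> Ux HZ; apply: is_derive_big => i.
have n0 := Uset_sqnorm i Ux.
have H1 : is_derive x v (fun y => Z y - p i) dZ.
  by rewrite -[dZ]subr0; exact: is_deriveB.
have H2 := is_derive_inv_sqnorm n0 HZ.
have H3 := is_derive_scale (is_derive_mul (is_derive_cst (- (2 * a * k i)) x v)
  (is_derive_mul H2 H2)) H1.
have -> : (fun y => (- (2 * a * k i) / sqnorm (Z y - p i) ^+ 2) *: (Z y - p i)) =
  (fun y => (- (2 * a * k i) * ((sqnorm (Z y - p i))^-1 * (sqnorm (Z y - p i))^-1)) *: (Z y - p i)).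
  by apply/funext => y; rewrite -invfM expr2.
apply: is_derive_eq H3 _; rewrite mul0r add0r addrC [RHS]scalerDr !scalerA /=.
by congr (_ *: _ + _ *: _); field.
Qed.

Lemma is_derive_conn4 (V : normedModType R) (Z : V -> quat) x v dZ w :
  Uset p (Z x) -> is_derive x v Z dZ ->
  is_derive x v (fun y => conn4 (Z y) w)
    ((2 * h (Z x))^-1 *: (lmul_mx w *m (lmul_mx (hhess (Z x) dZ))^T)
     - (dotp (grad (Z x)) dZ / h (Z x)) *: conn4 (Z x) w).
Proof.
move=> Ux HZ; have hx : h (Z x) != 0 by rewrite gt_eqF //; apply: h_gt0.
have H1 := is_derive_mul (is_derive_cst (2 : R) x v) (is_derive_hfun k c a Ux HZ).
have H2 := is_derive_inv _ H1.
have H3 := is_derive_trmx (is_derive_linear (@lmul_mx R) (is_derive_hgrad Ux HZ)).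
have H4 := is_derive_scale (H2 _) (is_derive_mulmx (is_derive_cst (lmul_mx w) x v) H3).
apply: is_derive_eq (H4 _) _; rewrite /= ?mulf_neq0 //.
rewrite mul0mx mul0r !add0r addrC; congr (_ + _).
rewrite /conn4 scalerA -[RHS]scaleNr /GRing.scale /=; congr (_ *: _).
by field.
Qed.

(** The ratios of values of [h] telescope over the pieces of the path; for a loop the quaternion is
    therefore a unit. *)
Lemma transport_act x y T : M x -> transport M A x y T ->
  M y /\ exists2 r : quat, T = act r & sqnorm r = h (prC2 x) / h (prC2 y).
Proof.
move=> Mx; elim=> [|{}y z {}T S _ [My [r -> Er]] HS].
  split=> //; exists (qone R); first by rewrite act_qone.
  by rewrite sqnorm_qone divff // gt_eqF //; apply: h_gt0.
have [q [q' [P [Uq dq dP [q0 q1] [P0 ->]]]]] := C1_transport_parallel h_gt0 HJ HS.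
have I1 : 0 <= (1 : R) <= 1 by rewrite lexx ler01.
have [s PE Es] := parallel_quat h_gt0 Uq dq dP P0 I1.
split; first by rewrite /Mset /= -q1; exact: Uq.
exists (lmul_mx s *m r); first by rewrite PE -act_fib act_mul.
have hy : h (prC2 y) != 0 by rewrite gt_eqF //; apply: h_gt0.
have hz : h (prC2 z) != 0 by rewrite gt_eqF // -q1; apply/h_gt0/Uq.
by rewrite sqnorm_lmul Er Es q0 q1; field; rewrite hz hy.
Qed.

Section Frame.
Variable E : quat -> 'M[R]_4.
Hypothesis E_unit : forall z, Uset p z -> E z \in unitmx.
Hypothesis E_parallel : forall q q' : R -> quat,
  (forall t : R, 0 <= t <= 1 -> Uset p (q t)) ->
  (forall t : R, 0 <= t <= 1 -> is_derive t 1 q (q' t)) ->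
  parallel q q' (fun t => E (q t)).

(** By uniqueness, transport along each piece is the frame at the end times the inverse frame at the
    start; the inner factors cancel. *)
Lemma transport_frame x y T : M x -> transport M A x y T ->
  T = base R + fib R *m (E (prC2 y) *m invmx (E (prC2 x))) *m (fib R)^T.
Proof.
move=> Mx HT; elim: HT => [|{}y z {}T S HT IH HS].
  by rewrite mulmxV ?E_unit // mulmx1 subrK.
have [My _] := transport_act Mx HT.
have [q [q' [P [Uq dq dP [q0 q1] [P0 ->]]]]] := C1_transport_parallel h_gt0 HJ HS.
have I1 : 0 <= (1 : R) <= 1 by rewrite lexx ler01.
have := parallel_uniq h_gt0 Uq dq dP (parallelMr (invmx (E (q 0))) (E_parallel Uq dq)).
rewrite P0 q0 mulmxV ?E_unit // => /(_ erefl 1 I1) ->.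
rewrite {T HT}IH q1; apply: (etrans (base_mul _ _)); congr (_ + _ *m _ *m _).
by rewrite !mulmxA -[_ *m _ *m E _]mulmxA mulVmx ?E_unit // mulmx1.
Qed.

Lemma holonomy_frame x : M x -> holonomy M A x = [set 1%:M].
Proof.
move=> Mx; apply/seteqP; split=> [T /(transport_frame Mx) ->|T ->] /=.
  by rewrite mulmxV ?E_unit // mulmx1 subrK.
exact: transport_refl.
Qed.

End Frame.

Lemma holonomy_a0 x : a = 0 -> M x -> holonomy M A x = [set 1%:M].
Proof.
move=> a0; apply: (holonomy_frame (E := fun=> 1%:M)) => [z _|q q' _ _ t _].
  exact: unitmx1.
have -> : conn4 (q t) (q' t) = 0.
  rewrite /conn4 (_ : grad _ = 0) ?linear0 ?trmx0 ?mulmx0 ?scaler0 //.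
  by rewrite /hgrad big1 // => i _; rewrite a0 mulr0 !mul0r oppr0 mul0r scale0r.
by rewrite mul0mx oppr0; exact: is_derive_cst.
Qed.

(** With y = z - p_1 one has h = a k_1 / |y|^2 and grad h = -2 h y / |y|^2, hence (2 h)^-1 v
    conj(grad h) y = -v. This cancels dy(v) = v, so y is parallel. *)
Lemma conn4_one (z v : quat) (i0 : 'I_n) : c = 0 -> (forall i, i = i0) -> a != 0 -> k i0 != 0 ->
  Uset p z -> conn4 z v *m lmul_mx (z - p i0) = - lmul_mx v.
Proof.
move=> c0 one a0 k0 Uz; have s0 := Uset_sqnorm i0 Uz.
have S (V : nmodType) (F : 'I_n -> V) : \sum_i F i = F i0.
  by rewrite (bigD1 i0) //= big1 ?addr0 // => i; rewrite (one i) eqxx.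
rewrite /conn4 /hfun /hgrad !S c0 add0r linearZ /= linearZ /= -scalemxAr scalerA.
rewrite -scalemxAl -mulmxA lmul_mxK mul_mx_scalar scalerA -[RHS]scaleN1r.
by congr (_ *: _); field; rewrite s0 k0.
Qed.

Lemma lmul_unit (u : quat) : u != 0 -> lmul_mx u \in unitmx.
Proof.
move=> u0; have s0 : sqnorm u != 0 by rewrite sqnorm_eq0.
have E : lmul_mx u *m ((sqnorm u)^-1 *: (lmul_mx u)^T) = 1%:M.
  by rewrite -scalemxAr lmul_mxKr scale_scalar_mx mulVf.
by have [] := mulmx1_unit E.
Qed.

Lemma holonomy_one x : (forall i, 0 < k i) -> a != 0 -> c = 0 -> n = 1%N ->
  M x -> holonomy M A x = [set 1%:M].
Proof.
move=> k0 a0 c0 n1.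
have n0 : (0 < n)%N by rewrite n1.
pose i0 := Ordinal n0.
have one i : i = i0.
  by apply/val_inj => /=; case: i => i /=; rewrite n1; case: i.
apply: (holonomy_frame (E := fun z => lmul_mx (z - p i0))) => [z Uz|q q' Uq dq t tI].
  by apply: lmul_unit; rewrite subr_eq0; apply/eqP/Uz.
rewrite (conn4_one _ c0 one a0) ?gt_eqF ?opprK //; last exact: Uq.
have H : is_derive t 1 (fun s => q s - p i0) (q' t).
  by rewrite -[q' t]subr0; apply: is_deriveB; exact: dq.
exact: (is_derive_linear (@lmul_mx R) H).
Qed.

Definition fib_vec (v : quat) : 'cV[R]_6 := fib R *m v.

Lemma prC2_fib_vec v : prC2 (fib_vec v) = v.
Proof. by rewrite -fib_prC2 mulmxA fib_trK mul1mx. Qed.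

(** The source of existence of transport: every loop used later is a polygon, made of triangle edges
    and of pieces of a ray. *)
Lemma segment_transport x v : M x ->
  (forall t : R, 0 <= t <= 1 -> Uset p (prC2 x + t *: v)) ->
  exists P : R -> 'M[R]_4,
    [/\ parallel (fun t => prC2 x + t *: v) (fun=> v) P, P 0 = 1%:M &
        transport M A x (x + fib_vec v) (base R + fib R *m P 1 *m (fib R)^T)].
Proof.
move=> Mx Uv; pose q (t : R) := prC2 x + t *: v.
have dline m (y w : 'cV[R]_m) (t : R) : is_derive t 1 (fun s : R => y + s *: w) w.
  have H1 := @is_derive_scale R R m 1 id (cst w) t 1 1 0 (is_derive_id _ _) (is_derive_cst _ _ _).
  have H := is_deriveD (is_derive_cst y t 1) H1.
  by apply: is_derive_eq H _; rewrite add0r scaler0 addr0 scale1r.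
have dq (t : R) : is_derive t 1 q v by exact: dline.
pose B (t : R) := - conn4 (q t) v.
have [t tI|P [P0 dP]] := lin_ode_exists (B := B).
  have H := is_derive_conn4 (Z := q) v (Uv t tI) (dq t).
  by apply: continuousN; exact: is_derive_continuous H.
have dP' : parallel q (fun=> v) P.
  by move=> t tI; rewrite -mulNmx; exact: dP.
exists P; split=> //.
rewrite -[base R + _]mulmx1; apply: (transport_step (transport_refl _ _ _)).
have dcv := dline 6%N x (fib_vec v).
have qE (t : R) : prC2 (x + t *: fib_vec v) = q t.
  by rewrite linearD linearZ /= prC2_fib_vec.
exists (fun t : R => x + t *: fib_vec v), (fun t => base R + fib R *m P t *m (fib R)^T).
split.
- by move=> t; have [] := dcv t.
- have -> : (fun t : R => x + t *: fib_vec v)^`()%classic = cst (fib_vec v).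
    by apply/funext => t; rewrite derive1E; have [_ ->] := dcv t.
  exact: cst_continuous.
- by move=> t tI; rewrite /Mset /= qE; exact: Uv.
- by rewrite scale0r addr0 scale1r.
split=> //; first by rewrite P0 mulmx1 subrK.
move=> t tI.
have -> : (fun t : R => x + t *: fib_vec v)^`()%classic t = fib_vec v.
  by rewrite derive1E; have [_ ->] := dcv t.
rewrite (bismut_fib h_gt0 HJ); last by rewrite /Mset /= qE; exact: Uv.
rewrite qE prC2_fib_vec.
have H := is_deriveD (is_derive_cst (base R) t 1)
  (is_derive_mulmx (is_derive_mulmx (is_derive_cst (fib R) t 1) (dP' t tI))
    (is_derive_cst (fib R)^T t 1)).
apply: is_derive_eq H _; rewrite mulmx0 addr0 mul0mx !add0r mulmxN mulNmx.
congr (- _); rewrite mulmxDr -!mulmxA tr_fib_base !mulmx0 add0r.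
by rewrite [_^T *m (fib R *m _)]mulmxA fib_trK mul1mx.
Qed.

End Holonomy.

(** * Uniformly Lipschitz families *)

Section UniformlyLipschitz.
Variable R : realType.
Local Notation quat := 'cV[R]_4.
Variable r0 : R.

(* Families depending on a scale [r], a time [t] and a loop parameter [s]. *)
Definition ulip (V : normedModType R) (f : R -> R -> 'cV[R]_3 -> V) :=
  exists2 C : R, 0 <= C & forall r t s s', 0 < r <= r0 -> 0 <= t <= 1 ->
    `|s| <= 1 -> `|s'| <= 1 -> `|f r t s| <= C /\ `|f r t s - f r t s'| <= C * `|s - s'|.

Lemma ulip_ext (V : normedModType R) (f g : R -> R -> 'cV[R]_3 -> V) :
  (forall r t s, 0 < r <= r0 -> 0 <= t <= 1 -> `|s| <= 1 -> f r t s = g r t s) ->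
  ulip f -> ulip g.
Proof.
move=> E [C C0 H]; exists C => // r t s s' rI tI sI s'I.
by rewrite -!E //; exact: H.
Qed.

Lemma ulip_cst (V : normedModType R) (v : V) : ulip (fun _ _ _ => v).
Proof.
exists `|v| => // r t s s' _ _ _ _; split=> //.
by rewrite subrr normr0 mulr_ge0.
Qed.

Lemma ulip_id : ulip (fun _ _ s => s).
Proof. by exists 1 => // r t s s' _ _ s1 _; rewrite mul1r. Qed.

Lemma ulip_time : ulip (fun _ t _ => t).
Proof.
exists 1 => // r t s s' _ /andP[t0 t1] _ _.
by rewrite ger0_norm // subrr normr0 mul1r.
Qed.

Lemma ulip_scale : ulip (fun r _ _ => r).
Proof.
exists `|r0| => // r t s s' /andP[t0 t1] _ _ _.
rewrite subrr normr0 mulr_ge0 // ger0_norm ?(ltW t0) //; split=> //.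
exact: le_trans (ler_norm _).
Qed.

Lemma ulip_add (V : normedModType R) (f g : R -> R -> 'cV[R]_3 -> V) :
  ulip f -> ulip g -> ulip (fun r t s => f r t s + g r t s).
Proof.
move=> [C C0 Hf] [D D0 Hg]; exists (C + D); first exact: addr_ge0.
move=> r t s s' rI tI sI s'I.
have [f1 f2] := Hf _ _ _ _ rI tI sI s'I; have [g1 g2] := Hg _ _ _ _ rI tI sI s'I.
split; first by rewrite (le_trans (ler_normD _ _)) // lerD.
by rewrite opprD addrACA mulrDl (le_trans (ler_normD _ _)) // lerD.
Qed.

Lemma ulip_opp (V : normedModType R) (f : R -> R -> 'cV[R]_3 -> V) :
  ulip f -> ulip (fun r t s => - f r t s).
Proof.
move=> [C C0 Hf]; exists C => // r t s s' rI tI sI s'I.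
by rewrite -opprD !normrN; exact: Hf.
Qed.

(** One rule covers all the products in use. The factor 2 counts the terms of f g - f' g' = (f - f')
    g + f' (g - g'). *)
Lemma ulip_bilinear (V W X : normedModType R) (op : V -> W -> X) (D : R)
    (f : R -> R -> 'cV[R]_3 -> V) (g : R -> R -> 'cV[R]_3 -> W) :
  0 <= D -> (forall v w, `|op v w| <= D * (`|v| * `|w|)) ->
  (forall v v' w, op (v - v') w = op v w - op v' w) ->
  (forall v w w', op v (w - w') = op v w - op v w') ->
  ulip f -> ulip g -> ulip (fun r t s => op (f r t s) (g r t s)).
Proof.
move=> D0 Hop opl opr [C C0 Hf] [C' C'0 Hg].
exists (2 * (D * (C * C'))) => [|r t s s' rI tI sI s'I]; first by rewrite !mulr_ge0.
have [f1 f2] := Hf _ _ _ _ rI tI sI s'I; have [g1 g2] := Hg _ _ _ _ rI tI sI s'I.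
have [f1' _] := Hf _ _ _ _ rI tI s'I s'I.
split.
  rewrite (le_trans (Hop _ _)) //.
  apply: (@le_trans _ _ (D * (C * C'))); first by rewrite ler_wpM2l // ler_pM.
  by rewrite ler_peMl ?mulr_ge0 //; lra.
rewrite -(subrKA (op (f r t s') (g r t s))) -opl -opr (le_trans (ler_normD _ _)) //.
have -> : 2 * (D * (C * C')) * `|s - s'| =
    D * ((C * `|s - s'|) * C') + D * (C * (C' * `|s - s'|)) by ring.
by rewrite lerD // (le_trans (Hop _ _)) // ler_wpM2l // ler_pM.
Qed.

Lemma ulip_mul (f g : R -> R -> 'cV[R]_3 -> R) :
  ulip f -> ulip g -> ulip (fun r t s => f r t s * g r t s).
Proof.
apply: (@ulip_bilinear R R R *%R 1) => // [v w|v v' w|v w w'].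
- by rewrite normrM mul1r.
- exact: mulrBl.
- exact: mulrBr.
Qed.

Lemma ulip_scalemx m l (f : R -> R -> 'cV[R]_3 -> R) (g : R -> R -> 'cV[R]_3 -> 'M[R]_(m, l)) :
  ulip f -> ulip g -> ulip (fun r t s => f r t s *: g r t s).
Proof.
apply: (@ulip_bilinear R _ _ *:%R 1) => // [v w|v v' w|v w w'].
- by rewrite normrZ mul1r.
- exact: scalerBl.
- exact: scalerBr.
Qed.

Lemma ulip_mulmx m l o (f : R -> R -> 'cV[R]_3 -> 'M[R]_(m, l))
    (g : R -> R -> 'cV[R]_3 -> 'M[R]_(l, o)) :
  ulip f -> ulip g -> ulip (fun r t s => f r t s *m g r t s).
Proof.
apply: (@ulip_bilinear _ _ _ mulmx l%:R) => // [v w|v v' w|v w w'].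
- exact: mx_norm_mulmx.
- exact: mulmxBl.
- exact: mulmxBr.
Qed.

Lemma ulip_linear m l m' l' (L : {linear 'M[R]_(m, l) -> 'M[R]_(m', l')})
    (f : R -> R -> 'cV[R]_3 -> 'M[R]_(m, l)) :
  (forall X, `|L X| <= `|X|) -> ulip f -> ulip (fun r t s => L (f r t s)).
Proof.
move=> HL [C C0 Hf]; exists C => // r t s s' rI tI sI s'I.
have [f1 f2] := Hf _ _ _ _ rI tI sI s'I.
by rewrite -linearB; split; apply: le_trans (HL _) _.
Qed.

Lemma ulip_tr m l (f : R -> R -> 'cV[R]_3 -> 'M[R]_(m, l)) :
  ulip f -> ulip (fun r t s => (f r t s)^T).
Proof.
apply: (@ulip_linear _ _ _ _ (@trmx R m l)) => X.
by apply: mx_norm_le => // i j; rewrite mxE mx_norm_entry.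
Qed.

Lemma ulip_lmul (f : R -> R -> 'cV[R]_3 -> quat) :
  ulip f -> ulip (fun r t s => lmul_mx (f r t s)).
Proof.
apply: (@ulip_linear _ _ _ _ (@lmul_mx R)) => X.
apply: mx_norm_le => //; apply: forall_ord4; apply: forall_ord4;
  by rewrite mxE /= ?normrN mx_norm_entry.
Qed.

Lemma ulip_dotp (f g : R -> R -> 'cV[R]_3 -> quat) :
  ulip f -> ulip g -> ulip (fun r t s => dotp (f r t s) (g r t s)).
Proof.
apply: (@ulip_bilinear _ _ _ (@dotp R) 4) => // [v w|v v' w|v w w'].
- rewrite /dotp (le_trans (ler_norm_sum _ _ _)) //.
  rewrite -[4]/(4%:R) -[X in X%:R]card_ord -sum1_card natr_sum mulr_suml ler_sum // => i _.
  by rewrite mul1r normrM ler_pM // mx_norm_entry.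
- by rewrite dotpC dotpDr -scaleN1r dotpZr mulN1r ![dotp w _]dotpC.
- by rewrite dotpDr -scaleN1r dotpZr mulN1r.
Qed.

Lemma ulip_sqnorm (f : R -> R -> 'cV[R]_3 -> quat) :
  ulip f -> ulip (fun r t s => sqnorm (f r t s)).
Proof.
move=> Hf; apply: ulip_ext (ulip_dotp Hf Hf) => r t s _ _ _.
by rewrite sqnorm_dotp.
Qed.

Lemma ulip_inv (f : R -> R -> 'cV[R]_3 -> R) (d : R) : 0 < d ->
  (forall r t s, 0 < r <= r0 -> 0 <= t <= 1 -> `|s| <= 1 -> d <= f r t s) ->
  ulip f -> ulip (fun r t s => (f r t s)^-1).
Proof.
move=> d0 Hd [C C0 Hf]; exists (d^-1 + C / d ^+ 2).
  by rewrite addr_ge0 ?invr_ge0 ?divr_ge0 ?exprn_ge0 // ltW.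
move=> r t s s' rI tI sI s'I.
have [_ f2] := Hf _ _ _ _ rI tI sI s'I.
have H1 := Hd _ _ _ rI tI sI; have H2 := Hd _ _ _ rI tI s'I.
have p1 : 0 < f r t s by exact: lt_le_trans H1.
have p2 : 0 < f r t s' by exact: lt_le_trans H2.
have i1 : (f r t s)^-1 <= d^-1 by rewrite lef_pV2.
have i2 : (f r t s')^-1 <= d^-1 by rewrite lef_pV2.
have K0 : 0 <= C / d ^+ 2 by rewrite divr_ge0 // exprn_ge0 // ltW.
split.
  by rewrite ger0_norm ?invr_ge0 ?(ltW p1) // (le_trans i1) // lerDl.
have -> : (f r t s)^-1 - (f r t s')^-1 =
    - (f r t s - f r t s') * ((f r t s)^-1 * (f r t s')^-1).
  by field; rewrite !gt_eqF.
have v1 : 0 <= (f r t s)^-1 by rewrite invr_ge0 ltW.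
have v2 : 0 <= (f r t s')^-1 by rewrite invr_ge0 ltW.
rewrite normrM normrN [X in _ * X]ger0_norm ?mulr_ge0 //.
apply: (@le_trans _ _ (C / d ^+ 2 * `|s - s'|)).
  have -> : C / d ^+ 2 * `|s - s'| = C * `|s - s'| * (d^-1 * d^-1) by field; rewrite gt_eqF.
  by apply: ler_pM => //; [exact: mulr_ge0|exact: ler_pM].
by rewrite ler_wpM2r // lerDr invr_ge0 (ltW d0).
Qed.

Lemma ulip_sum (V : normedModType R) (I : finType) (P : pred I)
    (f : I -> R -> R -> 'cV[R]_3 -> V) :
  (forall i, P i -> ulip (f i)) -> ulip (fun r t s => \sum_(i | P i) f i r t s).
Proof.
move=> H; pose F i := if P i then f i else fun _ _ _ => 0.
have HF i : ulip (F i) by rewrite /F; case: ifP => Pi; [exact: H|exact: ulip_cst].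
suff G l : ulip (fun r t s => \sum_(i <- l) F i r t s).
  apply: ulip_ext (G (index_enum I)) => r t s _ _ _.
  by rewrite [RHS]big_mkcond; apply: eq_bigr => i _; rewrite /F; case: ifP.
elim: l => [|i l IHl].
  by apply: ulip_ext (ulip_cst 0) => r t s _ _ _; rewrite big_nil.
by apply: ulip_ext (ulip_add (HF i) IHl) => r t s _ _ _; rewrite big_cons.
Qed.

End UniformlyLipschitz.

(** * Expansion of a linear equation in a small scale *)

Section SmallODE.
Variable R : realType.

Lemma ulipW (V : normedModType R) (r0 r1 : R) (f : R -> R -> 'cV[R]_3 -> V) :
  r1 <= r0 -> ulip r0 f -> ulip r1 f.
Proof.
move=> r10 [C C0 H]; exists C => // r t s s' /andP[rp rr1]; apply: H.
by rewrite rp (le_trans rr1).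
Qed.

(** At order [r ^+ 2] the solution is 1 minus the primitive [Lam] of [L]. The perturbation [f]
    enters at order 3 and the quadratic effects at order 4. Comparing the solutions for two
    parameters gives the same orders times [|s - s'|]. *)
Lemma ulip_ode (r0 : R) (L f : R -> R -> 'cV[R]_3 -> 'M[R]_4)
    (Lam Q : R -> 'cV[R]_3 -> R -> 'M[R]_4) :
  0 < r0 -> ulip r0 L -> ulip r0 f ->
  (forall r s, Lam r s 0 = 0) ->
  (forall r s (t : R), is_derive t 1 (Lam r s) (L r t s)) ->
  (forall r s, 0 < r <= r0 -> `|s| <= 1 -> Q r s 0 = 1%:M) ->
  (forall r s (t : R), 0 < r <= r0 -> `|s| <= 1 -> 0 <= t <= 1 ->
     is_derive t 1 (Q r s) (- ((r ^+ 2 *: (L r t s + r *: f r t s)) *m Q r s t))) ->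
  exists r1, 0 < r1 <= r0 /\
    ulip r1 (fun r _ s => r ^- 3 *: (Q r s 1 - 1%:M + r ^+ 2 *: Lam r s 1)).
Proof.
move=> r00 uL uf Lam0 dLam Q0 dQ.
have [C C0 Hb] := ulip_add uL (ulip_scalemx (ulip_scale r0) uf).
have [C' C'0 Hf] := uf.
(* This forces [r <= 1] and [8 * C * r <= 1], hence [4 * (r ^+ 2 * C) <= 1 / 2], as [gronwall_small]
   demands; the 4 is the size of the matrices. *)
pose r1 := Num.min r0 (1 + 8 * C)^-1.
have D0 : 0 < 1 + 8 * C by lra.
have r1p : 0 < r1 by rewrite /r1 lt_min r00 invr_gt0.
exists r1; split; first by rewrite r1p ge_min lexx.
have sub r : 0 < r <= r1 -> [/\ 0 < r <= r0, 0 < r, r <= 1 & 8 * C * r <= 1].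
  move=> /andP[rp]; rewrite le_min => /andP[rr0 rr1].
  have rD : r * (1 + 8 * C) <= 1 by rewrite -ler_pdivlMr // div1r.
  split=> //; first by rewrite rp.
    by apply: le_trans rD; nra.
  by apply: le_trans rD; nra.
have I1 : 0 <= (1 : R) <= 1 by rewrite lexx ler01.
pose B r t s := r ^+ 2 *: (L r t s + r *: f r t s).
have nB r t s : 0 < r <= r1 -> 0 <= t <= 1 -> `|s| <= 1 -> `|B r t s| <= r ^+ 2 * C.
  move=> rI tI sI; have [rI0 rp r_1 rC] := sub _ rI.
  have [+ _] := Hb _ _ _ _ rI0 tI sI sI.
  by rewrite normrZ ger0_norm ?exprn_ge0 ?(ltW rp) // => ?; rewrite ler_wpM2l ?exprn_ge0 ?(ltW rp).
have lB r t s s' : 0 < r <= r1 -> 0 <= t <= 1 -> `|s| <= 1 -> `|s'| <= 1 ->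
    `|B r t s - B r t s'| <= r ^+ 2 * C * `|s - s'|.
  move=> rI tI sI s'I; have [rI0 rp r_1 rC] := sub _ rI.
  have [_ +] := Hb _ _ _ _ rI0 tI sI s'I.
  rewrite -scalerBr normrZ ger0_norm ?exprn_ge0 ?(ltW rp) // => ?.
  by rewrite -mulrA ler_wpM2l ?exprn_ge0 ?(ltW rp).
have smallC r : 0 < r <= r1 -> 4 * (r ^+ 2 * C) <= 1 / 2.
  move=> rI; have [rI0 rp r_1 rC] := sub _ rI.
  have : r * (8 * C * r) <= 1 * 1 by rewrite ler_pM ?(ltW rp) ?mulr_ge0 ?(ltW rp).
  rewrite expr2; lra.
have dD r s (t : R) : 0 < r <= r1 -> `|s| <= 1 -> 0 <= t <= 1 ->
    is_derive t 1 (fun t => Q r s t - 1%:M) (- (B r t s *m Q r s t)).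
  move=> rI sI tI; have [rI0 _ _ _] := sub _ rI.
  rewrite -[X in is_derive _ _ _ X]subr0; apply: is_deriveB; exact: dQ.
have mul4 (X Y : 'M[R]_4) x y : `|X| <= x -> `|Y| <= y -> `|X *m Y| <= 4 * (x * y).
  move=> Xx Yy; apply: le_trans (mx_norm_mulmx _ _) _.
  by rewrite ler_wpM2l // ler_pM.
have n1 : `|1%:M : 'M[R]_4| <= 1.
  apply: mx_norm_le => // i j; rewrite mxE; case: (i == j) => /=; first by rewrite normr1.
  by rewrite normr0.
have E1 r s t : 0 < r <= r1 -> `|s| <= 1 -> 0 <= t <= 1 ->
    `|Q r s t - 1%:M| <= 2 * (4 * (r ^+ 2 * C)).
  move=> rI sI tI; have [rI0 rp _ _] := sub _ rI.
  apply: (gronwall_small (D := fun t => Q r s t - 1%:M) (D' := fun t => - (B r t s *m Q r s t))) tI.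
  - by move=> u uI; exact: dD.
  - by rewrite Q0 // subrr.
  move=> u uI; rewrite normrN; have -> : Q r s u = (Q r s u - 1%:M) + 1%:M by rewrite subrK.
  rewrite mulmxDr addrK (le_trans (ler_normD _ _)) // lerD //.
    apply: le_trans (mul4 _ _ _ _ (nB _ _ _ rI uI sI) (lexx _)) _.
    by rewrite mulrA [leRHS]mulrC ler_wpM2r // (le_trans (smallC _ rI)) // div1r.
  apply: le_trans (mul4 _ _ _ _ (nB _ _ _ rI uI sI) n1) _.
  by rewrite mulr1.
have Q2 r s t : 0 < r <= r1 -> `|s| <= 1 -> 0 <= t <= 1 -> `|Q r s t| <= 2.
  move=> rI sI tI; have -> : Q r s t = (Q r s t - 1%:M) + 1%:M by rewrite subrK.
  rewrite (le_trans (ler_normD _ _)) //.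
  have := E1 _ _ _ rI sI tI; have := smallC _ rI; have := n1; lra.
have dDel r s s' (t : R) : 0 < r <= r1 -> `|s| <= 1 -> `|s'| <= 1 -> 0 <= t <= 1 ->
    is_derive t 1 (fun t => Q r s t - Q r s' t) (- (B r t s *m Q r s t - B r t s' *m Q r s' t)).
  move=> rI sI s'I tI; have [rI0 _ _ _] := sub _ rI.
  rewrite opprD; apply: is_deriveB; exact: dQ.
have E2 r s s' t : 0 < r <= r1 -> `|s| <= 1 -> `|s'| <= 1 -> 0 <= t <= 1 ->
    `|Q r s t - Q r s' t| <= 2 * (4 * (r ^+ 2 * C * `|s - s'| * 2)).
  move=> rI sI s'I tI; have [rI0 rp _ _] := sub _ rI.
  apply: (gronwall_small (D := fun t => Q r s t - Q r s' t)
    (D' := fun t => - (B r t s *m Q r s t - B r t s' *m Q r s' t))) tI.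
  - by move=> u uI; exact: dDel.
  - by rewrite !Q0 // subrr.
  move=> u uI.
  have -> : B r u s *m Q r s u - B r u s' *m Q r s' u =
      B r u s *m (Q r s u - Q r s' u) + (B r u s - B r u s') *m Q r s' u.
    by rewrite mulmxBr mulmxBl addrA subrK.
  rewrite normrN (le_trans (ler_normD _ _)) // lerD //.
    apply: le_trans (mul4 _ _ _ _ (nB _ _ _ rI uI sI) (lexx _)) _.
    by rewrite mulrA [leRHS]mulrC ler_wpM2r // (le_trans (smallC _ rI)) // div1r.
  by apply: (mul4 _ _ _ _ (lB _ _ _ _ rI uI sI s'I)); exact: Q2.
have r3 r : 0 < r <= r1 -> [/\ 0 <= r ^+ 3, 0 < r ^+ 3 & r ^+ 4 <= r ^+ 3].
  move=> rI; have [_ rp r_1 _] := sub _ rI.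
  split; [by rewrite exprn_ge0 ?(ltW rp)|by rewrite exprn_gt0|].
  by rewrite exprS ler_piMl ?exprn_ge0 ?(ltW rp).
(* 96 = 32 + 64: the contributions of [lB] times [E1] and of [nB] times [E2] in the Lipschitz
   estimate. The bound itself uses only 32. [C'] accounts for [f]. *)
exists (96 * C ^+ 2 + C') => [|r _ s s' rI _ sI s'I].
  by rewrite addr_ge0 // mulr_ge0 // sqr_ge0.
have [rI0 rp r_1 rC] := sub _ rI; have [r3_ge r3_gt r43] := r3 _ rI.
have C20 : 0 <= C ^+ 2 by exact: sqr_ge0.
have ds0 : 0 <= `|s - s'| by [].
have scale_le (X : 'M[R]_4) x : `|X| <= r ^+ 3 * x -> `|r ^- 3 *: X| <= x.
  by move=> H; rewrite normrZ normfV ger0_norm // mulrC ler_pdivrMr // mulrC.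
have r43C x : 0 <= x -> x * r ^+ 4 <= r ^+ 3 * x.
  by move=> x0; rewrite [leRHS]mulrC ler_wpM2l.
split.
  apply: scale_le.
  pose F t := Q r s t - 1%:M + r ^+ 2 *: Lam r s t.
  have -> : Q r s 1 - 1%:M + r ^+ 2 *: Lam r s 1 = F 1 - F 0.
    by rewrite /F Q0 // Lam0 scaler0 subrr addr0 subr0.
  have dF (t : R) : 0 <= t <= 1 ->
      is_derive t 1 F (- (B r t s *m Q r s t) + r ^+ 2 *: L r t s).
    move=> tI.
    have H := is_derive_scale (is_derive_cst (r ^+ 2) t 1) (dLam r s t).
    have H' := is_deriveD (dD _ _ _ rI sI tI) H.
    by apply: is_derive_eq H' _; rewrite scale0r add0r.
  suff HK (t : R) : 0 <= t <= 1 ->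
      `|- (B r t s *m Q r s t) + r ^+ 2 *: L r t s| <= r ^+ 3 * (96 * C ^+ 2 + C').
    exact: (derive_bound dF HK I1).
  move=> tI.
  have -> : - (B r t s *m Q r s t) + r ^+ 2 *: L r t s =
      - (B r t s *m (Q r s t - 1%:M)) - (r ^+ 3) *: f r t s.
    have EB : B r t s = r ^+ 2 *: L r t s + r ^+ 3 *: f r t s.
      by rewrite /B scalerDr scalerA -exprSr.
    rewrite mulmxBr mulmx1; move: (B r t s *m Q r s t) => X; rewrite EB.
    by rewrite opprB addrAC addrK addrC.
  rewrite (le_trans (ler_normB _ _)) // normrN mulrDr lerD //.
    apply: le_trans (mul4 _ _ _ _ (nB _ _ _ rI tI sI) (E1 _ _ _ rI sI tI)) _.
    apply: (@le_trans _ _ (96 * C ^+ 2 * r ^+ 4)); last by rewrite r43C // mulr_ge0.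
    have : 0 <= C ^+ 2 * r ^+ 4 by rewrite mulr_ge0 // exprn_ge0 // ltW.
    have -> : 4 * (r ^+ 2 * C * (2 * (4 * (r ^+ 2 * C)))) = 32 * (C ^+ 2 * r ^+ 4) by ring.
    by rewrite -mulrA; lra.
  by rewrite normrZ ger0_norm // ler_wpM2l //; have [] := Hf _ _ _ _ rI0 tI sI sI.
rewrite -scalerBr; apply: scale_le.
pose F t := (Q r s t - Q r s' t) + r ^+ 2 *: (Lam r s t - Lam r s' t).
have -> : Q r s 1 - 1%:M + r ^+ 2 *: Lam r s 1 - (Q r s' 1 - 1%:M + r ^+ 2 *: Lam r s' 1) = F 1 - F 0.
  rewrite /F !Q0 // !Lam0 !subrr scaler0 addr0 subr0 opprD addrACA scalerBr.
  by congr (_ + _); rewrite opprB addrA subrK.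
have dF (t : R) : 0 <= t <= 1 -> is_derive t 1 F
    (- (B r t s *m Q r s t - B r t s' *m Q r s' t) + r ^+ 2 *: (L r t s - L r t s')).
  move=> tI.
  have H := is_derive_scale (is_derive_cst (r ^+ 2) t 1) (is_deriveB (dLam r s t) (dLam r s' t)).
  have H' := is_deriveD (dDel _ _ _ _ rI sI s'I tI) H.
  by apply: is_derive_eq H' _; rewrite scale0r add0r.
suff HK (t : R) : 0 <= t <= 1 ->
    `|- (B r t s *m Q r s t - B r t s' *m Q r s' t) + r ^+ 2 *: (L r t s - L r t s')|
      <= r ^+ 3 * ((96 * C ^+ 2 + C') * `|s - s'|).
  exact: (derive_bound dF HK I1).
move=> tI.
have -> : - (B r t s *m Q r s t - B r t s' *m Q r s' t) + r ^+ 2 *: (L r t s - L r t s') =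
   - ((B r t s - B r t s') *m (Q r s t - 1%:M)) - B r t s' *m (Q r s t - Q r s' t)
   - r ^+ 3 *: (f r t s - f r t s').
  have EB : B r t s - B r t s' = r ^+ 2 *: (L r t s - L r t s') + r ^+ 3 *: (f r t s - f r t s').
    by rewrite /B -scalerBr opprD addrACA -scalerBr scalerDr scalerA -exprSr.
  rewrite [_ *m (Q r s t - 1%:M)]mulmxBr mulmx1 mulmxBl EB mulmxBr.
  move: (B r t s *m Q r s t) (B r t s' *m Q r s t) (B r t s' *m Q r s' t) => X Y Z.
  move: (r ^+ 2 *: _) (r ^+ 3 *: _) => U W.
  by apply/matrixP => i j; rewrite !mxE; ring.
rewrite (le_trans (ler_normB _ _)) // (le_trans (lerD (ler_normB _ _) (lexx _))) // normrN.
have H1 := mul4 _ _ _ _ (lB _ _ _ _ rI tI sI s'I) (E1 _ _ _ rI sI tI).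
have H2 := mul4 _ _ _ _ (nB _ _ _ rI tI s'I) (E2 _ _ _ _ rI sI s'I tI).
have H3 : `|r ^+ 3 *: (f r t s - f r t s')| <= r ^+ 3 * (C' * `|s - s'|).
  by rewrite normrZ ger0_norm // ler_wpM2l //; have [] := Hf _ _ _ _ rI0 tI sI s'I.
apply: le_trans (lerD (lerD H1 H2) H3) _.
have -> : r ^+ 3 * ((96 * C ^+ 2 + C') * `|s - s'|) =
  r ^+ 3 * (96 * C ^+ 2 * `|s - s'|) + r ^+ 3 * (C' * `|s - s'|) by ring.
rewrite lerD2r; apply: (@le_trans _ _ (96 * C ^+ 2 * `|s - s'| * r ^+ 4)).
  by rewrite le_eqVlt; apply/orP; left; apply/eqP; ring.
by rewrite r43C // !mulr_ge0.
Qed.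

End SmallODE.

(** * Small triangles around a centre *)

Section RegularGauge.
Variable R : realType.
Local Notation quat := 'cV[R]_4.
Variables (n : nat) (p : 'I_n -> quat) (k : 'I_n -> R) (c a : R) (i0 : 'I_n).
Local Notation M := (Mset p).
Local Notation h := (hfun p k c a).
Local Notation grad := (hgrad p k a).
Hypothesis h_gt0 : forall z, Uset p z -> 0 < h z.
Local Notation conn4 := (conn4 p k c a).
Local Notation parallel := (parallel p k c a).
Local Notation K := (a * k i0).

Definition hreg (z : quat) : R := c + a * \sum_(i | i != i0) k i / sqnorm (z - p i).

Definition gradreg (z : quat) : quat :=
  \sum_(i | i != i0) (- (2 * a * k i) / sqnorm (z - p i) ^+ 2) *: (z - p i).

(** The function |z - p_i0|^2 h, continued to the centre with the positive value [K]. *)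
Definition wreg (z : quat) : R := K + hreg z * sqnorm (z - p i0).

(* The connection in the frame z - p i0, where its singularity at p i0
   disappears. *)
Definition conn_reg (z v : quat) : 'M[R]_4 :=
  (wreg z)^-1 *: ((lmul_mx (z - p i0))^T *m lmul_mx v *m
    ((hreg z)%:M + 2^-1 *: ((lmul_mx (gradreg z))^T *m lmul_mx (z - p i0)))).

Lemma hfun_split z : h z = K / sqnorm (z - p i0) + hreg z.
Proof. by rewrite /hfun (bigD1 i0) //= mulrDr mulrA addrCA. Qed.

Lemma hgrad_split z :
  grad z = (- (2 * K) / sqnorm (z - p i0) ^+ 2) *: (z - p i0) + gradreg z.
Proof. by rewrite /hgrad (bigD1 i0) //= [2 * K]mulrA. Qed.

Lemma wreg_hfun z : Uset p z -> wreg z = sqnorm (z - p i0) * h z.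
Proof.
by move=> /(Uset_sqnorm i0) s0; rewrite hfun_split /wreg; field.
Qed.

(** The pole of [h] acts as in [conn4_one]: it cancels the derivative [v] of the frame up to a
    factor that vanishes at the centre. *)
Lemma conn4_reg z v : Uset p z ->
  lmul_mx v + conn4 z v *m lmul_mx (z - p i0) =
  (sqnorm (z - p i0) / wreg z) *: (lmul_mx v *m
    ((hreg z)%:M + 2^-1 *: ((lmul_mx (gradreg z))^T *m lmul_mx (z - p i0)))).
Proof.
move=> Uz; have s0 := Uset_sqnorm i0 Uz; have w0 : wreg z != 0.
  by rewrite wreg_hfun // mulf_neq0 // gt_eqF //; apply: h_gt0.
have hE : h z = wreg z / sqnorm (z - p i0) by rewrite wreg_hfun //; field.
set y := z - p i0 in s0 hE *; set G := gradreg z.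
set T := (lmul_mx G)^T *m lmul_mx y; set l : R := - (2 * K) / sqnorm y ^+ 2.
have EG : (lmul_mx (grad z))^T *m lmul_mx y = (l * sqnorm y)%:M + T.
  rewrite hgrad_split -/y -/G -/l linearD /= linearZ /= linearD /= linearZ /=.
  by rewrite mulmxDl -scalemxAl lmul_mxK scale_scalar_mx.
rewrite /conn4 -scalemxAl -mulmxA EG scalemxAr [RHS]scalemxAr.
rewrite -{1}[lmul_mx v]mulmx1 -mulmxDr; congr (_ *m _).
rewrite !scalerDr scalerA !scale_scalar_mx addrA -[X in X + _]raddfD /=.
rewrite hE /l; congr (_%:M + _ *: _); last by field; rewrite s0 w0.
have wE : K = wreg z - hreg z * sqnorm y by rewrite /wreg -/y addrK.
by rewrite wE; field; rewrite s0 w0.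
Qed.

Lemma lmul_polar_tr (y v : quat) :
  (lmul_mx y)^T *m lmul_mx v + (lmul_mx v)^T *m lmul_mx y = (2 * dotp y v)%:M.
Proof.
have := lmul_mx_polar (qconj y) (qconj v).
rewrite -!lmul_mx_tr !trmxK => ->; congr (_%:M); congr (2 * _).
by rewrite !dotpE !mxE /=; ring.
Qed.

(** It identifies the derivative of |y|^-2 conj(y), as found by the quotient rule, with - y^-1 v
    y^-1. *)
Lemma lmul_sandwich (y v : quat) : (lmul_mx y)^T *m lmul_mx v *m (lmul_mx y)^T =
  (2 * dotp y v) *: (lmul_mx y)^T - sqnorm y *: (lmul_mx v)^T.
Proof.
have -> : (lmul_mx y)^T *m lmul_mx v = (2 * dotp y v)%:M - (lmul_mx v)^T *m lmul_mx y.
  by rewrite -lmul_polar_tr addrK.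
by rewrite mulmxBl mul_scalar_mx -mulmxA lmul_mxKr mul_mx_scalar.
Qed.

Definition ilmul (y : quat) : 'M[R]_4 := (sqnorm y)^-1 *: (lmul_mx y)^T.

Lemma ilmulK (y : quat) : y != 0 -> ilmul y *m lmul_mx y = 1%:M.
Proof. by move=> y0; rewrite -scalemxAl lmul_mxK scale_scalar_mx mulVf // sqnorm_eq0. Qed.

Lemma lmulK (y : quat) : y != 0 -> lmul_mx y *m ilmul y = 1%:M.
Proof. by move=> y0; rewrite -scalemxAr lmul_mxKr scale_scalar_mx mulVf // sqnorm_eq0. Qed.

(** Gauge transformation by y = z - p_i0: the new connection is y^-1 (dy + A y), which [conn4_reg]
    computes. The constant [N] leaves the initial value free to be normalized. *)
Lemma derive_regular (q q' : R -> quat) (P : R -> 'M[R]_4) (N : 'M[R]_4) :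
  (forall t : R, 0 <= t <= 1 -> Uset p (q t)) ->
  (forall t : R, 0 <= t <= 1 -> is_derive t 1 q (q' t)) ->
  parallel q q' P ->
  forall t : R, 0 <= t <= 1 ->
  is_derive t 1 (fun u => ilmul (q u - p i0) *m P u *m N)
    (- (conn_reg (q t) (q' t) *m (ilmul (q t - p i0) *m P t *m N))).
Proof.
move=> Uq dq dP t tI; have s0 := Uset_sqnorm i0 (Uq _ tI).
have H1 : is_derive t 1 (fun u => q u - p i0) (q' t).
  have H := is_deriveB (dq _ tI) (is_derive_cst (p i0) t 1).
  by apply: is_derive_eq H _; rewrite subr0.
have H2 := is_derive_inv_sqnorm s0 (dq _ tI).
have H3 := is_derive_scale H2 (is_derive_trmx (is_derive_linear (@lmul_mx R) H1)).
have H4 := is_derive_mulmx (is_derive_mulmx H3 (dP _ tI)) (is_derive_cst N t 1).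
apply: is_derive_eq H4 _; rewrite mulmx0 addr0 !mulmxA -!mulNmx; congr (_ *m N).
have E := conn4_reg (q' t) (Uq _ tI).
set y := q t - p i0 in s0 E *; set v := q' t in E *; set s := sqnorm y in s0 E *.
have w0 : wreg (q t) != 0.
  by rewrite wreg_hfun ?mulf_neq0 // ?gt_eqF //; [apply: h_gt0|]; exact: Uq.
have E' : conn_reg (q t) v = s^-1 *: ((lmul_mx y)^T *m (lmul_mx v + conn4 (q t) v *m lmul_mx y)).
  rewrite E -scalemxAr scalerA mulrA mulVf // mul1r /conn_reg -/y.
  by rewrite mulmxA.
rewrite E' /ilmul -/s /=; move: (conn4 (q t) v) (P t) => B Pt.
have S : (lmul_mx y)^T *m (lmul_mx v + B *m lmul_mx y) *m (lmul_mx y)^T =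
    (2 * dotp y v) *: (lmul_mx y)^T - s *: (lmul_mx v)^T + s *: ((lmul_mx y)^T *m B).
  rewrite mulmxDr mulmxDl lmul_sandwich; congr (_ + _).
  by rewrite mulmxA -mulmxA lmul_mxKr mul_mx_scalar.
rewrite mulmxA -mulmxDl; congr (_ *m Pt).
rewrite [RHS]mulNmx -[in RHS]scalemxAl -[in RHS]scalemxAr S mulmxN -scalemxAl.
move: ((lmul_mx y)^T *m B) (lmul_mx y)^T (lmul_mx v)^T => X Y V.
by apply/matrixP => i j; rewrite !mxE; field.
Qed.

End RegularGauge.

(** * Edges of a small triangle *)

Section Edges.
Variable R : realType.
Local Notation quat := 'cV[R]_4.
Variables (n : nat) (p : 'I_n -> quat) (k : 'I_n -> R) (c a : R) (i0 : 'I_n).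
Variable J : 'cV[R]_6 -> 'M[R]_6.
Local Notation M := (Mset p).
Local Notation sol := (solution p k c a).
Local Notation h := (hfun p k c a).
Hypothesis h_gt0 : forall z, Uset p z -> 0 < h z.
Hypothesis HJ : is_complex_structure (volform sol) M J.
Hypothesis p_inj : injective p.
Hypothesis k_gt0 : forall i, 0 < k i.
Hypothesis c_ge0 : 0 <= c.
Hypothesis a_gt0 : 0 < a.
Variable eta : quat.
Hypothesis eta1 : sqnorm eta = 1.
Local Notation A := (bismut (kform sol) J).
Local Notation conn4 := (conn4 p k c a).
Local Notation parallel := (parallel p k c a).
Local Notation K := (a * k i0).
Local Notation hreg := (hreg p k c a i0).
Local Notation gradreg := (gradreg p k a i0).

Definition emb_mx : 'M[R]_(4, 3) := \matrix_(i, j) ((i : nat) == j.+1)%:R.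
Definition emb (s : 'cV[R]_3) : quat := emb_mx *m s.

Lemma emb0 s : emb s o0 0 = 0.
Proof. by rewrite mxE big1 // => j _; rewrite mxE /= mul0r. Qed.

Lemma emb_norm s : `|emb s| <= `|s|.
Proof.
apply: mx_norm_le => // i j; rewrite mxE (ord1 j) {j}.
case: i => -[|i] hi.
  by rewrite big1 ?normr0 // => j _; rewrite mxE /= mul0r.
have hi' : (i < 3)%N by [].
rewrite (bigD1 (Ordinal hi')) //= big1 => [|j ji].
  by rewrite mxE /= eqxx mul1r addr0 mx_norm_entry.
rewrite mxE /= eqSS; case: eqP => [E|_]; last by rewrite mul0r.
by case/negP: ji; apply/eqP/val_inj.
Qed.

Definition vertex (ab : R * R) (s : 'cV[R]_3) : quat := ab.1 *: qone R + ab.2 *: emb s.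

(** A convex set containing the coordinates of the vertices 1, 1 + s, 2, hence those of the edges.
    As [|s|] is a maximum norm, squared lengths there lie between 1 and 4 + 3 = 7. *)
Definition admissible (ab : R * R) := (1 <= ab.1 <= 2) && (0 <= ab.2 <= 1).

Lemma vertex_edge ab ab' s (t : R) :
  vertex ab s + t *: (vertex ab' s - vertex ab s) =
  vertex (ab.1 + t * (ab'.1 - ab.1), ab.2 + t * (ab'.2 - ab.2)) s.
Proof.
rewrite /vertex opprD addrACA -!scalerBl scalerDr !scalerA addrACA -!scalerDl.
by [].
Qed.

Lemma admissible_edge ab ab' (t : R) : admissible ab -> admissible ab' -> 0 <= t <= 1 ->
  admissible (ab.1 + t * (ab'.1 - ab.1), ab.2 + t * (ab'.2 - ab.2)).
Proof.
case: ab ab' => [x y] [x' y'] /andP[/andP[/= ? ?] /andP[/= ? ?]].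
move=> /andP[/andP[/= ? ?] /andP[/= ? ?]] /andP[? ?].
by apply/andP; split; apply/andP; split => /=; nra.
Qed.

Lemma vertexE ab s i :
  vertex ab s i 0 = ab.1 * qone R i 0 + ab.2 * emb s i 0.
Proof. by rewrite mxE; congr (_ + _); rewrite mxE. Qed.

Lemma vertex_re ab s : vertex ab s o0 0 = ab.1.
Proof.
by rewrite vertexE emb0 mulr0 addr0 mxE /= mulr1.
Qed.

Lemma vertex_sqnorm ab s : admissible ab -> `|s| <= 1 -> 1 <= sqnorm (vertex ab s) <= 7.
Proof.
move=> /andP[/andP[? ?] /andP[? ?]] s1.
have E i : i != o0 -> 0 <= vertex ab s i 0 ^+ 2 <= 1.
  move=> i0'; rewrite sqr_ge0 /= -[leRHS](expr1n _ 2) -[X in X <= _]real_normK ?num_real //.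
  rewrite ler_pXn2r ?nnegrE // vertexE mxE (negbTE i0') mulr0 add0r.
  have := mx_norm_entry (emb s) i 0; have := emb_norm s => H1 H2.
  rewrite normrM ger0_norm // mulr_ile1 //.
  exact: le_trans H2 (le_trans H1 s1).
have := E o1 isT; have := E o2 isT; have := E o3 isT.
rewrite sqnormE vertex_re => /andP[? ?] /andP[? ?] /andP[? ?].
by apply/andP; split; nra.
Qed.

(* The lower bound comes from the parallelogram law. *)
Lemma sqnorm_sub (u d : quat) : sqnorm d / 2 - sqnorm u <= sqnorm (u - d).
Proof.
rewrite -subr_ge0.
have -> : sqnorm (u - d) - (sqnorm d / 2 - sqnorm u) = 2 * sqnorm (u - 2^-1 *: d).
  by rewrite !sqnormE !mxE; field.
by rewrite mulr_ge0 // sqnorm_ge0.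
Qed.

(** A positive lower bound for the squared distances to the other centres, obtained without a
    minimum; the summand 1 keeps it positive when there are none. *)
Definition sep : R := (1 + \sum_(i | i != i0) (sqnorm (p i - p i0))^-1)^-1.

Lemma sep_gt0 : 0 < sep.
Proof.
rewrite invr_gt0 ltr_pwDl // sumr_ge0 // => i _.
by rewrite invr_ge0 sqnorm_ge0.
Qed.

Lemma sep_le i : i != i0 -> sep <= sqnorm (p i - p i0).
Proof.
move=> ii0; have s0 : 0 < sqnorm (p i - p i0).
  by apply: sqnorm_gt0; rewrite subr_eq0; apply: contra ii0 => /eqP/p_inj ->.
rewrite -[leRHS]invrK lef_pV2 ?posrE ?invr_gt0 //; last first.
  by rewrite -invr_gt0; exact: sep_gt0.
rewrite (bigD1 i) //= addrCA lerDl addr_ge0 // sumr_ge0 // => j _.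
by rewrite invr_ge0 sqnorm_ge0.
Qed.

Definition ray_pt (r : R) (q : quat) : quat := p i0 + r *: (lmul_mx eta *m q).

Lemma point_sub r q : ray_pt r q - p i0 = r *: (lmul_mx eta *m q).
Proof. by rewrite /ray_pt addrC addKr. Qed.

Lemma sqnorm_eta q : sqnorm (lmul_mx eta *m q) = sqnorm q.
Proof. by rewrite sqnorm_lmul eta1 mul1r. Qed.

(** 28 = 4 * 7: the squared displacement is at most 7 r^2 <= sep / 4, and [sqnorm_sub] leaves sep /
    2 - sep / 4. *)
Lemma point_sqnorm r q i : i != i0 -> 28 * r ^+ 2 <= sep -> sqnorm q <= 7 ->
  sep / 4 <= sqnorm (ray_pt r q - p i).
Proof.
move=> ii0 rs q7.
have -> : ray_pt r q - p i = r *: (lmul_mx eta *m q) - (p i - p i0).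
  by rewrite /ray_pt opprB addrA [p i0 + _]addrC.
have := sqnorm_sub (r *: (lmul_mx eta *m q)) (p i - p i0).
rewrite sqnormZ sqnorm_eta; have := sep_le ii0.
have : r ^+ 2 * sqnorm q <= r ^+ 2 * 7 by rewrite ler_wpM2l // sqr_ge0.
lra.
Qed.

Lemma point_U r ab s : 0 < r -> 28 * r ^+ 2 <= sep -> admissible ab -> `|s| <= 1 ->
  Uset p (ray_pt r (vertex ab s)).
Proof.
move=> r0 rs Hab s1 i E; have /andP[q1 q7] := vertex_sqnorm Hab s1.
have [ii0|ii0] := eqVneq i i0.
  move/eqP: E; rewrite ii0 -subr_eq0 point_sub -sqnorm_eq0 sqnormZ sqnorm_eta.
  by rewrite mulf_eq0 sqrf_eq0 gt_eqF //= gt_eqF //; lra.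
have := point_sqnorm ii0 rs q7; rewrite E subrr.
by have -> : sqnorm (0 : quat) = 0; [apply/eqP; rewrite sqnorm_eq0|have := sep_gt0; lra].
Qed.

(** The difference quotient of [hreg] along the ray, with the division by [r] carried out, so that
    it is visibly bounded as [r] tends to 0. *)
Definition slope (r : R) (q : quat) : R := a * \sum_(i | i != i0)
  k i * (2 * dotp (lmul_mx eta *m q) (p i - p i0) - r * sqnorm q)
    * ((sqnorm (p i - p i0))^-1 * (sqnorm (ray_pt r q - p i))^-1).

Lemma hreg_slope r q : 28 * r ^+ 2 <= sep -> sqnorm q <= 7 ->
  hreg (ray_pt r q) = hreg (p i0) + r * slope r q.
Proof.
move=> rs q7; rewrite /hreg /slope -addrA; congr (_ + _).
rewrite mulrCA -mulrDr; congr (_ * _); rewrite mulr_sumr -big_split /=.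
apply: eq_bigr => i ii0.
have s1 : sqnorm (ray_pt r q - p i) != 0.
  by rewrite gt_eqF // (lt_le_trans _ (point_sqnorm ii0 rs q7)) // divr_gt0 // sep_gt0.
have s2 : sqnorm (p i - p i0) != 0.
  by rewrite gt_eqF // (lt_le_trans _ (sep_le ii0)) // sep_gt0.
have sE : sqnorm (p i0 - p i) = sqnorm (p i - p i0).
  by rewrite -opprB -scaleN1r sqnormZ; ring.
have E : sqnorm (ray_pt r q - p i) =
    r ^+ 2 * sqnorm q - 2 * r * dotp (lmul_mx eta *m q) (p i - p i0) + sqnorm (p i - p i0).
  rewrite -(sqnorm_eta q) /ray_pt; move: (lmul_mx eta *m q) => u.
  by rewrite !sqnormE dotpE !mxE; ring.
rewrite sE; move: s1 s2; rewrite E; move: (sqnorm (p i - p i0)) (sqnorm q) (dotp _ _) => x y z s1 s2.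
by field; rewrite s1 s2.
Qed.

Section OneEdge.
Variables (ab ab' : R * R) (r0 : R).
Hypothesis Hab : admissible ab.
Hypothesis Hab' : admissible ab'.
Hypothesis r0_gt0 : 0 < r0.
Hypothesis r0_small : 28 * r0 ^+ 2 <= sep.

Definition edge (t : R) (s : 'cV[R]_3) : quat :=
  vertex ab s + t *: (vertex ab' s - vertex ab s).

Definition side (s : 'cV[R]_3) : quat := vertex ab' s - vertex ab s.

Definition lead : R := hreg (p i0) / K.

Definition lead_conn (r t : R) (s : 'cV[R]_3) : 'M[R]_4 :=
  lead *: ((lmul_mx (edge t s))^T *m lmul_mx (side s)).

(** The first coefficient is (hreg(z) / wreg(z) - hreg(p_i0) / K) / r over a common denominator,
    with [r] cancelled by [slope]; the second term comes from [gradreg]. *)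
Definition rest_conn (r t : R) (s : 'cV[R]_3) : 'M[R]_4 :=
  let q := edge t s in let z := ray_pt r q in
  let qd := (lmul_mx q)^T *m lmul_mx (side s) in
  ((K * slope r q - hreg (p i0) * hreg z * (r * sqnorm q)) * (K^-1 * (wreg p k c a i0 z)^-1)) *: qd
  + (2^-1 * (wreg p k c a i0 z)^-1) *: (qd *m ((lmul_mx (gradreg z))^T *m lmul_mx (lmul_mx eta *m q))).

Lemma smallW r : 0 < r <= r0 -> 28 * r ^+ 2 <= sep.
Proof.
move=> /andP[rp rr0]; apply: le_trans r0_small; rewrite ler_wpM2l //.
by rewrite ler_pXn2r ?nnegrE ?(ltW rp) ?(ltW r0_gt0).
Qed.

Lemma edge_sqnorm t s : 0 <= t <= 1 -> `|s| <= 1 -> 1 <= sqnorm (edge t s) <= 7.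
Proof.
move=> tI sI; rewrite /edge vertex_edge; apply: vertex_sqnorm => //.
exact: admissible_edge.
Qed.

Lemma edge_U r t s : 0 < r <= r0 -> 0 <= t <= 1 -> `|s| <= 1 -> Uset p (ray_pt r (edge t s)).
Proof.
move=> rI tI sI; rewrite /edge vertex_edge; have /andP[rp _] := rI.
by apply: point_U => //; [exact: smallW|exact: admissible_edge].
Qed.

Lemma hreg_ge0 z : 0 <= hreg z.
Proof.
rewrite addr_ge0 // mulr_ge0 ?(ltW a_gt0) // sumr_ge0 // => i _.
by rewrite divr_ge0 ?sqnorm_ge0 // ltW.
Qed.

Lemma K_gt0 : 0 < K. Proof. exact: mulr_gt0. Qed.

Lemma K_le_wreg z : K <= wreg p k c a i0 z.
Proof. by rewrite lerDl mulr_ge0 ?hreg_ge0 ?sqnorm_ge0. Qed.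

(** The direction drops out of the leading part, since conj(eta q) (eta v) = conj(q) v; position and
    velocity each contribute a factor [r]. *)
Lemma conn_reg_edge r t s : 0 < r <= r0 -> 0 <= t <= 1 -> `|s| <= 1 ->
  conn_reg p k c a i0 (ray_pt r (edge t s)) (r *: (lmul_mx eta *m side s)) =
  r ^+ 2 *: (lead_conn r t s + r *: rest_conn r t s).
Proof.
move=> rI tI sI; have /andP[q1 q7] := edge_sqnorm tI sI.
have G := hreg_slope (smallW rI) q7.
have K0 : K != 0 by rewrite gt_eqF // K_gt0.
rewrite /conn_reg /lead_conn /rest_conn /lead; set q := edge t s in q1 q7 G *.
set z := ray_pt r q in G *; set W := wreg _ _ _ _ _ _.
have WE : W = K + hreg z * (r ^+ 2 * sqnorm q).
  by rewrite /W /wreg point_sub sqnormZ sqnorm_eta.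
have W0 : W != 0 by rewrite gt_eqF // (lt_le_trans K_gt0 (K_le_wreg z)).
rewrite point_sub; set u := lmul_mx eta *m q.
have uu : (lmul_mx (r *: u))^T *m lmul_mx (r *: (lmul_mx eta *m side s)) =
    r ^+ 2 *: ((lmul_mx q)^T *m lmul_mx (side s)).
  have E1 (y : quat) : lmul_mx (r *: y) = r *: lmul_mx y by rewrite linearZ.
  rewrite !E1 [(r *: _)^T]linearZ /= -scalemxAl -scalemxAr scalerA -expr2 /u !lmul_mxM.
  rewrite trmx_mul !mulmxA -[_ *m _ *m lmul_mx eta]mulmxA lmul_mxK eta1 mulmx1.
  by [].
rewrite uu; set qd := (lmul_mx q)^T *m _; set T := (lmul_mx (gradreg z))^T.
have E2 : qd *m ((hreg z)%:M + 2^-1 *: (T *m lmul_mx (r *: u))) =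
    hreg z *: qd + (2^-1 * r) *: (qd *m (T *m lmul_mx u)).
  rewrite linearZ /= mulmxDr mul_mx_scalar -scalemxAr; congr (_ + _).
  by rewrite -!scalemxAr scalerA.
rewrite -scalemxAl E2; move: (qd *m (T *m _)) => Y.
rewrite !scalerDr !scalerA addrA -scalerDl; congr (_ *: _ + _ *: _); last by field.
move: W0; rewrite WE G; move: (slope r q) (sqnorm q) (hreg (p i0)) => x y g0 W0.
have a0 : a != 0 by rewrite gt_eqF.
have k0 : k i0 != 0 by rewrite gt_eqF.
by field; rewrite W0 k0 a0.
Qed.

Lemma ulip_vertex cd : ulip r0 (fun _ _ s => vertex cd s).
Proof.
apply: ulip_add; first exact: ulip_cst.
apply: ulip_scalemx; first exact: ulip_cst.
by apply: ulip_mulmx; [exact: ulip_cst|exact: ulip_id].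
Qed.

Lemma ulip_side : ulip r0 (fun _ _ s => side s).
Proof. by apply: ulip_add; [|apply: ulip_opp]; exact: ulip_vertex. Qed.

Lemma ulip_edge : ulip r0 (fun _ t s => edge t s).
Proof.
apply: ulip_add; first exact: ulip_vertex.
by apply: ulip_scalemx; [exact: ulip_time|exact: ulip_side].
Qed.

Lemma ulip_qd : ulip r0 (fun _ t s => (lmul_mx (edge t s))^T *m lmul_mx (side s)).
Proof.
apply: ulip_mulmx; last exact/ulip_lmul/ulip_side.
exact/ulip_tr/ulip_lmul/ulip_edge.
Qed.

Lemma ulip_lead : ulip r0 lead_conn.
Proof. by apply: ulip_scalemx; [exact: ulip_cst|exact: ulip_qd]. Qed.

Lemma ulip_eta : ulip r0 (fun _ t s => lmul_mx eta *m edge t s).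
Proof. by apply: ulip_mulmx; [exact: ulip_cst|exact: ulip_edge]. Qed.

Lemma ulip_point q0 : ulip r0 (fun r t s => ray_pt r (edge t s) - q0).
Proof.
apply: ulip_add; last exact: ulip_cst.
apply: ulip_add; first exact: ulip_cst.
by apply: ulip_scalemx; [exact: ulip_scale|exact: ulip_eta].
Qed.

Lemma ulip_inv_point i : i != i0 ->
  ulip r0 (fun r t s => (sqnorm (ray_pt r (edge t s) - p i))^-1).
Proof.
move=> ii0; apply: (@ulip_inv _ _ _ (sep / 4)).
- by rewrite divr_gt0 // sep_gt0.
- move=> r t s rI tI sI; have /andP[_ q7] := edge_sqnorm tI sI.
  by apply: point_sqnorm => //; exact: smallW.
- exact/ulip_sqnorm/ulip_point.
Qed.

Lemma ulip_hreg : ulip r0 (fun r t s => hreg (ray_pt r (edge t s))).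
Proof.
apply: ulip_add; first exact: ulip_cst.
apply: ulip_mul; first exact: ulip_cst.
apply: ulip_sum => i ii0.
by apply: ulip_mul; [exact: ulip_cst|exact: ulip_inv_point].
Qed.

Lemma ulip_sqedge : ulip r0 (fun r t s => sqnorm (edge t s)).
Proof. exact/ulip_sqnorm/ulip_edge. Qed.

Lemma ulip_slope : ulip r0 (fun r t s => slope r (edge t s)).
Proof.
apply: ulip_mul; first exact: ulip_cst.
apply: ulip_sum => i ii0; apply: ulip_mul; last first.
  by apply: ulip_mul; [exact: ulip_cst|exact: ulip_inv_point].
apply: ulip_mul; first exact: ulip_cst.
apply: ulip_add.
  apply: ulip_mul; first exact: ulip_cst.
  by apply: ulip_dotp; [exact: ulip_eta|exact: ulip_cst].
by apply: ulip_opp; apply: ulip_mul; [exact: ulip_scale|exact: ulip_sqedge].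
Qed.

Lemma ulip_inv_wreg : ulip r0 (fun r t s => (wreg p k c a i0 (ray_pt r (edge t s)))^-1).
Proof.
apply: (ulip_inv K_gt0) => [r t s _ _ _|]; first exact: K_le_wreg.
apply: ulip_add; first exact: ulip_cst.
by apply: ulip_mul; [exact: ulip_hreg|exact/ulip_sqnorm/ulip_point].
Qed.

Lemma ulip_gradreg : ulip r0 (fun r t s => gradreg (ray_pt r (edge t s))).
Proof.
apply: ulip_sum => i ii0; apply: ulip_scalemx; last exact: ulip_point.
have H := ulip_inv_point ii0.
apply: ulip_ext (ulip_mul (ulip_cst _ (- (2 * a * k i))) (ulip_mul H H)).
by move=> r t s _ _ _; rewrite expr2 invfM.
Qed.

Lemma ulip_rest : ulip r0 rest_conn.
Proof.
apply: ulip_add; apply: ulip_scalemx.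
- apply: ulip_mul; last by apply: ulip_mul; [exact: ulip_cst|exact: ulip_inv_wreg].
  apply: ulip_add; first by apply: ulip_mul; [exact: ulip_cst|exact: ulip_slope].
  apply: ulip_opp; apply: ulip_mul.
    by apply: ulip_mul; [exact: ulip_cst|exact: ulip_hreg].
  by apply: ulip_mul; [exact: ulip_scale|exact: ulip_sqedge].
- exact: ulip_qd.
- by apply: ulip_mul; [exact: ulip_cst|exact: ulip_inv_wreg].
- apply: ulip_mulmx; first exact: ulip_qd.
  apply: ulip_mulmx; last exact/ulip_lmul/ulip_eta.
  exact/ulip_tr/ulip_lmul/ulip_gradreg.
Qed.

Variable xb : 'cV[R]_6.
Hypothesis xb_centre : prC2 xb = p i0.

Definition node (r : R) (q : quat) : 'cV[R]_6 := xb + fib_vec (r *: (lmul_mx eta *m q)).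

Lemma prC2_node r q : prC2 (node r q) = ray_pt r q.
Proof. by rewrite linearD /= prC2_fib_vec xb_centre. Qed.

(** [Q] is the transport written in the frame z - p_i0 at both ends. The frame factors cancel
    between consecutive edges, so only the matrices [Q] need be multiplied. *)
Lemma edge_solution r s : 0 < r <= r0 -> `|s| <= 1 ->
  exists Q : R -> 'M[R]_4,
    [/\ Q 0 = 1%:M,
      forall t : R, 0 <= t <= 1 -> is_derive t 1 Q
        (- ((r ^+ 2 *: (lead_conn r t s + r *: rest_conn r t s)) *m Q t)) &
      transport M A (node r (vertex ab s)) (node r (vertex ab' s))
        (base R + fib R *m (lmul_mx (r *: (lmul_mx eta *m vertex ab' s)) *m Q 1
          *m ilmul (r *: (lmul_mx eta *m vertex ab s))) *m (fib R)^T)].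
Proof.
move=> rI sI; have /andP[rp _] := rI.
have I0 : 0 <= (0 : R) <= 1 by rewrite lexx ler01.
have I1 : 0 <= (1 : R) <= 1 by rewrite lexx ler01.
pose v := r *: (lmul_mx eta *m side s); pose x := node r (vertex ab s).
have pE (t : R) : prC2 x + t *: v = ray_pt r (edge t s).
  rewrite prC2_node /ray_pt /v -addrA scalerA mulrC -scalerA -scalerDr.
  by rewrite [t *: _]scalemxAr -mulmxDr.
have Mx : M x by rewrite /Mset /= prC2_node; have := edge_U rI I0 sI; rewrite /edge scale0r addr0.
have UE (t : R) : 0 <= t <= 1 -> Uset p (prC2 x + t *: v).
  by move=> tI; rewrite pE; exact: edge_U.
have [P [dP P0 HT]] := segment_transport h_gt0 HJ Mx UE.
have dq (t : R) : 0 <= t <= 1 -> is_derive t 1 (fun t : R => prC2 x + t *: v) v.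
  move=> _; have H1 := @is_derive_scale R R 4 1 id (cst v) t 1 1 0 (is_derive_id _ _) (is_derive_cst _ _ _).
  have H := is_deriveD (is_derive_cst (prC2 x) t 1) H1.
  by apply: is_derive_eq H _; rewrite add0r scaler0 addr0 scale1r.
have y0 (t : R) : 0 <= t <= 1 -> r *: (lmul_mx eta *m edge t s) != 0.
  move=> tI; rewrite -sqnorm_eq0 sqnormZ sqnorm_eta mulf_neq0 ?sqrf_eq0 ?gt_eqF //.
  by have /andP[+ _] := edge_sqnorm tI sI; lra.
pose N := lmul_mx (r *: (lmul_mx eta *m vertex ab s)).
exists (fun t => ilmul (prC2 x + t *: v - p i0) *m P t *m N).
have e0 : edge 0 s = vertex ab s by rewrite /edge scale0r addr0.
have e1 : edge 1 s = vertex ab' s by rewrite /edge scale1r addrC subrK.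
split.
- by rewrite pE point_sub e0 P0 mulmx1 ilmulK // -e0 y0.
- move=> t tI; rewrite -conn_reg_edge // -/v -pE.
  exact: (derive_regular i0 h_gt0 (q := fun t : R => prC2 x + t *: v) N UE dq dP tI).
rewrite pE point_sub e1.
have -> : node r (vertex ab' s) = x + fib_vec v.
  rewrite /x /node -addrA; congr (_ + _).
  rewrite /fib_vec -mulmxDr /v -scalerDr -mulmxDr; congr (_ *m (_ *: (_ *m _))).
  by rewrite /side addrC subrK.
set Y1 := r *: (lmul_mx eta *m vertex ab' s); set Y0 := r *: (lmul_mx eta *m vertex ab s).
have Y10 : Y1 != 0 by rewrite /Y1 -e1 y0.
have Y00 : Y0 != 0 by rewrite /Y0 -e0 y0.
have -> : lmul_mx Y1 *m (ilmul Y1 *m P 1 *m N) *m ilmul Y0 = P 1; last exact: HT.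
by rewrite !mulmxA lmulK // mul1mx -mulmxA lmulK // mulmx1.
Qed.

End OneEdge.
End Edges.

Lemma transport_trans (R : realType) (d : nat) (M : set 'cV[R]_d.+1)
    (A : 'cV[R]_d.+1 -> 'cV[R]_d.+1 -> 'M[R]_d.+1) x y z T S :
  transport M A x y T -> transport M A y z S -> transport M A x z (S *m T).
Proof.
move=> HT; elim=> [|{}y' z' S' S'' _ IH HS]; first by rewrite mul1mx.
by rewrite -mulmxA; exact: transport_step IH HS.
Qed.

(** * Transport around a triangle *)

Section Expansion.
Variable R : realType.
Local Notation quat := 'cV[R]_4.
Variables (n : nat) (p : 'I_n -> quat) (k : 'I_n -> R) (c a : R) (i0 : 'I_n).
Variable J : 'cV[R]_6 -> 'M[R]_6.
Local Notation M := (Mset p).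
Local Notation sol := (solution p k c a).
Local Notation h := (hfun p k c a).
Hypothesis h_gt0 : forall z, Uset p z -> 0 < h z.
Hypothesis HJ : is_complex_structure (volform sol) M J.
Hypothesis p_inj : injective p.
Hypothesis k_gt0 : forall i, 0 < k i.
Hypothesis c_ge0 : 0 <= c.
Hypothesis a_gt0 : 0 < a.
Variable eta : quat.
Hypothesis eta1 : sqnorm eta = 1.
Local Notation A := (bismut (kform sol) J).
Variable xb : 'cV[R]_6.
Hypothesis xb_centre : prC2 xb = p i0.
Variable r0 : R.
Hypothesis r0_gt0 : 0 < r0.
Hypothesis r0_small : 28 * r0 ^+ 2 <= sep p i0.
Local Notation lead := (lead p k c a i0).
Local Notation node := (node eta xb).

(** The integral of conj(q) dq along the edge. *)
Definition edge_tot (ab ab' : R * R) (s : 'cV[R]_3) : 'M[R]_4 :=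
  (lmul_mx (vertex ab s))^T *m lmul_mx (side ab ab' s)
  + 2^-1 *: ((lmul_mx (side ab ab' s))^T *m lmul_mx (side ab ab' s)).

Lemma edge_expansion ab ab' : admissible ab -> admissible ab' ->
  exists r1, 0 < r1 <= r0 /\ exists Q rem : R -> 'cV[R]_3 -> 'M[R]_4,
    ulip r1 (fun r _ s => rem r s) /\
    forall r s, 0 < r <= r1 -> `|s| <= 1 ->
      Q r s = 1%:M - (r ^+ 2 * lead) *: edge_tot ab ab' s + r ^+ 3 *: rem r s /\
      transport M A (node r (vertex ab s)) (node r (vertex ab' s))
        (base R + fib R *m (lmul_mx (r *: (lmul_mx eta *m vertex ab' s)) *m Q r s
          *m ilmul (r *: (lmul_mx eta *m vertex ab s))) *m (fib R)^T).
Proof.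
move=> Hab Hab'.
(* Pairing scale and parameter lets one choice produce the whole family; outside the range the value
   0 is arbitrary. *)
have H (rs : R * 'cV[R]_3) : exists Q : R -> 'M[R]_4, 0 < rs.1 <= r0 -> `|rs.2| <= 1 ->
    [/\ Q 0 = 1%:M,
      forall t : R, 0 <= t <= 1 -> is_derive t 1 Q
        (- ((rs.1 ^+ 2 *: (lead_conn p k c a i0 ab ab' rs.1 t rs.2
             + rs.1 *: rest_conn p k c a i0 eta ab ab' rs.1 t rs.2)) *m Q t)) &
      transport M A (node rs.1 (vertex ab rs.2)) (node rs.1 (vertex ab' rs.2))
        (base R + fib R *m (lmul_mx (rs.1 *: (lmul_mx eta *m vertex ab' rs.2)) *m Q 1
          *m ilmul (rs.1 *: (lmul_mx eta *m vertex ab rs.2))) *m (fib R)^T)].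
  have [rI|nr] := boolP (0 < rs.1 <= r0); last by exists (fun=> 0).
  have [sI|ns] := boolP (`|rs.2| <= 1); last by exists (fun=> 0).
  have [Q HQ] := edge_solution h_gt0 HJ p_inj k_gt0 c_ge0 a_gt0 eta1 Hab Hab' r0_gt0
    r0_small xb_centre rI sI.
  by exists Q.
have [Q HQ] := choice H.
pose Lam (r : R) (s : 'cV[R]_3) (t : R) : 'M[R]_4 := lead *:
  (t *: ((lmul_mx (vertex ab s))^T *m lmul_mx (side ab ab' s))
   + (2^-1 * (t * t)) *: ((lmul_mx (side ab ab' s))^T *m lmul_mx (side ab ab' s))).
have dt (t : R) := is_derive_id t (1 : R).
have dLam r s (t : R) : is_derive t 1 (Lam r s) (lead_conn p k c a i0 ab ab' r t s).
  set X := (lmul_mx (vertex ab s))^T *m lmul_mx (side ab ab' s).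
  set Y := (lmul_mx (side ab ab' s))^T *m lmul_mx (side ab ab' s).
  have H1 := @is_derive_scale R R 4 4 id (cst X) t 1 1 0 (dt t) (is_derive_cst _ _ _).
  have H2 := @is_derive_mul R R id id t 1 1 1 (dt t) (dt t).
  have H3 := is_derive_mul (is_derive_cst (2^-1 : R) t 1) H2.
  have H4 := is_derive_scale H3 (is_derive_cst Y t 1).
  have H5 := is_derive_scale (is_derive_cst lead t 1) (is_deriveD H1 H4).
  apply: is_derive_eq H5 _; rewrite scale0r add0r /lead_conn !scaler0 !addr0.
  congr (_ *: _); rewrite /edge -/(side ab ab' s) linearD /= linearZ /=.
  rewrite [(_ + _)^T]linearD /= [(_ *: _)^T]linearZ /= mulmxDl -scalemxAl -/X -/Y.
  by rewrite scale1r mul0r add0r mul1r mulr1; congr (_ + _ *: _); field.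
have [|||||r1 [r1I Hrem]] := @ulip_ode R r0 (lead_conn p k c a i0 ab ab')
    (rest_conn p k c a i0 eta ab ab') Lam (fun r s => Q (r, s)) r0_gt0.
- exact: ulip_lead.
- exact: ulip_rest.
- by move=> r s; rewrite /Lam mul0r mulr0 !scale0r addr0 scaler0.
- by move=> r s rI sI; have [] := HQ (r, s) rI sI.
- by move=> r s t rI sI tI; have [_ + _] := HQ (r, s) rI sI; apply.
exists r1; split=> //; exists (fun r s => Q (r, s) 1).
exists (fun r s => r ^- 3 *: (Q (r, s) 1 - 1%:M + r ^+ 2 *: Lam r s 1)); split=> // r s rI sI.
have rI0 : 0 < r <= r0.
  by have /andP[rp rr1] := rI; have /andP[_ r10] := r1I; rewrite rp (le_trans rr1).
have [_ _ HT] := HQ (r, s) rI0 sI; split=> //.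
have r3 : r ^+ 3 != 0 by rewrite expf_neq0 // gt_eqF //; case/andP: rI.
rewrite scalerA mulfV // scale1r /Lam mulr1 mulr1 scale1r scalerA -/(edge_tot ab ab' s).
move: (Q (r, s) 1) (_ *: edge_tot _ _ _) => X Z.
by apply/matrixP => i j; rewrite !mxE; ring.
Qed.

Definition V1 : R * R := (1, 0).
Definition V2 : R * R := (1, 1).
Definition V3 : R * R := (2, 0).

Lemma emb_tr (s : 'cV[R]_3) : (lmul_mx (emb s))^T = - lmul_mx (emb s).
Proof.
rewrite lmul_mx_tr -linearN /=; congr lmul_mx; apply/colP; apply: forall_ord4;
  by rewrite [LHS]mxE [RHS]mxE /= ?emb0 ?oppr0.
Qed.

(* The real parts telescope; what survives is the area form Im (conj q dq)
   integrated along the triangle 1, 1 + s, 2. *)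
Lemma triangle_tot (s : 'cV[R]_3) :
  edge_tot V1 V2 s + edge_tot V2 V3 s + edge_tot V3 V1 s = - lmul_mx (emb s).
Proof.
set E := lmul_mx (emb s).
have LV ab : lmul_mx (vertex ab s) = ab.1%:M + ab.2 *: E.
  by rewrite /vertex linearD /= !linearZ /= lmul_mx_qone scalemx1.
have LVT ab : (lmul_mx (vertex ab s))^T = ab.1%:M - ab.2 *: E.
  by rewrite LV linearD /= linearZ /= tr_scalar_mx emb_tr scalerN.
have LS ab ab' : lmul_mx (side ab ab' s) = (ab'.1 - ab.1)%:M + (ab'.2 - ab.2) *: E.
  by rewrite linearB /= !LV raddfB /= scalerBl opprD addrACA.
have LST ab ab' : (lmul_mx (side ab ab' s))^T = (ab'.1 - ab.1)%:M - (ab'.2 - ab.2) *: E.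
  by rewrite LS linearD /= linearZ /= tr_scalar_mx emb_tr scalerN.
have mulS (x y z w : R) : (x%:M - y *: E) *m (z%:M + w *: E) =
    (x * z)%:M + (x * w - y * z) *: E - (y * w) *: (E *m E).
  rewrite mulmxBl !mulmxDr mul_scalar_mx scale_scalar_mx mul_scalar_mx scalerA.
  rewrite -!scalemxAl -!scalemxAr mul_mx_scalar !scalerA scalerBl opprD !addrA.
  by rewrite [y * w]mulrC; congr (_ + _ - _); rewrite -!addrA.
rewrite /edge_tot !LVT !LST !LS !mulS /=; clear LV LVT LS LST mulS; move: (E *m E) => E2; clearbody E.
by apply/matrixP => i j; rewrite !mxE; case: (i == j); rewrite /= ?mulr1n ?mulr0n; field.
Qed.

Lemma vertex0 (x : R) (s : 'cV[R]_3) : vertex (x, 0) s = x *: qone R.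
Proof. by rewrite /vertex /= scale0r addr0. Qed.

Lemma triangle_expansion : exists r1, 0 < r1 <= r0 /\
  exists Q rem : R -> 'cV[R]_3 -> 'M[R]_4, ulip r1 (fun r _ s => rem r s) /\
    forall r s, 0 < r <= r1 -> `|s| <= 1 ->
      Q r s = 1%:M + (r ^+ 2 * lead) *: lmul_mx (emb s) + r ^+ 3 *: rem r s /\
      transport M A (node r (qone R)) (node r (qone R))
        (base R + fib R *m (lmul_mx (r *: eta) *m Q r s *m ilmul (r *: eta)) *m (fib R)^T).
Proof.
have a1 : admissible V1 by rewrite /admissible /V1 /=; apply/andP; split; apply/andP; split; lra.
have a2 : admissible V2 by rewrite /admissible /V2 /=; apply/andP; split; apply/andP; split; lra.
have a3 : admissible V3 by rewrite /admissible /V3 /=; apply/andP; split; apply/andP; split; lra.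
have [ra [raI [Qa [ea [ua Ha]]]]] := edge_expansion a1 a2.
have [rb [rbI [Qb [eb [ub Hb]]]]] := edge_expansion a2 a3.
have [rc [rcI [Qc [ec [uc Hc]]]]] := edge_expansion a3 a1.
pose r1 := Num.min ra (Num.min rb rc).
have r1a : r1 <= ra by rewrite ge_min lexx.
have r1b : r1 <= rb by rewrite !ge_min lexx orbT.
have r1c : r1 <= rc by rewrite !ge_min lexx !orbT.
have [ra0 ra1] := andP raI; have [rb0 _] := andP rbI; have [rc0 _] := andP rcI.
exists r1; split; first by rewrite !lt_min ra0 rb0 rc0 (le_trans r1a).
pose ta s := lead *: edge_tot V1 V2 s; pose tb s := lead *: edge_tot V2 V3 s.
pose tc s := lead *: edge_tot V3 V1 s.
have ut ab ab' : ulip r1 (fun _ _ s => lead *: edge_tot ab ab' s).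
  have uv cd : ulip r1 (fun _ _ s => vertex cd s) by exact: ulip_vertex.
  have us : ulip r1 (fun _ _ s => side ab ab' s) by exact: ulip_side.
  apply: ulip_scalemx; first exact: ulip_cst.
  apply: ulip_add.
    by apply: ulip_mulmx; [exact/ulip_tr/ulip_lmul|exact/ulip_lmul].
  apply: ulip_scalemx; first exact: ulip_cst.
  by apply: ulip_mulmx; [exact/ulip_tr/ulip_lmul|exact/ulip_lmul].
(* Each factor becomes 1 + r^2 X. Products of two or three [X] carry r^4 or r^6 and go into the
   remainder at order r^3. *)
pose X ab ab' (e : R -> 'cV[R]_3 -> 'M[R]_4) r s := r *: e r s - lead *: edge_tot ab ab' s.
have uX ab ab' e : ulip r1 (fun r _ s => e r s) -> ulip r1 (fun r _ s => X ab ab' e r s).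
  move=> ue; apply: ulip_add; last exact/ulip_opp/ut.
  by apply: ulip_scalemx; [exact: ulip_scale|exact: ue].
have {}ua := ulipW r1a ua; have {}ub := ulipW r1b ub; have {}uc := ulipW r1c uc.
pose Xa := X V1 V2 ea; pose Xb := X V2 V3 eb; pose Xc := X V3 V1 ec.
have uXa : ulip r1 (fun r _ s => Xa r s) by exact: uX.
have uXb : ulip r1 (fun r _ s => Xb r s) by exact: uX.
have uXc : ulip r1 (fun r _ s => Xc r s) by exact: uX.
exists (fun r s => Qc r s *m Qb r s *m Qa r s).
exists (fun r s => (ea r s + eb r s + ec r s)
  + (r *: (Xc r s *m Xb r s + Xc r s *m Xa r s + Xb r s *m Xa r s)
     + (r * (r * r)) *: (Xc r s *m Xb r s *m Xa r s))).
split.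
  apply: ulip_add; first by apply: ulip_add => //; exact: ulip_add.
  apply: ulip_add; apply: ulip_scalemx.
  - exact: ulip_scale.
  - by apply: ulip_add; [apply: ulip_add|]; exact: ulip_mulmx.
  - by apply: ulip_mul; [|apply: ulip_mul]; exact: ulip_scale.
  - by apply: ulip_mulmx => //; exact: ulip_mulmx.
move=> r s /andP[rp rr1] sI.
have [Ea Ta] : _ /\ _ := Ha r s (introT andP (conj rp (le_trans rr1 r1a))) sI.
have [Eb Tb] : _ /\ _ := Hb r s (introT andP (conj rp (le_trans rr1 r1b))) sI.
have [Ec Tc] : _ /\ _ := Hc r s (introT andP (conj rp (le_trans rr1 r1c))) sI.
have EX ab ab' e : 1%:M - (r ^+ 2 * lead) *: edge_tot ab ab' s + r ^+ 3 *: e r s =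
    1%:M + r ^+ 2 *: X ab ab' e r s.
  by rewrite /X scalerBr !scalerA -exprSr -addrA [in RHS]addrC [- _ + _]addrC addrC.
split.
  have -> : Qa r s = 1%:M + r ^+ 2 *: Xa r s by rewrite Ea; exact: EX.
  have -> : Qb r s = 1%:M + r ^+ 2 *: Xb r s by rewrite Eb; exact: EX.
  have -> : Qc r s = 1%:M + r ^+ 2 *: Xc r s by rewrite Ec; exact: EX.
  rewrite -[(_ * lead) *: _]scalerA.
  have -> : lead *: lmul_mx (emb s) = Xa r s + Xb r s + Xc r s - r *: (ea r s + eb r s + ec r s).
    have Z (T1 T2 T3 E1 E2 E3 : 'M[R]_4) : - (T1 + T2 + T3) =
        (r *: E1 - T1) + (r *: E2 - T2) + (r *: E3 - T3) - r *: (E1 + E2 + E3).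
      by apply/matrixP => i j; rewrite !mxE; ring.
    rewrite -[lmul_mx _]opprK -triangle_tot scalerN 2!scalerDr; exact: Z.
  move: (Xa r s) (Xb r s) (Xc r s) (ea r s + eb r s + ec r s) => A1 A2 A3 E.
  have H2 (U V : 'M[R]_4) : (1%:M + U) *m (1%:M + V) = 1%:M + (U + V + U *m V).
    by rewrite mulmxDl mul1mx mulmxDr mulmx1 -addrA; congr (_ + _); rewrite addrCA addrA.
  rewrite !H2 !mulmxDl -!scalemxAl -!scalemxAr -scalemxAl.
  move: (A3 *m A2 *m A1) (A3 *m A2) (A3 *m A1) (A2 *m A1) => B1 B2 B3 B4.
  by apply/matrixP => i j; rewrite !mxE; ring.
have nz cd : admissible cd -> r *: (lmul_mx eta *m vertex cd s) != 0.
  move=> Hcd; have /andP[+ _] := vertex_sqnorm Hcd sI.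
  rewrite -sqnorm_eq0 sqnormZ (sqnorm_eta eta1) => q1.
  by rewrite mulf_neq0 ?sqrf_eq0 ?gt_eqF //; lra.
have := transport_trans (transport_trans Ta Tb) Tc.
rewrite [_ *m (_ *m _)]mulmxA [X in _ -> transport _ _ _ _ X](_ : _ = 
  (base R + fib R *m (lmul_mx (r *: eta) *m Qc r s *m ilmul (r *: (lmul_mx eta *m vertex V3 s))) *m (fib R)^T)
  *m (base R + fib R *m (lmul_mx (r *: (lmul_mx eta *m vertex V3 s)) *m Qb r s
       *m ilmul (r *: (lmul_mx eta *m vertex V2 s))) *m (fib R)^T)
  *m (base R + fib R *m (lmul_mx (r *: (lmul_mx eta *m vertex V2 s)) *m Qa r s
       *m ilmul (r *: eta)) *m (fib R)^T)).
  by rewrite /V1 !vertex0 scale1r lmul_mx1.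
rewrite !base_mul; congr (_ + _ *m _ *m _).
set Y2 := r *: (lmul_mx eta *m vertex V2 s); set Y3 := r *: (lmul_mx eta *m vertex V3 s).
have K2 := ilmulK (nz _ a2); have K3 := ilmulK (nz _ a3).
rewrite -/Y2 in K2; rewrite -/Y3 in K3.
rewrite !mulmxA -[_ *m ilmul Y3 *m lmul_mx Y3]mulmxA K3 mulmx1.
by rewrite -[_ *m ilmul Y2 *m lmul_mx Y2]mulmxA K2 mulmx1.
Qed.

End Expansion.

(** * Full holonomy *)

Lemma ball_fixed_point (R : realType) m (f : 'cV[R]_m -> 'cV[R]_m) :
  (forall s, `|s| <= 1 -> `|f s| <= 1) ->
  (forall s s', `|s| <= 1 -> `|s'| <= 1 -> `|f s - f s'| <= 2^-1 * `|s - s'|) ->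
  exists2 s, `|s| <= 1 & s = f s.
Proof.
move=> f1 fl; pose U := closed_ball_ (fun x : 'cV[R]_m => `|x|) 0 1.
have UE s : U s <-> `|s| <= 1 by rewrite /U /closed_ball_ /= sub0r normrN.
have fU : set_fun U U f by move=> s /UE s1; apply/UE/f1.
have half0 : 0 <= 2^-1 :> R by lra.
have [|||s Us sE] := @banach_fixed_point R 'cV[R]_m U (mkfun fU).
- exists (NngNum half0); split=> /=; first by lra.
  by move=> [s s'] [/= /UE s1 /UE s'1]; exact: fl.
- exact: closed_closed_ball_.
- by exists 0; apply/UE; rewrite normr0.
by exists s => //; apply/UE.
Qed.

(** * All unit quaternions from loops near one centre *)

Section LocalHolonomy.
Variable R : realType.
Local Notation quat := 'cV[R]_4.

Lemma base_fib_inj (N N' : 'M[R]_4) :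
  base R + fib R *m N *m (fib R)^T = base R + fib R *m N' *m (fib R)^T -> N = N'.
Proof.
have K (X : 'M[R]_4) : (fib R)^T *m (base R + fib R *m X *m (fib R)^T) *m fib R = X.
  move: (tr_fib_base R); move: (base R) => b tb.
  rewrite mulmxDr mulmxDl tb mul0mx add0r !mulmxA fib_trK mul1mx.
  by rewrite -mulmxA fib_trK mulmx1.
by move=> /(congr1 (fun X => (fib R)^T *m X *m fib R)); rewrite !K.
Qed.

Definition imag (q : quat) : 'cV[R]_3 := (emb_mx R)^T *m q.

Lemma imagE (q : quat) (j : 'I_3) (i : 'I_4) : val i = j.+1 -> imag q j 0 = q i 0.
Proof.
move=> ij; rewrite mxE (bigD1 i) //= big1 => [|l li]; rewrite mxE mxE /=.
  by rewrite [nat_of_ord i]ij eqxx mul1r addr0.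
case: eqP => [E|_]; last by rewrite mul0r.
by case/negP: li; apply/eqP/val_inj; rewrite ij.
Qed.

(** On a hemisphere the imaginary part is a coordinate system; this turns the search for a loop into
    three equations for [s]. *)
Lemma imag_inj (q q' : quat) : sqnorm q = 1 -> sqnorm q' = 1 -> 0 <= q o0 0 ->
  0 <= q' o0 0 -> imag q = imag q' -> q = q'.
Proof.
move=> q1 q'1 q0 q'0 E.
have Ei (j : 'I_3) i : val i = j.+1 -> q i 0 = q' i 0.
  by move=> ij; rewrite -(imagE q ij) -(imagE q' ij) E.
have e1 := Ei (@Ordinal 3 0 isT) o1 erefl; have e2 := Ei (@Ordinal 3 1 isT) o2 erefl.
have e3 := Ei (@Ordinal 3 2 isT) o3 erefl.
apply/colP; apply: forall_ord4 => //; apply/eqP; rewrite -(eqrXn2 (n := 2)) //.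
by move: q1 q'1; rewrite !sqnormE e1 e2 e3 => <- /eqP; rewrite -!addrA => /eqP/addIr ->.
Qed.

Lemma imag_emb (s : 'cV[R]_3) : imag (emb s) = s.
Proof.
apply/colP => j; rewrite (@imagE _ j (lift ord0 j)) // mxE (bigD1 j) //= big1 => [|l lj].
  by rewrite mxE /= eqxx mul1r addr0.
rewrite mxE /= eqSS; case: eqP => [E|_]; last by rewrite mul0r.
by case/negP: lj; apply/eqP/val_inj.
Qed.

Lemma imag_qone : imag (qone R) = 0.
Proof. by apply/colP => j; rewrite (@imagE _ j (lift ord0 j)) // !mxE. Qed.

Lemma imag_norm (q : quat) : `|imag q| <= `|q|.
Proof.
apply: mx_norm_le => // i j; rewrite (ord1 j) (@imagE _ i (lift ord0 i)) //.
exact: mx_norm_entry.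
Qed.

Lemma col0_norm (N : 'M[R]_4) : `|N *m qone R| <= `|N|.
Proof. by apply: mx_norm_le => // i j; rewrite (ord1 j) -colE mxE mx_norm_entry. Qed.

(** The squared imaginary part is (1 - q_0) (1 + q_0) <= 2 (1 - q_0). *)
Lemma imag_small (q : quat) (d : R) : sqnorm q = 1 -> 0 <= d ->
  1 - q o0 0 <= d ^+ 2 / 2 -> `|imag q| <= d.
Proof.
move=> q1 d0 qd; apply: mx_norm_le => // i j; rewrite (ord1 j).
rewrite (@imagE _ i (lift ord0 i)) //; set l := lift ord0 i.
rewrite -[leRHS]ger0_norm // -ler_sqr ?nnegrE // !real_normK ?num_real //.
have : q l 0 ^+ 2 + q o0 0 ^+ 2 <= 1.
  rewrite -q1 /sqnorm (bigD1 l) //= (bigD1 o0) //= addrA lerDl sumr_ge0 // => u _.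
  exact: sqr_ge0.
by nra.
Qed.

Variables (n : nat) (p : 'I_n -> quat) (k : 'I_n -> R) (c a : R) (i0 : 'I_n).
Variable J : 'cV[R]_6 -> 'M[R]_6.
Local Notation M := (Mset p).
Local Notation sol := (solution p k c a).
Local Notation h := (hfun p k c a).
Hypothesis h_gt0 : forall z, Uset p z -> 0 < h z.
Hypothesis HJ : is_complex_structure (volform sol) M J.
Hypothesis p_inj : injective p.
Hypothesis k_gt0 : forall i, 0 < k i.
Hypothesis c_ge0 : 0 <= c.
Hypothesis a_gt0 : 0 < a.
Variable eta : quat.
Hypothesis eta1 : sqnorm eta = 1.
Local Notation A := (bismut (kform sol) J).
Variable xb : 'cV[R]_6.
Hypothesis xb_centre : prC2 xb = p i0.
Variable r0 : R.
Hypothesis r0_gt0 : 0 < r0.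
Hypothesis r0_small : 28 * r0 ^+ 2 <= sep p i0.
Local Notation lead := (lead p k c a i0).
Local Notation node := (node eta xb).
Hypothesis lead_gt0 : 0 < lead.

(** Some loop at the node has transport [q] in the frame z - p_i0, whose value at the node is
    [r *: eta]. *)
Definition loop_in (r : R) (q : quat) := transport M A (node r (qone R)) (node r (qone R))
  (base R + fib R *m (lmul_mx (r *: eta) *m lmul_mx q *m ilmul (r *: eta)) *m (fib R)^T).

Lemma scale_eta_neq0 r : 0 < r -> r *: eta != 0.
Proof. by move=> rp; rewrite -sqnorm_eq0 sqnormZ eta1 mulr1 sqrf_eq0 gt_eqF. Qed.

Lemma node_M r : 0 < r <= r0 -> M (node r (qone R)).
Proof.
move=> /andP[rp rr0]; rewrite /Mset /= (prC2_node _ xb_centre).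
have := @point_U R n p i0 p_inj eta eta1 r (1, 0) 0; rewrite vertex0 scale1r; apply=> //.
- apply: le_trans r0_small; rewrite ler_wpM2l //.
  by rewrite ler_pXn2r ?nnegrE ?(ltW rp) ?(ltW r0_gt0).
- by rewrite /admissible /=; apply/andP; split; apply/andP; split; lra.
- by rewrite normr0.
Qed.

Lemma loop_unit r (N : 'M[R]_4) : 0 < r <= r0 ->
  transport M A (node r (qone R)) (node r (qone R))
    (base R + fib R *m (lmul_mx (r *: eta) *m N *m ilmul (r *: eta)) *m (fib R)^T) ->
  N = lmul_mx (N *m qone R) /\ sqnorm (N *m qone R) = 1.
Proof.
move=> rI HT; have /andP[rp _] := rI; have MN := node_M rI.
have [_ [t E tE]] := transport_act h_gt0 HJ MN HT.
have {}tE : sqnorm t = 1 by rewrite tE divff // gt_eqF //; exact: h_gt0.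
move: (r *: eta) (scale_eta_neq0 rp) E => Y Y0; rewrite act_fib => /base_fib_inj E.
pose q := (sqnorm Y)^-1 *: (lmul_mx (qconj Y) *m (lmul_mx t *m Y)).
have NE : N = lmul_mx q.
  have -> : N = ilmul Y *m lmul_mx t *m lmul_mx Y.
    by rewrite -E !mulmxA ilmulK // mul1mx -mulmxA ilmulK // mulmx1.
  by rewrite /q linearZ /= !lmul_mxM mulmxA /ilmul -!scalemxAl -lmul_mx_tr.
split; first by rewrite {1}NE {1}NE lmul_mx1.
have sY : sqnorm Y != 0 by rewrite sqnorm_eq0.
by rewrite NE lmul_mx1 sqnormZ !sqnorm_lmul sqnorm_conj tE; field.
Qed.

(** With L = r^2 lead, the imaginary part of the transport around the triangle is L s + r^3 rho(s).
    Equating it to that of [q] is the fixed point equation s = L^-1 (Im q - r^3 rho(s)). *)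
Lemma loops_near_one : exists r d, [/\ 0 < r <= r0, 0 < d &
  forall q, sqnorm q = 1 -> 1 - q o0 0 <= d -> loop_in r q].
Proof.
have [r1 [r1I [Q [rem [[C C0 HC] HQ]]]]] :=
  triangle_expansion h_gt0 HJ p_inj k_gt0 c_ge0 a_gt0 eta1 xb_centre r0_gt0 r0_small.
have [r1p r1r0] := andP r1I.
have D0 : 0 < 2 * C + 1 by lra.
(* The quotient by [2 * C + 1] gives r^3 C <= L / 2, so that the map contracts by 1/2; the last term
   keeps the real part of the transport nonnegative. *)
pose r := Num.min r1 (Num.min 1 (Num.min (lead / (2 * C + 1)) (2 * C + 1)^-1)).
have rp : 0 < r by rewrite !lt_min r1p ltr01 divr_gt0 // invr_gt0.
have rr1 : r <= r1 by rewrite ge_min lexx.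
have r_1 : r <= 1 by rewrite !ge_min lexx orbT.
have rC1 : r * (2 * C + 1) <= lead.
  by rewrite -ler_pdivlMr // !ge_min lexx !orbT.
have rC2 : r * (2 * C + 1) <= 1.
  by rewrite -ler_pdivlMr // div1r !ge_min lexx !orbT.
have rI : 0 < r <= r1 by rewrite rp.
have rI0 : 0 < r <= r0 by rewrite rp (le_trans rr1).
pose L := r ^+ 2 * lead; have L0 : 0 < L by rewrite mulr_gt0 // exprn_gt0.
have rL : r ^+ 3 * C <= L / 2.
  have -> : r ^+ 3 * C = r ^+ 2 * (r * C) by rewrite exprSr mulrA.
  rewrite /L -mulrA ler_wpM2l ?sqr_ge0 //.
  by rewrite ler_pdivlMr //; nra.
(* The first bound makes the real part of [q] positive, the second makes its imaginary part at most
   [L / 2], so that the unit ball is mapped into itself. *)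
exists r, (Num.min 2^-1 ((L / 2) ^+ 2 / 2)); split=> //.
  by rewrite lt_min invr_gt0 ltr0n divr_gt0 // exprn_gt0 // divr_gt0.
move=> q q1; rewrite le_min => /andP[qh qd].
have xi : `|imag q| <= L / 2 by apply: imag_small => //; rewrite divr_ge0 // ltW.
pose rho s := imag (rem r s *m qone R).
have I0 : 0 <= (0 : R) <= 1 by rewrite lexx ler01.
have rho1 s : `|s| <= 1 -> `|rho s| <= C.
  move=> s1; have [H _] := HC r 0 s s rI I0 s1 s1.
  exact: le_trans (imag_norm _) (le_trans (col0_norm _) H).
have rhol s s' : `|s| <= 1 -> `|s'| <= 1 -> `|rho s - rho s'| <= C * `|s - s'|.
  move=> s1 s'1; have [_ H] := HC r 0 s s' rI I0 s1 s'1.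
  rewrite /rho /imag -mulmxBr -mulmxBl.
  exact: le_trans (imag_norm _) (le_trans (col0_norm _) H).
have r3 : 0 < r ^+ 3 by rewrite exprn_gt0.
have [||s s1 sE] := @ball_fixed_point R 3 (fun s => L^-1 *: (imag q - r ^+ 3 *: rho s)).
- move=> s s1; rewrite normrZ gtr0_norm ?invr_gt0 // mulrC ler_pdivrMr // mul1r.
  apply: le_trans (ler_normB _ _) _; rewrite normrZ gtr0_norm //.
  have : r ^+ 3 * `|rho s| <= r ^+ 3 * C by rewrite ler_wpM2l ?rho1 // ltW.
  lra.
- move=> s s' s1 s'1; rewrite -scalerBr.
  have -> : imag q - r ^+ 3 *: rho s - (imag q - r ^+ 3 *: rho s') = r ^+ 3 *: (rho s' - rho s).
    by rewrite opprB addrC addrA subrK -scalerBr.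
  rewrite normrZ gtr0_norm ?invr_gt0 // mulrC ler_pdivrMr // normrZ gtr0_norm // (distrC s).
  apply: le_trans (_ : r ^+ 3 * (C * `|s' - s|) <= _).
    by rewrite ler_wpM2l ?rhol // ltW.
  by rewrite mulrA [leRHS]mulrAC ler_wpM2r // [2^-1 * _]mulrC.
have [QE HT] := HQ r s rI s1.
have [NE N1] := loop_unit rI0 HT.
rewrite /loop_in; suff -> : q = Q r s *m qone R by rewrite -NE.
have E : Q r s *m qone R = qone R + L *: emb s + r ^+ 3 *: (rem r s *m qone R).
  by rewrite QE !mulmxDl mul1mx -!scalemxAl lmul_mx1.
apply: imag_inj => //.
- by move: qh; lra.
- have re3 : `|r ^+ 3 * (rem r s *m qone R) o0 0| <= r ^+ 3 * C.
    rewrite normrM gtr0_norm // ler_wpM2l ?(ltW r3) //.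
    have [H _] := HC r 0 s s rI I0 s1 s1.
    exact: le_trans (mx_norm_entry _ _ _) (le_trans (col0_norm _) H).
  have rC : r ^+ 3 * C <= 1.
    have : r ^+ 2 <= 1 by rewrite expr_le1 // ltW.
    by rewrite exprSr -mulrA; have := sqr_ge0 r; nra.
  have : (Q r s *m qone R) o0 0 = 1 + r ^+ 3 * (rem r s *m qone R) o0 0.
    have D (u v : quat) : (u + v) o0 0 = u o0 0 + v o0 0 by rewrite mxE.
    have Z (x : R) (u : quat) : (x *: u) o0 0 = x * u o0 0 by rewrite mxE.
    by rewrite E !D !Z emb0 mulr0 addr0 mxE.
  by move=> ->; move: re3; rewrite ler_norml => /andP[+ _]; lra.
rewrite E /imag !mulmxDr -!scalemxAr -!/(imag _) imag_qone imag_emb add0r -/(rho s).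
by rewrite {1}sE scalerA mulfV ?gt_eqF // scale1r subrK.
Qed.

(** All loops share the base point, so running one twice squares its quaternion. The defect
    [1 - q o0 0] is at most 2, and [m] square roots divide it by at least [2 ^+ m]. *)
Lemma loops_full : exists2 r, 0 < r <= r0 & forall q, sqnorm q = 1 -> loop_in r q.
Proof.
have [r [d [rI d0 H]]] := loops_near_one; exists r => // q q1.
have Y0 : r *: eta != 0 by apply: scale_eta_neq0; case/andP: rI.
suff G m : forall q, sqnorm q = 1 -> 1 - q o0 0 <= 2 ^+ m * d -> loop_in r q.
  apply: (G (Num.bound (2 / d))) => //.
  have : 2 / d <= 2 ^+ Num.bound (2 / d).
    apply: le_trans (_ : (Num.bound (2 / d))%:R <= _).
      by apply/ltW/archi_boundP; rewrite divr_ge0 // ltW.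
    by rewrite -natrX ler_nat ltnW // ltn_expl.
  rewrite ler_pdivrMr //; apply: le_trans.
  by move: q1; rewrite sqnormE; nra.
elim: m => [|m IH] {q1}q q1 qd; first by apply: H => //; rewrite mul1r in qd.
have [s s1 [qE sq]] := sqrt_unit_quat q1.
have Hs : loop_in r s.
  by apply: IH => //; move: qd; rewrite exprS -mulrA; lra.
have := transport_trans Hs Hs; rewrite base_mul /loop_in -qE lmul_mxM; set Y := r *: eta in Y0 *.
by rewrite !mulmxA -[_ *m ilmul Y *m lmul_mx Y]mulmxA ilmulK // mulmx1.
Qed.

End LocalHolonomy.

(** * Holonomy at an arbitrary point *)

Section FullHolonomy.
Variable R : realType.
Local Notation quat := 'cV[R]_4.
Variables (n : nat) (p : 'I_n -> quat) (k : 'I_n -> R) (c a : R).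
Variable J : 'cV[R]_6 -> 'M[R]_6.
Local Notation M := (Mset p).
Local Notation sol := (solution p k c a).
Local Notation h := (hfun p k c a).
Hypothesis n_gt0 : (0 < n)%N.
Hypothesis h_gt0 : forall z, Uset p z -> 0 < h z.
Hypothesis HJ : is_complex_structure (volform sol) M J.
Hypothesis p_inj : injective p.
Hypothesis k_gt0 : forall i, 0 < k i.
Hypothesis c_ge0 : 0 <= c.
Hypothesis a_gt0 : 0 < a.
Hypothesis nonexceptional : ~ (c = 0 /\ n = 1%N).
Local Notation A := (bismut (kform sol) J).

(** The point where the exceptional case [c = 0], [n = 1] is excluded: otherwise [c] or another
    centre contributes a positive term. *)
Lemma hreg_gt0 i0 : 0 < hreg p k c a i0 (p i0).
Proof.
have [c0|c0] := eqVneq c 0; last first.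
  rewrite /hreg ltr_pwDl ?lt_def ?c0 // mulr_ge0 ?(ltW a_gt0) // sumr_ge0 // => i _.
  by rewrite divr_ge0 ?sqnorm_ge0 // ltW.
have [i ii0] : exists i, i != i0.
  case: (pickP (fun i => i != i0)) => [i ii0|one]; first by exists i.
  exfalso; apply: nonexceptional; split=> //; rewrite -(card_ord n) -(card1 i0); apply: eq_card => i.
  by have /negbFE := one i; rewrite inE.
rewrite /hreg c0 add0r mulr_gt0 // (bigD1 i) //= ltr_pwDl //.
  by rewrite divr_gt0 // sqnorm_gt0 // subr_eq0; apply: contra ii0 => /eqP/p_inj ->.
by rewrite sumr_ge0 // => j _; rewrite divr_ge0 ?sqnorm_ge0 // ltW.
Qed.

Lemma lead_gt0 i0 : 0 < lead p k c a i0.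
Proof. by rewrite divr_gt0 ?hreg_gt0 ?mulr_gt0. Qed.

Lemma full_holonomy x (q : quat) : M x -> sqnorm q = 1 -> transport M A x x (act q).
Proof.
move=> Mx q1; pose z := prC2 x.
have [i0 near0] : exists i0, forall i, sqnorm (z - p i0) <= sqnorm (z - p i).
  case: (@arg_minP _ R _ (Ordinal n_gt0) predT (fun i => sqnorm (z - p i))) => // i _ Hi.
  by exists i => j; exact: Hi.
pose w := z - p i0; have sw : 0 < sqnorm w.
  by rewrite lt_def sqnorm_ge0 (Uset_sqnorm i0 Mx).
pose d := Num.sqrt (sqnorm w); have d0 : 0 < d by rewrite sqrtr_gt0.
have d2 : d ^+ 2 = sqnorm w by rewrite sqr_sqrtr // ltW.
pose eta := d^-1 *: w; have eta1 : sqnorm eta = 1.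
  by rewrite sqnormZ exprVn d2 mulVf // gt_eqF.
have wE : w = d *: eta by rewrite scalerA mulfV ?scale1r // gt_eqF.
pose xb := x - fib_vec w; have xbE : prC2 xb = p i0.
  by rewrite linearB /= prC2_fib_vec opprB addrC subrK.
have s0 := sep_gt0 p i0; pose r0 := Num.min d (Num.min 1 (sep p i0 / 28)).
have r0p : 0 < r0 by rewrite !lt_min d0 ltr01 divr_gt0.
have r0d : r0 <= d by rewrite ge_min lexx.
have r0s : 28 * r0 ^+ 2 <= sep p i0.
  have r01 : r0 <= 1 by rewrite !ge_min lexx orbT.
  have : r0 <= sep p i0 / 28 by rewrite !ge_min lexx !orbT.
  by rewrite ler_pdivlMr // => ?; nra.
have [r /andP[rp rr0] loops] := loops_full h_gt0 HJ p_inj k_gt0 c_ge0 a_gt0 eta1 xbE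
  r0p r0s (lead_gt0 i0).
have rI : 0 < r <= r0 by rewrite rp.
have Mx0 := node_M p_inj eta1 xbE r0p r0s rI.
set x0 := node eta xb r (qone R) in loops Mx0.
have x0E : prC2 x0 = p i0 + r *: eta by rewrite /x0 (prC2_node _ xbE) /ray_pt lmul_mx1.
have zE : z = p i0 + d *: eta by rewrite -wE addrC subrK.
have rd : r <= d by exact: le_trans r0d.
(* Another centre on the ray would lie at distance d - rho < d from [z], against the choice of
   [i0]. *)
have ray rho : 0 < rho <= d -> Uset p (p i0 + rho *: eta).
  move=> /andP[rho0 rhod] i E; have [ii0|ii0] := eqVneq i i0.
    move: E; rewrite ii0 -[RHS]addr0 => /addrI /eqP; rewrite -sqnorm_eq0 sqnormZ eta1 mulr1.
    by rewrite sqrf_eq0 gt_eqF.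
  have := near0 i; rewrite -/w -d2 -E zE opprD addrACA subrr add0r -scalerBl sqnormZ eta1.
  by rewrite mulr1; nra.
have dx0 : x0 = x + fib_vec ((r - d) *: eta).
  rewrite /x0 /node lmul_mx1 /xb -addrA; congr (_ + _).
  by rewrite /fib_vec -mulmxN -mulmxDr scalerBl -wE addrC.
have dx : x = x0 + fib_vec ((d - r) *: eta).
  by rewrite dx0 -addrA /fib_vec -mulmxDr -scalerDl subrKA subrr scale0r mulmx0 addr0.
have [|P [_ _ TP]] := segment_transport h_gt0 HJ (x := x) (v := (r - d) *: eta) Mx.
  move=> t /andP[t0 t1]; rewrite -/z zE [t *: _]scalerA -addrA -scalerDl; apply: ray.
  by apply/andP; split; nra.
have [|S [_ _ TS]] := segment_transport h_gt0 HJ (x := x0) (v := (d - r) *: eta) Mx0.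
  move=> t /andP[t0 t1]; rewrite x0E [t *: _]scalerA -addrA -scalerDl; apply: ray.
  by apply/andP; split; nra.
rewrite -dx0 in TP; rewrite -dx in TS.
have [_ [tau tauE tau1]] := transport_act h_gt0 HJ Mx TP.
have [_ [sig sigE sig1]] := transport_act h_gt0 HJ Mx0 TS.
rewrite tauE in TP; rewrite sigE in TS.
have hx : h (prC2 x) != 0 by rewrite gt_eqF //; exact: h_gt0.
have hx0 : h (prC2 x0) != 0 by rewrite gt_eqF //; exact: h_gt0.
have sigtau : sqnorm sig * sqnorm tau = 1 by rewrite sig1 tau1; field; rewrite hx hx0.
pose Y := r *: eta; have Y0 : Y != 0 by exact: scale_eta_neq0.
have sY : sqnorm Y != 0 by rewrite sqnorm_eq0.
(* [tau] and [sig], the transports to the node and back, need not be units, but |sig|^2 |tau|^2 = 1.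
   Conjugates thus replace inverses: sig u tau = q. [q'] is this [u] expressed in the frame at the
   node. *)
pose u := lmul_mx (qconj sig) *m (lmul_mx q *m qconj tau).
pose q' := (sqnorm Y)^-1 *: (lmul_mx (qconj Y) *m (lmul_mx u *m Y)).
have u1 : sqnorm u = 1 by rewrite !sqnorm_lmul !sqnorm_conj q1 mul1r.
have q'1 : sqnorm q' = 1.
  by rewrite sqnormZ sqnorm_lmul sqnorm_conj sqnorm_lmul u1; field.
have q'E : lmul_mx Y *m lmul_mx q' *m ilmul Y = lmul_mx u.
  have -> : lmul_mx q' = ilmul Y *m lmul_mx u *m lmul_mx Y.
    by rewrite [LHS]linearZ /= !lmul_mxM mulmxA /ilmul -!scalemxAl -lmul_mx_tr.
  by rewrite !mulmxA lmulK // mul1mx -mulmxA lmulK // mulmx1.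
have := loops q' q'1; rewrite /loop_in -/Y q'E -act_fib => TL.
have := transport_trans TP (transport_trans TL TS); rewrite !act_mul.
suff -> : lmul_mx (lmul_mx sig *m u) *m tau = q by [].
apply: lmul_mx_inj; rewrite /u !lmul_mxM -!lmul_mx_tr !mulmxA lmul_mxKr -!mulmxA.
by rewrite lmul_mxK !mul_mx_scalar mul_scalar_mx scalerA sigtau scale1r.
Qed.

Lemma holonomy_SU2 x : M x -> holonomy M A x = SU2_in_SU3 (R := R).
Proof.
move=> Mx; rewrite SU2_in_SU3_act; apply/seteqP; split=> [T HT|_ [q q1 <-]].
  have [_ [q -> qE]] := transport_act h_gt0 HJ Mx HT; exists q => //=.
  by rewrite qE divff // gt_eqF //; exact: h_gt0.
exact: full_holonomy.
Qed.

End FullHolonomy.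

(** * Curvature *)

Section Flatness.
Variable R : realType.
Local Notation quat := 'cV[R]_4.
Variables (n : nat) (p : 'I_n -> quat) (k : 'I_n -> R) (c a : R).
Variable J : 'cV[R]_6 -> 'M[R]_6.
Local Notation M := (Mset p).
Local Notation sol := (solution p k c a).
Local Notation h := (hfun p k c a).
Local Notation grad := (hgrad p k a).
Local Notation hess := (hhess p k a).
Hypothesis h_gt0 : forall z, Uset p z -> 0 < h z.
Hypothesis HJ : is_complex_structure (volform sol) M J.
Local Notation A := (bismut (kform sol) J).
Local Notation conn4 := (conn4 p k c a).

Definition dconn4 (z v w : quat) : 'M[R]_4 :=
  (2 * h z)^-1 *: (lmul_mx w *m (lmul_mx (hess z v))^T)
  - (dotp (grad z) v / h z) *: conn4 z w.

Lemma derive_bismut x X Y : M x ->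
  'D_X (fun y => A y Y) x = fib R *m dconn4 (prC2 x) (prC2 X) (prC2 Y) *m (fib R)^T.
Proof.
move=> Mx; rewrite (@near_eq_derive _ _ _ _
    (fun y => fib R *m conn4 (prC2 y) (prC2 Y) *m (fib R)^T)); last first.
  by near=> y; apply: bismut_fib => //; near: y; exact: Mset_open.
have HZ := @is_derive_prC2 _ _ id x X X (is_derive_id x X).
have H1 := is_derive_conn4 h_gt0 (prC2 Y) Mx HZ.
have H2 := is_derive_mulmx (is_derive_mulmx (is_derive_cst (fib R) x X) H1)
  (is_derive_cst (fib R)^T x X).
by rewrite (@derive_val _ _ _ _ _ _ _ H2) mul0mx add0r mulmx0 addr0.
Unshelve. all: by end_near. Qed.

Lemma flat_fibre z v w : flat M A -> Uset p z ->
  dconn4 z v w - dconn4 z w v + (conn4 z v *m conn4 z w - conn4 z w *m conn4 z v) = 0.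
Proof.
move=> H Uz; have Mz : M (fib_vec z) by rewrite /Mset /= prC2_fib_vec.
have := H _ Mz (fib_vec v) (fib_vec w).
rewrite /curvature !derive_bismut // !bismut_fib // !prC2_fib_vec.
move=> /(congr1 (fun N => (fib R)^T *m N *m fib R)); rewrite mulmx0 mul0mx.
have K (N : 'M[R]_4) : (fib R)^T *m (fib R *m N *m (fib R)^T) *m fib R = N.
  by rewrite !mulmxA fib_trK mul1mx -mulmxA fib_trK mulmx1.
have B (N N' : 'M[R]_4) : (fib R *m N *m (fib R)^T) *m (fib R *m N' *m (fib R)^T) =
    fib R *m (N *m N') *m (fib R)^T.
  by rewrite !mulmxA -[_ *m (fib R)^T *m fib R]mulmxA fib_trK mulmx1.
have C (N1 N2 N3 N4 : 'M[R]_4) : fib R *m N1 *m (fib R)^T - fib R *m N2 *m (fib R)^T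
    + (fib R *m N3 *m (fib R)^T - fib R *m N4 *m (fib R)^T) =
    fib R *m (N1 - N2 + (N3 - N4)) *m (fib R)^T.
  by rewrite -!mulmxBl -!mulmxBr -mulmxDl -mulmxDr.
by rewrite !B C K.
Qed.

Definition qi : quat := delta_mx o1 0.

(* The component of the curvature along [qone], [qi] that sees the Laplacian of
   h restricted to that plane. *)
Lemma flat_hess z : flat M A -> Uset p z ->
  h z * (hess z (qone R) o0 0 + hess z qi o1 0) =
  grad z o0 0 ^+ 2 + grad z o1 0 ^+ 2 - grad z o2 0 ^+ 2 - grad z o3 0 ^+ 2.
Proof.
move=> H Uz; have hz : h z != 0 by rewrite gt_eqF //; exact: h_gt0.
have := flat_fibre (qone R) qi H Uz.
rewrite /dconn4 /conn4; set u := hess z (qone R); set v := hess z qi; set g := grad z.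
rewrite lmul_mx_qone !mul1mx; set G := (lmul_mx g)^T; set W := lmul_mx qi.
have GG : G *m G = (2 * g o0 0) *: G - (sqnorm g)%:M.
  have := lmul_sandwich g (qone R); rewrite lmul_mx_qone mulmx1 trmx1 scalemx1 -/G => ->.
  by congr (_ *: _ - _); rewrite dotpE !mxE /=; ring.
have GWG : G *m W *m G = (2 * g o1 0) *: G - sqnorm g *: W^T.
  by rewrite lmul_sandwich; congr (_ *: _ - _); rewrite dotpE !mxE /=; ring.
rewrite -!scalemxAl -!scalemxAr !scalerA mulmxA GWG -[W *m G *m G]mulmxA GG mulmxBr -scalemxAr.
rewrite mul_mx_scalar.
have WX (x : quat) : (W *m (lmul_mx x)^T) o1 o0 = x o0 0.
  by rewrite mxE sum_ord4 !mxE /=; ring.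
have GT (x : quat) : ((lmul_mx x)^T) o1 o0 = - x o1 0 by rewrite !mxE.
have D (X Y : 'M[R]_4) : (X + Y) o1 o0 = X o1 o0 + Y o1 o0 by rewrite mxE.
have Z (x : R) (X : 'M[R]_4) : (x *: X) o1 o0 = x * X o1 o0 by rewrite mxE.
have N (X : 'M[R]_4) : (- X) o1 o0 = - X o1 o0 by rewrite mxE.
have W10 : W o1 o0 = 1 by rewrite !mxE.
have [E0 E1 E2 E3] : [/\ qone R o0 0 = 1, qone R o1 0 = 0, qone R o2 0 = 0 & qone R o3 0 = 0].
  by split; rewrite mxE.
have [F0 F1 F2 F3] : [/\ qi o0 0 = 0, qi o1 0 = 1, qi o2 0 = 0 & qi o3 0 = 0].
  by split; rewrite mxE.
(* The [qi]-component of the curvature applied to [qone]. *)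
move=> /(congr1 (fun N : 'M[R]_4 => N o1 o0)).
rewrite !(D, Z, N) !WX !GT W10 [(0 : 'M[R]_4) _ _]mxE !dotpE sqnormE.
rewrite E0 E1 E2 E3 F0 F1 F2 F3.
move: (g o0 0) (g o1 0) (g o2 0) (g o3 0) (u o0 0) (v o1 0) (h z) hz => g0 g1 g2 g3 x y t t0 E.
apply/eqP; rewrite -subr_eq0; apply/eqP.
by rewrite -[RHS](mulr0 (2 * t ^+ 2)) -E; field.
Qed.

Lemma hess_plane z : hess z (qone R) o0 0 + hess z qi o1 0 =
  \sum_i a * k i * (8 * ((z - p i) o0 0 ^+ 2 + (z - p i) o1 0 ^+ 2) / sqnorm (z - p i) ^+ 3
    - 4 / sqnorm (z - p i) ^+ 2).
Proof.
rewrite /hhess !summxE -big_split /=; apply: eq_bigr => i _.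
rewrite !dotpE; move: (z - p i) (sqnorm (z - p i)) => u s.
by rewrite !mxE /=; ring.
Qed.

Hypothesis p_inj : injective p.
Hypothesis k_gt0 : forall i, 0 < k i.
Hypothesis a_gt0 : 0 < a.
Variable i0 : 'I_n.
Hypothesis hreg_gt0 : 0 < hreg p k c a i0 (p i0).

Definition hess_rest (z : quat) : R := \sum_(i | i != i0) a * k i *
  (8 * (dotp (qone R) (z - p i) * dotp (qone R) (z - p i) + dotp qi (z - p i) * dotp qi (z - p i))
     * ((sqnorm (z - p i))^-1 * ((sqnorm (z - p i))^-1 * (sqnorm (z - p i))^-1))
   - 4 * ((sqnorm (z - p i))^-1 * (sqnorm (z - p i))^-1)).

Definition flat_rest (r : R) (z : quat) : R :=
  let g := gradreg p k a i0 z in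
  4 * (a * k i0) * (slope p k a i0 (qone R) r (qone R) + dotp (qone R) g)
  + r * (a * k i0 * hess_rest z)
  + r * (r * r) * (hreg p k c a i0 z * hess_rest z
     - (dotp (qone R) g * dotp (qone R) g + dotp qi g * dotp qi g
        - dotp (delta_mx o2 0) g * dotp (delta_mx o2 0) g
        - dotp (delta_mx o3 0) g * dotp (delta_mx o3 0) g)).

Lemma dotp_delta (j : 'I_4) (u : quat) : dotp (delta_mx j 0) u = u j 0.
Proof.
rewrite /dotp (bigD1 j) //= big1 => [|l lj]; first by rewrite mxE !eqxx mul1r addr0.
by rewrite mxE (negbTE lj) mul0r.
Qed.

(** With K = a k_i0, both sides of [flat_hess] at p_i0 + r begin with 4 K^2 / r^6, which cancels
    because a single pole is flat. Multiplying the rest by r^4 leaves 4 K hreg(p_i0) plus r times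
    [flat_rest]. *)
Lemma flat_expansion r : flat M A -> 0 < r -> 28 * r ^+ 2 <= sep p i0 ->
  4 * (a * k i0) * hreg p k c a i0 (p i0) =
  - (r * flat_rest r (ray_pt p i0 (qone R) r (qone R))).
Proof.
move=> H rp rs; set z := ray_pt _ _ _ _ _.
have e1 := sqnorm_qone R.
have dq (u : quat) : dotp (qone R) u = u o0 0 by exact: dotp_delta.
have dqi (u : quat) : dotp qi u = u o1 0 by exact: dotp_delta.
have Uz : Uset p z.
  have := @point_U R n p i0 p_inj (qone R) e1 r (1, 0) 0; rewrite vertex0 scale1r; apply=> //.
    by rewrite /admissible /=; apply/andP; split; apply/andP; split; lra.
  by rewrite normr0.
have zi : z - p i0 = r *: qone R by rewrite point_sub lmul_mx1.
have s0 : sqnorm (z - p i0) = r ^+ 2 by rewrite zi sqnormZ e1 mulr1.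
have E := flat_hess H Uz; move: E; rewrite hess_plane.
rewrite (bigD1 i0) //= (_ : \sum_(i | i != i0) _ = hess_rest z); last first.
  apply: eq_bigr => i _; rewrite !(dq, dqi).
  by rewrite [_ ^+ 3]exprS expr2 !invfM; ring.
rewrite (hfun_split _ _ _ _ i0) (hgrad_split _ _ _ i0) s0.
rewrite /flat_rest /=.
have hE : hreg p k c a i0 z = hreg p k c a i0 (p i0) + r * slope p k a i0 (qone R) r (qone R).
  by apply: hreg_slope => //; rewrite e1; lra.
rewrite hE; move: (hreg _ _ _ _ _ _) (hess_rest z) (slope _ _ _ _ _ _ _) => y rho sl.
rewrite !(dq, dqi, dotp_delta); move: (gradreg _ _ _ _ _) => g.
rewrite zi; have D (u v : quat) j : (u + v) j 0 = u j 0 + v j 0 by rewrite mxE.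
have Z (x : R) (u : quat) j : (x *: u) j 0 = x * u j 0 by rewrite mxE.
have [E0 E1 E2 E3] : [/\ qone R o0 0 = 1, qone R o1 0 = 0, qone R o2 0 = 0 & qone R o3 0 = 0].
  by split; rewrite mxE.
rewrite !(D, Z) E0 E1 E2 E3.
move: (g o0 0) (g o1 0) (g o2 0) (g o3 0) => g0 g1 g2 g3 E.
have r0 : r != 0 by rewrite gt_eqF.
apply/eqP; rewrite -subr_eq0; apply/eqP; move/eqP: E; rewrite -subr_eq0 => /eqP E.
by rewrite -[RHS](mulr0 (r ^+ 4)) -E; field.
Qed.

Lemma not_flat : ~ flat M A.
Proof.
move=> H; have e1 := sqnorm_qone R; have s0 := sep_gt0 p i0.
pose r0 := Num.min 1 (sep p i0 / 28).
have r0p : 0 < r0 by rewrite lt_min ltr01 divr_gt0.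
have r0s : 28 * r0 ^+ 2 <= sep p i0.
  have r01 : r0 <= 1 by rewrite ge_min lexx.
  have : r0 <= sep p i0 / 28 by rewrite ge_min lexx orbT.
  by rewrite ler_pdivlMr // => ?; nra.
(* The degenerate edge from 1 to 1 makes the estimates for edges apply to the single point p_i0 +
   r. *)
pose ab : R * R := (1, 0); have adm : admissible ab.
  by rewrite /admissible /=; apply/andP; split; apply/andP; split; lra.
have edge1 t s : edge ab ab t s = qone R.
  by rewrite /edge subrr scaler0 addr0 vertex0 scale1r.
pose Z r t s := ray_pt p i0 (qone R) r (edge ab ab t s).
have uu i : ulip r0 (fun r t s => Z r t s - p i) by exact: ulip_point.
have ui i : i != i0 -> ulip r0 (fun r t s => (sqnorm (Z r t s - p i))^-1).
  exact: ulip_inv_point.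
have ud (w : quat) f : ulip r0 f -> ulip r0 (fun r t s => dotp w (f r t s) : R).
  by move=> uf; apply: ulip_dotp => //; exact: ulip_cst.
have ug : ulip r0 (fun r t s => gradreg p k a i0 (Z r t s)) by exact: ulip_gradreg.
have uD (w : quat) f : ulip r0 f -> ulip r0 (fun r t s => dotp w (f r t s) * dotp w (f r t s) : R).
  by move=> uf; apply: ulip_mul; exact: ud.
have uh : ulip r0 (fun r t s => hess_rest (Z r t s)).
  apply: ulip_sum => i ii0; apply: ulip_mul; first exact: ulip_cst.
  have u2 := ulip_mul (ui i ii0) (ui i ii0).
  apply: ulip_add.
    apply: ulip_mul; last by apply: ulip_mul => //; exact: ui.
    by apply: ulip_mul; [exact: ulip_cst|apply: ulip_add; exact: uD].
  by apply: ulip_opp; apply: ulip_mul => //; exact: ulip_cst.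
have us := @ulip_scale R r0.
have [C C0 HC] : ulip r0 (fun r t s => flat_rest r (Z r t s)).
  apply: ulip_add; first apply: ulip_add.
  - apply: ulip_mul; first exact: ulip_cst.
    apply: ulip_add; last exact: ud.
    apply: ulip_ext (@ulip_slope _ _ p k a i0 p_inj _ e1 _ _ _ adm adm r0p r0s).
    by move=> r t s _ _ _; rewrite edge1.
  - by apply: ulip_mul => //; apply: ulip_mul => //; exact: ulip_cst.
  apply: ulip_mul; first by do 2!apply: ulip_mul => //.
  apply: ulip_add.
    by apply: ulip_mul => //; exact: ulip_hreg.
  apply: ulip_opp; do 2!(apply: ulip_add; last by apply/ulip_opp/uD).
  by apply: ulip_add; exact: uD.
pose y := 4 * (a * k i0) * hreg p k c a i0 (p i0).
have y0 : 0 < y by rewrite !mulr_gt0.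
have C1 : 0 < C + 1 by lra.
(* For this [r] flatness would give y <= r C < r (C + 1) <= y. *)
pose r := Num.min r0 (y / (C + 1)).
have rp : 0 < r by rewrite lt_min r0p divr_gt0.
have rr0 : r <= r0 by rewrite ge_min lexx.
have rC : r * (C + 1) <= y by rewrite -ler_pdivlMr // ge_min lexx orbT.
have rs : 28 * r ^+ 2 <= sep p i0.
  apply: le_trans r0s; rewrite ler_wpM2l //.
  by rewrite ler_pXn2r ?nnegrE ?(ltW rp) ?(ltW r0p).
have rI : 0 < r <= r0 by rewrite rp.
have I0 : 0 <= (0 : R) <= 1 by rewrite lexx ler01.
have s1 : `|0 : 'cV[R]_3| <= 1 by rewrite normr0.
have [+ _] := HC r 0 0 0 rI I0 s1 s1; have := flat_expansion H rp rs.
rewrite /Z edge1 -/y ler_norml => yE /andP[fC _].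
by have : r * - C <= r * flat_rest r (ray_pt p i0 (qone R) r (qone R)); [rewrite ler_wpM2l // ltW|lra].
Qed.

End Flatness.

Unset Implicit Arguments.
Set Strict Implicit.
Set Printing Implicit Defensive.

Theorem proposition3p3 (R : realType) (n : nat) (p : 'I_n -> 'cV[R]_4)
    (k : 'I_n -> R) (c a : R) (J : 'cV[R]_6 -> 'M[R]_6) :
  (1 <= n)%N ->
  injective p ->
  (forall i, 0 < k i) ->
  0 <= c -> 0 <= a ->
  (forall z, Uset p z -> 0 < hfun p k c a z) ->
  let M := Mset p in
  let sol := solution p k c a in
  is_complex_structure (volform sol) M J ->
  let nablaB := bismut (kform sol) J in
  let exceptional := a = 0 \/ (c = 0 /\ n = 1%N) in
  (exceptional -> forall x, M x -> holonomy M nablaB x = [set 1%:M]) /\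
  (~ exceptional ->
     (forall x, M x -> holonomy M nablaB x = SU2_in_SU3 (R := R)) /\
     ~ flat M nablaB).
Proof.
move=> n_gt0 p_inj k_gt0 c_ge0 a_ge0 h_gt0 M sol HJ nablaB exceptional; split.
  move=> exc x Mx; have [a0|a0] := eqVneq a 0.
    exact: (holonomy_a0 h_gt0 HJ).
  case: exc => [aE|[c0 n1]]; first by rewrite aE eqxx in a0.
  exact: (holonomy_one h_gt0 HJ).
move=> nexc; have a_gt0 : 0 < a.
  by rewrite lt_neqAle a_ge0 andbT; apply/eqP => a0; apply: nexc; left.
have nexc' : ~ (c = 0 /\ n = 1%N) by move=> E; apply: nexc; right.
split=> [x Mx|]; first exact: (holonomy_SU2 n_gt0 h_gt0 HJ).
have i0 : 'I_n := Ordinal n_gt0.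
exact: (not_flat h_gt0 HJ p_inj k_gt0 a_gt0 (hreg_gt0 p_inj k_gt0 c_ge0 a_gt0 nexc' i0)).
Qed.
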